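(* Let $\rho_0:[0,\pi]\to(0,\infty)$ be the equilibrium profile (case $\theta_1=\theta_2=0$), i.e. a minimizer of $$E(\rho)=\frac{g}{3}\int_{0}^{\pi}\rho^{3}\sin\theta\,d\theta+\sigma\int_{0}^{\pi}\sqrt{\rho^{2}+\rho'^{2}}\,d\theta-[\![\gamma]\!]\bigl(\rho(0)+\rho(\pi)\bigr)$$ subject to $\int_0^\pi\rho^2\,d\theta=V$. Let $\xi_s$ be its horizontal shifting function and $E''(\rho_0)$ the second variation of $E$ at $\rho_0$ (both defined in the context). Then: (1) $\xi_s$ is given explicitly by $$\xi_s(\theta)=\cos\theta+\frac{\rho_0'(\theta)}{\rho_0(\theta)}\sin\theta .$$ (2) Let $\xi\in H^1(0,\pi)$ satisfy $\int_0^\pi\xi\rho_0\,d\theta=0$. Then $E''(\rho_0)(\xi,\xi)=0$ if and only if $\xi=C\xi_s$ for some constant $C$. In other words, $\ker\{E''(\rho_0)\}=\operatorname{span}\{\xi_s\}$.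
   Context: Parameters: $g>0$, $\sigma>0$, $V>0$, $[\![\gamma]\!]\in\mathbb{R}$ with $|[\![\gamma]\!]|<\sigma$. The equilibrium profile $\rho_0$ is smooth, positive and centred at the pole, i.e. $\rho_0(\pi-\theta)=\rho_0(\theta)$; being a constrained minimizer it satisfies, for a constant $P_0$, $$g\rho_0^2\sin\theta+\sigma\frac{\rho_0}{\sqrt{\rho_0^2+\rho_0'^2}}-\sigma\,\partial_\theta\frac{\rho_0'}{\sqrt{\rho_0^2+\rho_0'^2}}=P_0\rho_0\ \text{ on }(0,\pi),\qquad \frac{\sigma\rho_0'}{\sqrt{\rho_0^2+\rho_0'^2}}(\pi)=[\![\gamma]\!],\quad \frac{\sigma\rho_0'}{\sqrt{\rho_0^2+\rho_0'^2}}(0)=-[\![\gamma]\!].$$ Horizontal shifting function: for small $c$ let $\rho_{0,c}(\theta)$ be the polar representation (about the origin) of the curve $\{(\rho_0(\theta)\cos\theta+c,\ \rho_0(\theta)\sin\theta):\theta\in[0,\pi]\}$, i.e. the equilibrium curve translated horizontally by $c$. Then $\xi_s(\theta):=\frac{d}{dc}\big|_{c=0}\rho_{0,c}(\theta)$. Second variation (taken along variations preserving $\int_0^\pi\rho^2$): $E''(\rho_0)$ is the symmetric bilinear form with quadratic form $$E''(\rho_0)(\xi,\xi)=g\int_0^\pi\rho_0\xi^2\sin\theta\,d\theta+\sigma\int_0^\pi\left(-\frac{\rho_0^2+2\rho_0'^2-\rho_0''\rho_0}{(\rho_0^2+\rho_0'^2)^{3/2}}\xi^2+\frac{\xi^2+\xi'^2}{(\rho_0^2+\rho_0'^2)^{1/2}}-\frac{(\rho_0\xi+\rho_0'\xi')^2}{(\rho_0^2+\rho_0'^2)^{3/2}}\right)d\theta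 .$$ $\ker\{E''(\rho_0)\}$ denotes the set of $\xi\in H^1(0,\pi)$ with $\int_0^\pi\xi\rho_0\,d\theta=0$ and $E''(\rho_0)(\xi,\xi)=0$. *)

(* Defs.v *)
From HB Require Import structures.
From mathcomp Require Import all_boot all_order all_algebra.
From mathcomp Require Import all_classical all_reals all_analysis.

Set Implicit Arguments.
Unset Strict Implicit.
Unset Printing Implicit Defensive.

Import Order.TTheory GRing.Theory Num.Theory.
Import numFieldNormedType.Exports.

Local Open Scope classical_set_scope.
Local Open Scope ring_scope.

(* In ring_scope these denote by default the formal derivatives of polynomials. *)
Local Notation "f ^` ()" := (derive1 f) : ring_scope.
Local Notation "f ^` ( n )" := (derive1n n f) : ring_scope.

(* Functions on [0, pi] are represented by functions R -> R of which only the
   values on [0, pi] matter.  Derivatives are taken at interior points only and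
   all integrals are over the open interval. *)

Notation "'\int0pi' f" :=
  (Rintegral (@lebesgue_measure _) `]0, pi[%classic f) (at level 10, f at level 9).

Section Regularity.
Context {R : realType}.
Implicit Types f r : R -> R.

(* f belongs to C^k([0, pi]): f is continuous on [0, pi], and its derivatives of
   order 1, ..., k exist on ]0, pi[ and extend continuously to [0, pi]. *)
Definition Ck_0pi (k : nat) f : Prop :=
  {within `[0, pi], continuous f} /\
  forall j, (j < k)%N ->
    (forall t, t \in `]0, pi[ -> derivable (f^`(j)) t 1) /\
    exists h : R -> R, {within `[0, pi], continuous h} /\
      forall t, t \in `]0, pi[ -> f^`(j.+1) t = h t.

Definition smooth_0pi f : Prop := forall k, Ck_0pi k f.

Definition positive_0pi r : Prop := forall t, t \in `[0, pi] -> 0 < r t.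

End Regularity.

Section Sobolev.
Context {R : realType}.
Implicit Types f xi eta phi : R -> R.

Definition L2_0pi f : Prop :=
  measurable_fun `]0, pi[ f /\
  (@lebesgue_measure R).-integrable `]0, pi[ (fun t => (f t ^+ 2)%:E).

(* Test functions: C^1 on the line, compactly supported in ]0, pi[. *)
Definition test_function phi : Prop :=
  [/\ forall t, derivable phi t 1, continuous phi^`() &
    exists a b : R, [/\ 0 < a, b < pi & forall t, t \notin `[a, b] -> phi t = 0]].

Definition is_weak_derivative xi eta : Prop :=
  forall phi, test_function phi ->
    \int0pi (fun t => xi t * phi^`() t) = - \int0pi (fun t => eta t * phi t).

Definition H1_0pi xi : Prop :=
  L2_0pi xi /\ exists eta, L2_0pi eta /\ is_weak_derivative xi eta.

(* A representative of the weak derivative of an element of H^1(0, pi), which is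
   unique up to a null set; 0 outside H^1(0, pi). *)
Definition weak_derivative xi : R -> R :=
  xget (fun=> 0) [set eta | L2_0pi eta /\ is_weak_derivative xi eta].

End Sobolev.

Section Droplet.
Context {R : realType}.
Variables (g sigma V gamma : R).
Implicit Types r rho xi zeta : R -> R.

Definition energy rho : R :=
  g / 3 * \int0pi (fun t => rho t ^+ 3 * sin t)
  + sigma * \int0pi (fun t => Num.sqrt (rho t ^+ 2 + rho^`() t ^+ 2))
  - gamma * (rho 0 + rho pi).

Definition admissible rho : Prop :=
  [/\ Ck_0pi 1 rho, positive_0pi rho & \int0pi (fun t => rho t ^+ 2) = V].

Definition constrained_minimizer rho : Prop :=
  admissible rho /\ forall r, admissible r -> energy rho <= energy r.

Definition equilibrium_profile rho : Prop :=
  [/\ smooth_0pi rho, positive_0pi rho,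
      forall t, t \in `[0, pi] -> rho (pi - t) = rho t
    & constrained_minimizer rho].

(* The curve with polar equation r, in Cartesian coordinates. *)
Definition polar_curve r : set (R * R) :=
  [set (r t * cos t, r t * sin t) | t in `[0, pi]].

Definition is_shifted_profile rho (c : R) r : Prop :=
  positive_0pi r /\
  polar_curve r = [set (rho t * cos t + c, rho t * sin t) | t in `[0, pi]].

(* The values on [0, pi] are determined by is_shifted_profile; the default rho is
   taken when the translated curve has no polar representation. *)
Definition shifted_profile rho (c : R) : R -> R :=
  xget rho [set r | is_shifted_profile rho c r].

Definition horizontal_shift rho : R -> R :=
  fun t => (fun c => shifted_profile rho c t)^`() 0.

(* The quadratic form xi |-> E''(rho)(xi, xi) on H^1(0, pi), where
   Num.sqrt q ^+ 3 stands for q to the power 3/2. *)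
Definition second_variation rho xi : R :=
  let dxi := weak_derivative xi in
  let q t := rho t ^+ 2 + rho^`() t ^+ 2 in
  g * \int0pi (fun t => rho t * xi t ^+ 2 * sin t)
  + sigma * \int0pi (fun t =>
      - ((rho t ^+ 2 + 2 * rho^`() t ^+ 2 - rho^`(2) t * rho t)
         / Num.sqrt (q t) ^+ 3) * xi t ^+ 2
      + (xi t ^+ 2 + dxi t ^+ 2) / Num.sqrt (q t)
      - (rho t * xi t + rho^`() t * dxi t) ^+ 2 / Num.sqrt (q t) ^+ 3).

Definition second_variation_ker rho : set (R -> R) :=
  [set xi | [/\ H1_0pi xi, \int0pi (fun t => xi t * rho t) = 0
              & second_variation rho xi = 0]].

(* The line spanned by zeta, up to equality almost everywhere on ]0, pi[. *)
Definition ae_span zeta : set (R -> R) :=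
  [set xi | measurable_fun `]0, pi[ xi /\
    exists C : R, {ae @lebesgue_measure R, forall t : R,
      t \in `]0, pi[ -> xi t = C * zeta t}].

End Droplet.

(* Main.v *)
Require Import Defs.
From HB Require Import structures.
From mathcomp Require Import all_boot all_order all_algebra.
From mathcomp Require Import all_classical all_reals all_analysis.
From mathcomp Require Import measurable_realfun.
From mathcomp Require Import ring lra.
Import Order.TTheory GRing.Theory Num.Theory.
Import numFieldNormedType.Exports.
Local Open Scope classical_set_scope.
Local Open Scope ring_scope.
Set Implicit Arguments.
Unset Strict Implicit.
Unset Printing Implicit Defensive.

(** Let (x, y) = (rho cos, rho sin) be the equilibrium curve and u = xi / rho.

    Translations.  The point of parameter s, shifted by c, lies on the ray of
    angle t exactly when c = rho(s) sin(s - t) / sin t, and its radius is then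
    rho(s) sin s / sin t.  Both are explicit in s, so the derivative of the
    radius with respect to c is a quotient of two derivatives at s = t
    ([shifted_profile_derive]).  For small c the polar angle is monotone along
    the shifted curve, which makes that curve a polar graph ([on_ray_inj]).

    Equilibrium.  Comparing rho with (rho + e z) rescaled to the same volume
    gives the Euler-Lagrange equation sigma * curvature = P - g y
    ([minimizer_drop_profile]).  This pendulum equation for the tangent angle
    has a first integral, which gives P - g y > 0 along the whole drop and
    shows that y' vanishes at the apex only ([press_gt0], [tany_sign]).

    Second variation.  Through the equilibrium equation, E''(xi, xi) becomes
    Q(u) = int a u'^2 + b u^2 with a = sigma rho^4 / (rho^2 + rho'^2)^(3/2) and
    b = rho^2 (2 g y - P), under the constraint int rho^2 u = 0
    ([second_variation_qform]).  Two Jacobi fields are explicit: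
    - u_s = y' / rho^2, produced by the translations, with a u_s' = - (P - g y) y;
    - v, the derivative of the drop with respect to the pressure P at fixed
      contact angle, which solves - (a v')' + b v = rho^2.
    The fluxes a u_s' and a v' both carry the factor y, hence vanish at both
    ends.  Moreover u_s vanishes at the apex only, v does not vanish there, and
    int rho^2 v < 0: the volume decreases with the pressure ([drop_jacobi]).

    Kernel.  Given u with int rho^2 u = 0, choose alpha so that
    u_1 = u - alpha v vanishes at the apex.  Green's formula gives
    Q(u) = Q(u_1) - alpha^2 int rho^2 v, and on each half of the drop Jacobi's
    identity gives Q(u_1) = int a u_s^2 ((u_1 / u_s)')^2 >= 0, the boundary term
    at the apex disappearing because u_1^2 is small compared with the distance
    to the apex while u_s is of the same order as it.  So Q(u) = 0 forces
    alpha = 0 and u = C_1 u_s on the left half, u = C_2 u_s on the right half;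
    the constraint then gives C_1 = C_2 ([jacobi_kernel]).

    Elements of H^1 enter through their absolutely continuous representatives
    ([weak_derivative_AC]), so that all integrations by parts are instances of
    the product rule [ACM]. *)

(** * Calculus on a closed interval *)

Section IntervalIntegrals.
Context {R : realType}.
Notation mu := (@lebesgue_measure R).
Implicit Types (a b s t : R) (f g p q u v : R -> R).

Definition L1 a b f := mu.-integrable `[a, b] (EFin \o f).

Definition itg a b f : R := \int[mu]_(x in `[a, b]) f x.

Definition cont a b f := {within `[a, b], continuous f}.

Lemma sub_itvcc a b s t : a <= s -> t <= b -> `[s, t] `<=` `[a, b].
Proof. by move=> as_ tb; apply: subset_itvScc. Qed.

Lemma contS a b s t f : a <= s -> t <= b -> cont a b f -> cont s t f.
Proof. by move=> as_ tb; apply: continuous_subspaceW; exact: sub_itvcc. Qed.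

Lemma contD a b f g : cont a b f -> cont a b g -> cont a b (fun t => f t + g t).
Proof. by move=> cf cg x; apply: continuousD; [exact: cf|exact: cg]. Qed.

Lemma contM a b f g : cont a b f -> cont a b g -> cont a b (fun t => f t * g t).
Proof. by move=> cf cg x; apply: continuousM; [exact: cf|exact: cg]. Qed.

Lemma contN a b f : cont a b f -> cont a b (fun t => - f t).
Proof. by move=> cf x; apply: continuousN; exact: cf. Qed.

Lemma contB a b f g : cont a b f -> cont a b g -> cont a b (fun t => f t - g t).
Proof. by move=> cf cg; apply: contD => //; exact: contN. Qed.

Lemma cont_cst a b (k : R) : cont a b (fun=> k).
Proof. by apply: continuous_subspaceT => x; exact: cst_continuous. Qed.

Lemma contT a b f : continuous f -> cont a b f.
Proof. exact: continuous_subspaceT. Qed.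

Lemma cont_comp a b f (h : R -> R) : cont a b f ->
  (forall t, t \in `[a, b] -> {for f t, continuous h}) -> cont a b (h \o f).
Proof.
move=> /subspace_continuousP cf ch; apply/subspace_continuousP => x xab.
by apply: cvg_comp; [exact: cf | exact: ch].
Qed.

Lemma cont_eq a b f g : (forall t, t \in `[a, b] -> f t = g t) ->
  cont a b f -> cont a b g.
Proof.
by move=> fg; apply: subspace_eq_continuous => t; rewrite inE => /fg.
Qed.

Lemma contX a b f n : cont a b f -> cont a b (fun t => f t ^+ n).
Proof.
move=> cf; elim: n => [|n ih].
  by apply: (cont_eq (f := fun=> 1)) => [t _|]; [rewrite expr0|exact: cont_cst].
by apply: (cont_eq (f := fun t => f t * f t ^+ n)) => [t _|]; [rewrite exprS|exact: contM].
Qed.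

Lemma contV a b f : cont a b f -> (forall t, t \in `[a, b] -> f t != 0) ->
  cont a b (fun t => (f t)^-1).
Proof.
move=> cf f0; apply: (@cont_comp a b f (fun y => y^-1)) => // t t0.
by apply: inv_continuous; exact: f0.
Qed.

Lemma cont_bounded a b f : cont a b f ->
  exists2 M, 0 < M & forall t, t \in `[a, b] -> `|f t| <= M.
Proof.
move=> cf; have /compact_bounded[M [_ mrt]] :=
  continuous_compact cf (segment_compact (a := a) (b := b)).
exists (`|M| + 1); first by rewrite ltr_pwDr.
move=> t tab; apply: mrt; last by exists t.
by rewrite (le_lt_trans (ler_norm _))// ltrDl.
Qed.

Lemma L1_measurable a b f : L1 a b f -> measurable_fun `[a, b] f.
Proof. by case/integrableP => /measurable_EFinP. Qed.

Lemma L1S a b s t f : a <= s -> t <= b -> L1 a b f -> L1 s t f.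
Proof.
by move=> as_ tb; apply: integrableS => //; exact: sub_itvcc.
Qed.

Lemma L1_eq a b f g : (forall t, t \in `[a, b] -> f t = g t) ->
  L1 a b f -> L1 a b g.
Proof.
move=> fg; apply: eq_integrable => // t; rewrite inE => tab /=.
by rewrite fg.
Qed.

Lemma L1_cont a b f : cont a b f -> L1 a b f.
Proof.
by move=> cf; apply: continuous_compact_integrable => //; exact: segment_compact.
Qed.

Lemma L1D a b f g : L1 a b f -> L1 a b g -> L1 a b (fun t => f t + g t).
Proof. by move=> lf lg; exact: (integrableD _ lf lg). Qed.

Lemma L1Z a b (k : R) f : L1 a b f -> L1 a b (fun t => k * f t).
Proof. by move=> lf; exact: (integrableZl _ k lf). Qed.

Lemma L1N a b f : L1 a b f -> L1 a b (fun t => - f t).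
Proof.
move=> lf; apply: (@L1_eq _ _ (fun t => -1 * f t)); first by move=> *; rewrite mulN1r.
exact: L1Z.
Qed.

Lemma L1B a b f g : L1 a b f -> L1 a b g -> L1 a b (fun t => f t - g t).
Proof. by move=> lf lg; apply: L1D => //; exact: L1N. Qed.

Lemma L1M a b f g : cont a b f -> L1 a b g -> L1 a b (fun t => f t * g t).
Proof.
move=> cf lg; have mf : measurable_fun `[a, b] f.
  by apply: subspace_continuous_measurable_fun.
have bf : [bounded f x | x in `[a, b]].
  have [M M0 fM] := cont_bounded cf.
  by exists M; split=> [|x Mx y yab]; [exact: num_real|exact: le_trans (fM _ yab) (ltW Mx)].
have := @integrableMr _ _ _ mu `[a, b] (measurable_itv _) f (EFin \o g) mf bf lg.
by apply: eq_integrable.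
Qed.

Lemma itg_eq a b f g : (forall t, t \in `[a, b] -> f t = g t) ->
  itg a b f = itg a b g.
Proof. by move=> fg; apply: eq_Rintegral => t; rewrite inE => /fg. Qed.

Lemma itgD a b f g : L1 a b f -> L1 a b g ->
  itg a b (fun t => f t + g t) = itg a b f + itg a b g.
Proof. by move=> lf lg; exact: RintegralD. Qed.

Lemma itgB a b f g : L1 a b f -> L1 a b g ->
  itg a b (fun t => f t - g t) = itg a b f - itg a b g.
Proof. by move=> lf lg; exact: RintegralB. Qed.

Lemma itgZ a b (k : R) f : L1 a b f -> itg a b (fun t => k * f t) = k * itg a b f.
Proof. by move=> lf; exact: RintegralZl. Qed.

Lemma itg_ge0 a b f : (forall t, t \in `[a, b] -> 0 <= f t) -> 0 <= itg a b f.
Proof. by move=> f0; apply: Rintegral_ge0 => t /= /f0. Qed.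

Lemma itg_le a b f g : L1 a b f -> L1 a b g ->
  (forall t, t \in `[a, b] -> f t <= g t) -> itg a b f <= itg a b g.
Proof. by move=> lf lg fg; apply: le_Rintegral => // t /= /fg. Qed.

Lemma itg_cst a b (k : R) : a <= b -> itg a b (fun=> k) = k * (b - a).
Proof.
move=> ab; rewrite /itg Rintegral_cst//= lebesgue_measure_itv/= lte_fin.
by move: ab; rewrite le_eqVlt => /predU1P[->|->//]; rewrite ltxx subrr.
Qed.

Lemma itg_xx a f : itg a a f = 0.
Proof. by rewrite /itg set_itv1 Rintegral_set1. Qed.

Lemma itg_chasles a b c f : a <= b -> b <= c -> L1 a c f ->
  itg a c f = itg a b f + itg b c f.
Proof.
move=> ab bc lf.
have e : itg b c f = \int[mu]_(x in `]b, c]) f x.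
  rewrite /itg -Rintegral_itv_obnd_cbnd//.
  by apply: integrableS lf => //; apply: subset_itvScc; rewrite bnd_simp.
rewrite e -(@Rintegral_itvB _ f (BLeft a) (BRight c) b) ?bnd_simp//.
by rewrite addrC subrK.
Qed.

Lemma itg_open a b f : L1 a b f -> \int[mu]_(x in `]a, b[) f x = itg a b f.
Proof.
move=> lf.
rewrite Rintegral_itv_bndo_bndc; last first.
  by apply: integrableS lf => //; apply: subset_itv; rewrite bnd_simp.
rewrite Rintegral_itv_obnd_cbnd//.
by apply: integrableS lf => //; apply: subset_itv; rewrite bnd_simp.
Qed.

End IntervalIntegrals.

Section AbsolutelyContinuous.
Context {R : realType}.
Notation mu := (@lebesgue_measure R).
Implicit Types (a b s t : R) (f g p q u v F G : R -> R).

(** Absolute continuity is encoded by the integral formula itself: sums,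
    products and comparisons of such functions stay integral identities, and no
    almost everywhere derivative has to be taken. *)
Definition AC a b u p := L1 a b p /\
  forall s t, a <= s -> s <= t -> t <= b -> u t - u s = itg s t p.

(** The derivative is carried as a function continuous up to the endpoints,
    where a two-sided derivative would depend on values outside [a, b]. *)
Definition C1 a b F f := [/\ cont a b F, cont a b f &
  forall t, t \in `]a, b[ -> is_derive t 1 F (f t)].

Lemma ACS a b s t u p : a <= s -> t <= b -> AC a b u p -> AC s t u p.
Proof.
move=> as_ tb [lp up]; split; first exact: L1S lp.
move=> s' t' ss' st' tt'; apply: up => //; first exact: le_trans ss'.
exact: le_trans tb.
Qed.

Lemma C1S a b s t F f : a <= s -> t <= b -> C1 a b F f -> C1 s t F f.
Proof.
move=> as_ tb [cF cf dF]; split; [exact: contS cF|exact: contS cf|].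
move=> x xst; apply: dF; move: xst; rewrite !in_itv/= => /andP[sx xt].
by rewrite (le_lt_trans as_ sx) (lt_le_trans xt tb).
Qed.

Lemma AC_cont a b u p : a <= b -> AC a b u p -> cont a b u.
Proof.
move=> ab [lp up].
apply: (@cont_eq _ _ _ (fun t => u a + itg a t p)).
  move=> t; rewrite in_itv/= => /andP[at_ tb].
  by rewrite -up// addrC subrK.
apply: contD; first exact: cont_cst.
exact: (parameterized_integral_continuous ab lp).
Qed.

Lemma C1_FTC a b F f : a <= b -> C1 a b F f -> F b - F a = itg a b f.
Proof.
rewrite le_eqVlt => /predU1P[->|ab] [cF cf dF]; first by rewrite itg_xx subrr.
have [_ rF lF] := (continuous_within_itvP F ab).1 cF.
rewrite /itg /Rintegral (continuous_FTC2 ab cf (F := F))//.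
- split => // x xab; by have [] := dF x xab.
- by move=> x xab; rewrite derive1E; have [_ ->] := dF x xab.
Qed.

Lemma C1_AC a b F f : C1 a b F f -> AC a b F f.
Proof.
move=> C; split; first by case: C => _ cf _; exact: L1_cont.
by move=> s t as_ st tb; apply: C1_FTC => //; exact: C1S C.
Qed.

Lemma AC_cst a b (k : R) : AC a b (fun=> k) (fun=> 0).
Proof.
apply: C1_AC; split; [exact: cont_cst|exact: cont_cst|].
by move=> t _; exact: is_derive_cst.
Qed.

Lemma ACD a b u p v q : AC a b u p -> AC a b v q ->
  AC a b (fun t => u t + v t) (fun t => p t + q t).
Proof.
move=> [lp up] [lq vq]; split; first exact: L1D.
move=> s t as_ st tb; rewrite itgD; [|exact: L1S lp|exact: L1S lq].
by rewrite -up// -vq// opprD addrACA.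
Qed.

Lemma ACZ a b u p (k : R) : AC a b u p ->
  AC a b (fun t => k * u t) (fun t => k * p t).
Proof.
move=> [lp up]; split; first exact: L1Z.
by move=> s t as_ st tb; rewrite itgZ ?(L1S as_ tb)// -up// mulrBr.
Qed.

Lemma ACB a b u p v q : AC a b u p -> AC a b v q ->
  AC a b (fun t => u t - v t) (fun t => p t - q t).
Proof.
move=> [lp up] [lq vq]; split; first exact: L1B.
move=> s t as_ st tb; rewrite itgB; [|exact: L1S lp|exact: L1S lq].
by rewrite -up// -vq//; ring.
Qed.

Lemma AC_itg a b p : a <= b -> L1 a b p -> AC a b (fun t => itg a t p) p.
Proof.
move=> ab lp; split => // s t as_ st tb.
rewrite (@itg_chasles _ a s t)//; last exact: L1S lp.
by rewrite addrC addKr.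
Qed.

Let tri s t p q (z : R * R) : \bar R :=
  ((p \_ `[s, t]) z.1 * (q \_ `[s, t]) z.2 * (z.2 <= z.1)%R%:R)%:E.

(** Dominated by the product of the absolute values, which has a finite
    iterated integral. *)
Lemma tri_integrable s t p q : L1 s t p -> L1 s t q ->
  (mu \x mu)%E.-integrable setT (tri s t p q).
Proof.
move=> lp lq.
have mp : measurable_fun setT (p \_ `[s, t]).
  by apply/(measurable_restrictT _ _).1 => //; exact: L1_measurable.
have mq : measurable_fun setT (q \_ `[s, t]).
  by apply/(measurable_restrictT _ _).1 => //; exact: L1_measurable.
have mtri : measurable_fun setT (tri s t p q).
  apply/measurable_EFinP; apply: measurable_funM.
    apply: measurable_funM.
      exact: (measurableT_comp mp measurable_fst).
    exact: (measurableT_comp mq measurable_snd).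
  have mb : measurable_fun setT (fun z : R * R => (z.2 <= z.1)%R).
    by apply: measurable_fun_ler; [exact: measurable_snd|exact: measurable_fst].
  have : measurable_fun setT (fun z : R * R => if (z.2 <= z.1)%R then (1:R) else 0).
    by apply: measurable_fun_ifT.
  by apply: eq_measurable_fun => z _; case: ifP.
have ip : mu.-integrable setT (EFin \o p \_ `[s, t]).
  by rewrite -restrict_EFin; apply/(integrable_mkcond _ _).1.
have iq : mu.-integrable setT (EFin \o q \_ `[s, t]).
  by rewrite -restrict_EFin; apply/(integrable_mkcond _ _).1.
apply/integrable12ltyP => //.
have map_ : measurable_fun setT (fun x => `|(EFin \o p \_ `[s, t]) x|%E).
  exact: (measurableT_comp (@abse_measurable R setT) ((measurable_EFinP _ _).2 mp)).
have maq : measurable_fun setT (fun x => `|(EFin \o q \_ `[s, t]) x|%E).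
  exact: (measurableT_comp (@abse_measurable R setT) ((measurable_EFinP _ _).2 mq)).
pose N := (\int[mu]_y `|(EFin \o q \_ `[s, t]) y|)%E.
have N0 : (0 <= N)%E by apply: integral_ge0.
have Noo : (N < +oo)%E by case/integrableP : iq.
have Nfin : N \is a fin_num by rewrite ge0_fin_numE.
apply: (@le_lt_trans _ _ (\int[mu]_x (`|(EFin \o p \_ `[s, t]) x| * N))%E).
  apply: ge0_le_integral => //.
  - by move=> x _; exact: integral_ge0.
  - have := @measurable_fun_fubini_tonelli_F _ _ _ _ R mu (abse \o tri s t p q).
    by apply=> [|z]; [exact: (measurableT_comp (@abse_measurable R setT) mtri)|exact: abse_ge0].
  - by apply: emeasurable_funM => //.
  - move=> x _; rewrite -ge0_integralZl//.
    apply: ge0_le_integral => //.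
    + apply: (measurableT_comp (@abse_measurable R setT)).
      exact: (measurableT_comp mtri (pair1_measurable x)).
    + by apply: emeasurable_funM.
    + move=> y _ /=; rewrite -EFinM lee_fin !normrM ler_piMr//.
      by case: (y <= x); rewrite ?normr1 ?normr0.
rewrite ge0_integralZr//.
by rewrite muleC lte_mul_pinfty//; case/integrableP : ip.
Qed.

Lemma tri_row s t p q (x y : R) : s <= x -> x <= t ->
  tri s t p q (x, y) = ((p x)%:E * ((EFin \o q) \_ `[s, x]) y)%E.
Proof.
move=> sx xt; rewrite /tri restrict_EFin /= -EFinM !patchE !mem_setE !in_itv/= sx xt /=.
congr EFin; case: (leP s y) => _ /=; last by rewrite mulr0 mul0r.
by case: (leP y x) => yx /=; rewrite ?mulr0// mulr1 (le_trans yx xt).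
Qed.

Lemma tri_column s t p q (x y : R) : s <= y -> y <= t ->
  tri s t p q (x, y) = ((q y)%:E * ((EFin \o p) \_ `[y, t]) x)%E.
Proof.
move=> sy yt; rewrite /tri restrict_EFin /= -EFinM !patchE !mem_setE !in_itv/= sy yt /=.
congr EFin; case: (leP y x) => yx /=; last by rewrite !mulr0.
by case: (leP x t) => xt /=; rewrite ?(le_trans sy yx)/= ?andbF ?mul0r ?mulr0// mulr1 mulrC.
Qed.

Lemma tri_row0 s t p q (x y : R) : x \notin `[s, t] -> tri s t p q (x, y) = 0%E.
Proof. by move=> xst; rewrite /tri /= patchE mem_setE (negbTE xst) !mul0r. Qed.

Lemma tri_column0 s t p q (x y : R) : y \notin `[s, t] -> tri s t p q (x, y) = 0%E.
Proof.
by move=> yst; rewrite /tri /= [in X in _ * X * _]patchE mem_setE (negbTE yst) mulr0 mul0r.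
Qed.

Lemma itg_scale s t p (k : R) : L1 s t p ->
  (\int[mu]_y (k%:E * ((EFin \o p) \_ `[s, t]) y) = (k * itg s t p)%:E)%E.
Proof.
move=> lp; rewrite EFinM /itg /Rintegral fineK; last exact: integrable_fin_num.
rewrite integralZl//; last by apply/(integrable_mkcond _ _).1.
by rewrite [in RHS]integral_mkcond.
Qed.

(** Integration over the triangle y <= x by rows and by columns. *)
Lemma itg_triangle s t p q : L1 s t p -> L1 s t q ->
  itg s t (fun x => p x * itg s x q) = itg s t (fun y => q y * itg y t p).
Proof.
move=> lp lq; have F := Fubini (tri_integrable lp lq).
have in_st x : x \in `[s, t] -> s <= x /\ x <= t by rewrite in_itv => /andP.
have E1 : (\int[mu]_x \int[mu]_y tri s t p q (x, y) =
    \int[mu]_(x in `[s, t]) (p x * itg s x q)%:E)%E.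
  rewrite [RHS]integral_mkcond; apply: eq_integral => x _.
  rewrite restrict_EFin/= patchE mem_setE; case: ifPn => [/in_st[sx xt]|xst]; last first.
    by apply: integral0_eq => y _; exact: tri_row0.
  rewrite -itg_scale; last exact: L1S lq.
  by apply: eq_integral => y _; exact: tri_row.
have E2 : (\int[mu]_y \int[mu]_x tri s t p q (x, y) =
    \int[mu]_(y in `[s, t]) (q y * itg y t p)%:E)%E.
  rewrite [RHS]integral_mkcond; apply: eq_integral => y _.
  rewrite restrict_EFin/= patchE mem_setE; case: ifPn => [/in_st[sy yt]|yst]; last first.
    by apply: integral0_eq => x _; exact: tri_column0.
  rewrite -itg_scale; last exact: L1S lp.
  by apply: eq_integral => x _; exact: tri_column.
by move: F; rewrite /itg /Rintegral E1 E2 => ->.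
Qed.

(** Write u from the right endpoint and v from the left one: the two double
    integrals that remain run over the same triangle and cancel. *)
Lemma ACM a b u p v q : a <= b -> AC a b u p -> AC a b v q ->
  AC a b (fun t => u t * v t) (fun t => p t * v t + u t * q t).
Proof.
move=> ab ACu ACv; have cu := AC_cont ab ACu; have cv := AC_cont ab ACv.
case: ACu ACv => lp up [lq vq].
have lvp : L1 a b (fun t => p t * v t).
  by apply: (L1_eq (f := fun t => v t * p t)) => [t _|]; [rewrite mulrC|exact: L1M].
have luq : L1 a b (fun t => u t * q t) by exact: L1M.
split; first exact: L1D.
move=> s t as_ st tb.
have lp' : L1 s t p by exact: L1S lp.
have lq' : L1 s t q by exact: L1S lq.
have us : forall x, x \in `[s, t] -> u x = u t - itg x t p.
  move=> x; rewrite in_itv/= => /andP[sx xt]; rewrite -up//; first by ring.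
  exact: le_trans as_ sx.
have vs : forall x, x \in `[s, t] -> v x = v s + itg s x q.
  move=> x; rewrite in_itv/= => /andP[sx xt]; rewrite -vq//; first by ring.
  exact: le_trans xt tb.
have lpq : L1 s t (fun x => p x * itg s x q).
  apply: (L1_eq (f := fun x => p x * v x - v s * p x)) => [x xst|].
    by rewrite (vs x xst); ring.
  by apply: L1B; [exact: L1S lvp|exact: L1Z].
have lqp : L1 s t (fun x => q x * itg x t p).
  apply: (L1_eq (f := fun x => u t * q x - u x * q x)) => [x xst|].
    by rewrite (us x xst); ring.
  by apply: L1B; [exact: L1Z|exact: L1S luq].
rewrite (itg_eq (g := fun x => (v s * p x + p x * itg s x q) + (u t * q x - q x * itg x t p))).
  rewrite itgD; [|by apply: L1D => //; exact: L1Z|by apply: L1B => //; exact: L1Z].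
  rewrite itgD//; last exact: L1Z.
  rewrite itgB//; last exact: L1Z.
  by rewrite !itgZ// itg_triangle// -up// -vq//; ring.
by move=> x xst; rewrite {1}(vs x xst) {1}(us x xst); ring.
Qed.

End AbsolutelyContinuous.

Lemma aeS {R : realType} (P Q : R -> Prop) : (forall t, P t -> Q t) ->
  {ae @lebesgue_measure R, forall t, P t} -> {ae @lebesgue_measure R, forall t, Q t}.
Proof.
by move=> PQ; apply: filterS; first exact: (ae_filter_ringOfSetsType (@lebesgue_measure R)).
Qed.

Lemma aeS2 {R : realType} (P Q S : R -> Prop) : (forall t, P t -> Q t -> S t) ->
  {ae @lebesgue_measure R, forall t, P t} -> {ae @lebesgue_measure R, forall t, Q t} ->
  {ae @lebesgue_measure R, forall t, S t}.
Proof.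
by move=> PQ; apply: filterS2; first exact: (ae_filter_ringOfSetsType (@lebesgue_measure R)).
Qed.

Section AeZero.
Context {R : realType}.
Notation mu := (@lebesgue_measure R).

(** By Lebesgue's differentiation theorem an integrable function is almost
    everywhere the derivative of its indefinite integral, here constant. *)
Lemma L1_itg_cst_ae (a b k : R) (p : R -> R) : L1 a b p ->
  (forall t, t \in `]a, b[ -> itg a t p = k) ->
  {ae mu, forall t, t \in `]a, b[ -> p t = 0}.
Proof.
move=> lp p0; pose f := p \_ `[a, b].
have lf : mu.-integrable setT (EFin \o f).
  by rewrite -restrict_EFin; apply/(integrable_mkcond _ _).1.
have lfl : locally_integrable setT f.
  by apply: open_integrable_locally => //; exact: openT.
have lfi (y : R) : mu.-integrable `[a, y] (EFin \o f) by apply: integrableS lf.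
have := @FTC1 R f (BLeft a) lfi lfl.
apply: aeS.
move=> t /= Ht; rewrite in_itv/= => /andP[at_ tb].
have [] := Ht; first by rewrite lte_fin.
have fE : f t = p t by rewrite /f patchE mem_set//= in_itv/= !ltW.
rewrite fE => dF <-; rewrite derive1E.
rewrite (@near_eq_derive _ _ _ _ (cst k))//; first by rewrite derive_cst.
have : t \in `]a, b[ by rewrite in_itv/= at_ tb.
move/near_in_itvoo; apply: filterS => s; rewrite in_itv/= => /andP[as_ sb] /=.
rewrite -(p0 s) ?in_itv/= ?as_ ?sb//; apply: eq_Rintegral => x.
rewrite inE/= in_itv/= => /andP[ax xs]; rewrite /f patchE mem_set//= in_itv/= ax/=.
exact: le_trans xs (ltW sb).
Qed.

Lemma itg_ae_eq (a b : R) (f g : R -> R) : L1 a b f -> L1 a b g ->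
  {ae mu, forall t, t \in `]a, b[ -> f t = g t} -> itg a b f = itg a b g.
Proof.
move=> lf lg fg; rewrite -!itg_open//; congr fine.
have sub : `]a, b[ `<=` `[a, b] by apply: subset_itvScc; rewrite bnd_simp.
apply: ae_eq_integral => //.
- by apply/measurable_EFinP; apply: measurable_funS (L1_measurable lf).
- by apply/measurable_EFinP; apply: measurable_funS (L1_measurable lg).
- apply: aeS fg.
  by move=> t fgt tab; congr EFin; apply: fgt.
Qed.

End AeZero.

Section L2.
Context {R : realType}.
Notation mu := (@lebesgue_measure R).
Implicit Types (a b s t : R) (f g p q u v F G : R -> R).

Definition L2 a b f := measurable_fun `[a, b] f /\ L1 a b (fun t => f t ^+ 2).

(** From 2 |f g| <= f^2 + g^2. *)
Lemma L2M_L1 a b f g : L2 a b f -> L2 a b g -> L1 a b (fun t => f t * g t).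
Proof.
move=> [mf lf] [mg lg].
have mI : measurable `[a, b]%classic by exact: measurable_itv.
refine (@le_integrable _ _ _ mu _ mI _ (EFin \o (fun t => f t ^+ 2 + g t ^+ 2)) _ _ _).
- by apply/measurable_EFinP; exact: measurable_funM.
- move=> t _ /=; rewrite lee_fin [leRHS]ger0_norm ?addr_ge0 ?sqr_ge0//.
  have h1 : 0 <= (`|f t| - `|g t|) ^+ 2 by exact: sqr_ge0.
  rewrite normrM -(real_normK (num_real (f t))) -(real_normK (num_real (g t))).
  have := normr_ge0 (f t); have := normr_ge0 (g t).
  by move: h1; set A := `|f t|; set B := `|g t|; nra.
- exact: L1D.
Qed.

Lemma L2_cont a b f : cont a b f -> L2 a b f.
Proof.
move=> cf; split; first exact: subspace_continuous_measurable_fun.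
by apply: L1_cont; exact: contM.
Qed.

Lemma L2_L1 a b f : L2 a b f -> L1 a b f.
Proof.
move=> l2; apply: (L1_eq (f := fun t => 1 * f t)); first by move=> *; rewrite mul1r.
by apply: L2M_L1 => //; apply: L2_cont; exact: cont_cst.
Qed.

Lemma L2D a b f g : L2 a b f -> L2 a b g -> L2 a b (fun t => f t + g t).
Proof.
move=> l2f l2g; split; first by apply: measurable_funD; [case: l2f|case: l2g].
apply: (L1_eq (f := fun t => f t ^+ 2 + 2 * (f t * g t) + g t ^+ 2)).
  by move=> t _; ring.
apply: L1D; last by case: l2g.
by apply: L1D; [case: l2f|apply: L1Z; exact: L2M_L1].
Qed.

Lemma L2M a b f g : cont a b f -> L2 a b g -> L2 a b (fun t => f t * g t).
Proof.
move=> cf l2g; split.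
  by apply: measurable_funM; [exact: subspace_continuous_measurable_fun|case: l2g].
apply: (L1_eq (f := fun t => (f t * f t) * g t ^+ 2)).
  by move=> t _; ring.
by apply: L1M; [exact: contM|case: l2g].
Qed.

Lemma L2B a b f g : L2 a b f -> L2 a b g -> L2 a b (fun t => f t - g t).
Proof.
move=> l2f l2g; have := L2D l2f (L2M (@cont_cst _ a b (-1)) l2g).
have -> // : (fun t => f t + -1 * g t) = (fun t => f t - g t).
by apply/funext => t; rewrite mulN1r.
Qed.

Lemma L2S a b s t f : a <= s -> t <= b -> L2 a b f -> L2 s t f.
Proof.
move=> as_ tb [mf lf]; split; last exact: L1S lf.
by apply: measurable_funS mf => //; exact: sub_itvcc.
Qed.

(** Cauchy-Schwarz against the constant 1, from the nonnegativity of
    int (f - m)^2 where m is the mean of f. *)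
Lemma itg_sqr_le s t f : s <= t -> L2 s t f ->
  itg s t f ^+ 2 <= (t - s) * itg s t (fun x => f x ^+ 2).
Proof.
rewrite le_eqVlt => /predU1P[<-|st] l2f; first by rewrite itg_xx subrr mul0r expr0n.
have lf := L2_L1 l2f; case: l2f => _ lf2.
set I := itg s t f; set h := t - s; have h0 : 0 < h by rewrite subr_gt0.
have : 0 <= itg s t (fun x => (f x - I / h) ^+ 2) by apply: itg_ge0 => *; exact: sqr_ge0.
rewrite (itg_eq (g := fun x => f x ^+ 2 - 2 * (I / h) * f x + (I / h) ^+ 2)); last first.
  by move=> x _; ring.
have lc : L1 s t (fun=> (I / h) ^+ 2) by apply: L1_cont; exact: cont_cst.
rewrite itgD//; last by apply: L1B => //; exact: L1Z.
rewrite itgB//; last exact: L1Z.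
rewrite itgZ// itg_cst ?(ltW st)// -/I -/h => H.
have -> : I ^+ 2 = h * (2 * (I / h) * I - (I / h) ^+ 2 * h) by field; rewrite gt_eqF.
by rewrite ler_pM2l//; lra.
Qed.

End L2.

Section C1Calculus.
Context {R : realType}.
Implicit Types (a b s t : R) (f g F G : R -> R).

Lemma C1_eq a b F f f' : (forall t, t \in `[a, b] -> f t = f' t) ->
  C1 a b F f -> C1 a b F f'.
Proof.
move=> ff [cF cf dF]; split => //; first exact: cont_eq cf.
move=> t tab; rewrite -ff; first exact: dF.
by apply: subset_itv_oo_cc tab.
Qed.

Lemma C1D a b F f G g : C1 a b F f -> C1 a b G g ->
  C1 a b (fun t => F t + G t) (fun t => f t + g t).
Proof.
move=> [cF cf dF] [cG cg dG]; split; [exact: contD|exact: contD|].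
by move=> t tab; have := dF t tab; have := dG t tab => ? ?; exact: is_deriveD.
Qed.

Lemma C1N a b F f : C1 a b F f -> C1 a b (fun t => - F t) (fun t => - f t).
Proof.
move=> [cF cf dF]; split; [exact: contN|exact: contN|].
by move=> t tab; have := dF t tab => ?; exact: is_deriveN.
Qed.

Lemma C1B a b F f G g : C1 a b F f -> C1 a b G g ->
  C1 a b (fun t => F t - G t) (fun t => f t - g t).
Proof. by move=> CF CG; apply: C1D => //; exact: C1N. Qed.

Lemma C1M a b F f G g : C1 a b F f -> C1 a b G g ->
  C1 a b (fun t => F t * G t) (fun t => f t * G t + F t * g t).
Proof.
move=> [cF cf dF] [cG cg dG]; split; [exact: contM|by apply: contD; exact: contM|].
move=> t tab; have := dF t tab; have := dG t tab => ? ?.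
have -> : f t * G t + F t * g t = F t *: g t + G t *: f t.
  by rewrite /GRing.scale/= addrC [G t * _]mulrC.
exact: is_deriveM.
Qed.

Lemma C1_cst a b (k : R) : C1 a b (fun=> k) (fun=> 0).
Proof.
split; [exact: cont_cst|exact: cont_cst|].
by move=> t _; exact: is_derive_cst.
Qed.

Lemma C1Z a b F f (k : R) : C1 a b F f -> C1 a b (fun t => k * F t) (fun t => k * f t).
Proof.
move=> CF; have := C1M (C1_cst a b k) CF; apply: C1_eq => t _.
by rewrite mul0r add0r.
Qed.

Lemma C1_comp a b F f h h' : C1 a b F f ->
  (forall t, t \in `[a, b] -> is_derive (F t) 1 h (h' (F t))) ->
  (forall t, t \in `[a, b] -> {for F t, continuous h'}) ->
  C1 a b (fun t => h (F t)) (fun t => h' (F t) * f t).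
Proof.
move=> [cF cf dF] dh ch; split.
- apply: (cont_comp cF) => t tab; have [dht _] := dh t tab.
  by apply: differentiable_continuous; exact/derivable1_diffP.
- by apply: contM => //; exact: cont_comp.
- move=> t tab; have := dF t tab; have := dh t (subset_itv_oo_cc tab) => ? ?.
  exact: is_derive1_comp.
Qed.

Lemma C1V a b F f : C1 a b F f -> (forall t, t \in `[a, b] -> F t != 0) ->
  C1 a b (fun t => (F t)^-1) (fun t => - f t / F t ^+ 2).
Proof.
move=> CF F0; have := @C1_comp a b F f (fun y => y^-1) (fun y => - y ^- 2) CF _ _.
move/(_ _ _)/(C1_eq _); apply.
- by move=> t _; rewrite mulNr mulNr mulrC.
- move=> t tab; apply: is_derive_eq; first exact: (@is_deriveV _ id (F t) 1 1 (F0 t tab) _).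
  by rewrite /GRing.scale/= mulr1.
- by move=> t tab; apply: continuousN; apply: continuousV; [rewrite expf_neq0//; exact: F0|exact: exprn_continuous].
Qed.

Lemma C1_sqrt a b F f : C1 a b F f -> (forall t, t \in `[a, b] -> 0 < F t) ->
  C1 a b (fun t => Num.sqrt (F t)) (fun t => f t / (2 * Num.sqrt (F t))).
Proof.
move=> CF F0.
have := @C1_comp a b F f Num.sqrt (fun y => (2 * Num.sqrt y)^-1) CF _ _.
move/(_ _ _)/(C1_eq _); apply.
- by move=> t _; rewrite mulrC.
- by move=> t tab; exact: is_derive1_sqrt (F0 t tab).
- move=> t tab; apply: continuousV; first by rewrite mulf_neq0// sqrtr_eq0 -ltNge F0.
  by apply: continuousM; [exact: cst_continuous|exact: sqrt_continuous].
Qed.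

End C1Calculus.

Section MoreC1.
Context {R : realType}.
Implicit Types (a b s t : R) (f g F G : R -> R).

(** Differential identities need only be checked inside the interval. *)
Lemma C1_eqo a b F f f' : C1 a b F f -> cont a b f' ->
  (forall t, t \in `]a, b[ -> f t = f' t) -> C1 a b F f'.
Proof.
move=> [cF cf dF] cf' ff'; split => // t tab.
by rewrite -ff'//; exact: dF.
Qed.

Lemma C1_itg a b f : a < b -> cont a b f -> C1 a b (fun t => itg a t f) f.
Proof.
move=> ab cf; have lf := L1_cont cf; split => //.
  exact: AC_cont (ltW ab) (AC_itg (ltW ab) lf).
move=> t tab; have tab' := tab; move: tab'; rewrite in_itv/= => /andP[at_ tb].
have cft : {for t, continuous f}.
  by have /continuous_within_itvP := cf => /(_ ab)[+ _ _]; apply.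
have [d e] := continuous_FTC1_closed tb lf at_ cft.
by rewrite -e derive1E; exact/derivableP.
Qed.

(** Otherwise the indefinite integral of f would vanish identically, and
    with it its derivative f. *)
Lemma itg_gt0 a b f s : cont a b f -> (forall t, t \in `[a, b] -> 0 <= f t) ->
  s \in `]a, b[ -> f s != 0 -> 0 < itg a b f.
Proof.
move=> cf f0 sab fs.
have ab : a < b by move: sab; rewrite in_itv/= => /andP[]; exact: lt_trans.
have lf := L1_cont cf.
rewrite lt_neqAle itg_ge0// andbT eq_sym; apply: contraNneq fs => If0.
have F0 t : t \in `]a, b[ -> itg a t f = 0.
  rewrite in_itv/= => /andP[/ltW at_ /ltW tb]; apply/eqP; rewrite eq_le.
  apply/andP; split; last by apply: itg_ge0 => x xab; apply: f0; apply: (sub_itvcc (lexx a) tb).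
  rewrite -If0 (itg_chasles at_ tb lf) lerDl.
  by apply: itg_ge0 => x xab; apply: f0; apply: (sub_itvcc at_ (lexx b)).
have [_ _ dF] := C1_itg ab cf.
have [_ <-] := dF s sab.
rewrite (@near_eq_derive _ _ _ _ (cst 0))//; first by rewrite derive_cst.
by apply: filterS (near_in_itvoo sab) => x /F0.
Qed.

Lemma cont_eq0_closed a b f : a < b -> cont a b f ->
  (forall t, t \in `]a, b[ -> f t = 0) -> forall t, t \in `[a, b] -> f t = 0.
Proof.
move=> ab cf f0 t; have [_ fa fb] := (continuous_within_itvP f ab).1 cf.
rewrite in_itv/= => /andP[]; rewrite le_eqVlt => /predU1P[<- _|at_].
  apply: (cvg_unique (@Rhausdorff R) fa); apply: cvg_near_cst.
  near=> x; apply: f0; rewrite in_itv/=; apply/andP; split.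
    by near: x; exact: nbhs_right_gt.
  by near: x; exact: nbhs_right_lt.
rewrite le_eqVlt => /predU1P[->|tb]; last by apply: f0; rewrite in_itv/= at_.
apply: (cvg_unique (@Rhausdorff R) fb); apply: cvg_near_cst.
near=> x; apply: f0; rewrite in_itv/=; apply/andP; split.
  by near: x; exact: nbhs_left_gt.
by near: x; exact: nbhs_left_lt.
Unshelve. all: by end_near. Qed.

Lemma C1_cos a b : C1 a b (@cos R) (fun t => - sin t).
Proof.
split; [exact: (contT (@continuous_cos R))| |by move=> t _; exact: is_derive_cos].
exact: contN (contT (@continuous_sin R)).
Qed.

Lemma C1_sin a b : C1 a b (@sin R) cos.
Proof.
split; [exact: (contT (@continuous_sin R))| |by move=> t _; exact: is_derive_sin].
exact: (contT (@continuous_cos R)).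
Qed.

Lemma C1_id a b : C1 a b (fun t : R => t) (fun=> 1).
Proof.
split; [by apply: contT => t; exact: cvg_id|exact: cont_cst|].
by move=> t _; exact: is_derive_id.
Qed.

Lemma is_derive_quadratic (A B C t : R) :
  is_derive t 1 (fun s => A + B * s + C * s ^+ 2) (B + 2 * C * t).
Proof.
have [_ _ d] := C1D (C1D (C1_cst (t - 1) (t + 1) A) (C1Z B (C1_id (t - 1) (t + 1))))
  (C1Z C (C1M (C1_id (t - 1) (t + 1)) (C1_id (t - 1) (t + 1)))).
have tin : t \in `](t - 1), (t + 1)[ by rewrite in_itv/=; apply/andP; split; lra.
have -> : B + 2 * C * t = 0 + B * 1 + C * (1 * t + t * 1) by ring.
exact: d.
Qed.

Lemma C1_incr a b F f : C1 a b F f -> (forall t, t \in `]a, b[ -> 0 < f t) ->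
  forall s t, a <= s -> s < t -> t <= b -> F s < F t.
Proof.
move=> CF f0 s t as_ st tb; have [cF _ dF] := C1S as_ tb CF.
have [x xst e] := MVT st dF cF.
rewrite -subr_gt0 e mulr_gt0 ?subr_gt0// f0//.
move: xst; rewrite !in_itv/= => /andP[sx xt].
by rewrite (le_lt_trans as_ sx) (lt_le_trans xt tb).
Qed.

End MoreC1.

(** * Sobolev functions of one variable *)

Section WeakDerivative.
Context {R : realType}.
Notation mu := (@lebesgue_measure R).
Implicit Types (xi eta phi f g u p : R -> R).

(** The endpoints are negligible. *)
Lemma L2_0piP f : L2_0pi f <-> L2 0 pi f.
Proof.
have sub : `]0, pi[ `<=` `[0, @pi R] by exact: subset_itv_oo_cc.
split=> -[mf lf]; split.
- by apply/measurable_fun_itv_bndo_bndcP/measurable_fun_itv_obnd_cbndP.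
- apply/integrableP; split.
    apply/emeasurable_fun_itv_bndo_bndcP/emeasurable_fun_itv_obnd_cbndP.
    exact: measurable_int lf.
  rewrite -integral_itv_bndo_bndc; last first.
    apply: measurableT_comp => //.
    apply/emeasurable_fun_itv_obnd_cbndP.
    exact: measurable_int lf.
  rewrite -integral_itv_obnd_cbnd; last first.
    by apply: measurableT_comp => //; exact: measurable_int lf.
  by case/integrableP : lf.
- exact: measurable_funS mf.
- exact: integrableS lf.
Qed.

Lemma int0piE f : L1 0 pi f -> \int0pi f = itg 0 pi f.
Proof. exact: itg_open. Qed.

Lemma int0pi_ae f g : measurable_fun `]0, pi[ f -> L1 0 pi g ->
  {ae mu, forall t, t \in `]0, pi[ -> f t = g t} -> \int0pi f = itg 0 pi g.
Proof.
move=> mf lg fg; rewrite -int0piE//; congr fine.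
apply: ae_eq_integral => //.
- exact/measurable_EFinP.
- apply/measurable_EFinP; apply: measurable_funS (L1_measurable lg) => //.
  exact: subset_itv_oo_cc.
- apply: aeS fg.
  by move=> t fgt tab; congr EFin; apply: fgt.
Qed.

Lemma test_functionC1 phi : test_function phi ->
  [/\ C1 0 pi phi (derive1 phi), phi 0 = 0 & phi pi = 0].
Proof.
move=> [dphi cphi [A [B [A0 Bpi phi0]]]]; split.
- split; last by move=> t _; rewrite derive1E; exact/derivableP.
    apply: contT => t; apply: differentiable_continuous.
    exact/derivable1_diffP.
  exact: contT.
- by apply: phi0; rewrite in_itv/= negb_and -!ltNge A0.
- by apply: phi0; rewrite in_itv/= negb_and -!ltNge Bpi orbT.
Qed.

(** The test functions below are combinations of translates of [pos2], the
    simplest C^1 function with a kink in its derivative. *)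
Definition pos (t : R) := Num.max 0 t.
Definition pos2 (t : R) := pos t ^+ 2 / 2.

Lemma pos_continuous : continuous pos.
Proof.
move=> t; rewrite /pos; apply: (@continuous_max _ _ (fun=> 0) id).
  exact: cst_continuous.
exact: cvg_id.
Qed.

Lemma is_derive_pos2 (t : R) : is_derive t 1 pos2 (pos t).
Proof.
have [t0|t0|->] := ltgtP t 0.
- rewrite /pos max_l ?(ltW t0)//.
  apply: (near_eq_is_derive (f := fun=> 0)).
  apply: filterS (lt_nbhsl t0) => s s0.
  by rewrite /pos2 /pos max_l ?(ltW s0)// expr0n mul0r.
- rewrite /pos max_r ?(ltW t0)//.
  have d2 : is_derive t 1 (2^-1 *: (id * id)) t.
    by apply: is_derive_eq; rewrite /GRing.scale/= mulr1; field.
  apply: near_eq_is_derive d2; apply: filterS (lt_nbhsr t0) => s s0.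
  by rewrite /pos2 /pos max_r ?(ltW s0)// expr2 [RHS]mulrC.
- have p0 : pos 0 = 0 by rewrite /pos maxxx.
  rewrite [X in is_derive _ _ _ X]p0; apply/is_derive1_caratheodory; exists (fun z => pos z / 2); split.
  + move=> z; rewrite /pos2 p0 expr0n mul0r !subr0 /pos.
    by have [z0|z0] := leP 0 z; rewrite ?mul0r ?expr0n ?mul0r//; field.
  + by apply: continuousM; [exact: pos_continuous|exact: cst_continuous].
  + by rewrite p0 mul0r.
Qed.

(** Lagrange basis polynomials for the nodes pi/4, pi/2 and 3pi/4; any three
    distinct interior points would serve. *)
Definition lag (a : R) (i : nat) : R :=
  let x := a / (pi / 4) in
  if i == 0%N then (x - 2) * (x - 3) / 2
  else if i == 1%N then - ((x - 1) * (x - 3)) else (x - 1) * (x - 2) / 2.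

Definition lag_comb (a : R) (P : R -> R) : R :=
  lag a 0 * P (pi / 4) + lag a 1 * P (pi / 2) + lag a 2 * P (3 * pi / 4).

Lemma lag_comb_quadratic (P : R -> R) :
  exists A B C, forall a, lag_comb a P = A + B * a + C * a ^+ 2.
Proof.
have pi0 : pi != 0 :> R by rewrite gt_eqF// pi_gt0.
exists (3 * P (pi / 4) - 3 * P (pi / 2) + P (3 * pi / 4)).
exists ((- 5 / 2 * P (pi / 4) + 4 * P (pi / 2) - 3 / 2 * P (3 * pi / 4)) / (pi / 4)).
exists ((P (pi / 4) / 2 - P (pi / 2) + P (3 * pi / 4) / 2) / (pi / 4) ^+ 2).
by move=> a; rewrite /lag_comb /lag /=; move: pi pi0 => q q0; field.
Qed.

(** Four kinks, one of them movable, combined so as to annihilate quadratic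
    polynomials: the combination vanishes to the left and to the right of all
    kinks, which makes its support compact. *)
Definition kink_test (a t : R) : R :=
  pos2 (t - a) - lag_comb a (fun s => pos2 (t - s)).
Definition kink_test' (a t : R) : R :=
  pos (t - a) - lag_comb a (fun s => pos (t - s)).

Lemma is_derive_kink (a t : R) : is_derive t 1 (kink_test a) (kink_test' a t).
Proof.
have d (s : R) : is_derive t 1 (fun t => pos2 (t - s)) (pos (t - s)).
  have h1 : is_derive t 1 (fun t : R => t - s) 1.
    have := @is_deriveB R R R id (fun=> s) t 1 1 0 _ _.
    by rewrite subr0; apply.
  have h2 := is_derive_pos2 (t - s).
  rewrite -[pos _]mulr1; exact: is_derive1_comp.
have dz k s : is_derive t 1 (fun t => k * pos2 (t - s)) (k * pos (t - s)).
  by have := @is_deriveZ R R R (fun t => pos2 (t - s)) k t 1 (pos (t - s)) (d s).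
exact: is_deriveB.
Qed.

Lemma kink_test'_continuous a : continuous (kink_test' a).
Proof.
have c s : continuous (fun t => pos (t - s)).
  move=> t; apply: (@continuous_comp _ _ _ (fun t => t - s) pos).
    by apply: continuousB; [exact: cvg_id|exact: cst_continuous].
  exact: pos_continuous.
move=> t; rewrite /kink_test' /lag_comb.
have cz k s : k * pos (t0 - s) @[t0 --> t] --> k * pos (t - s).
  by apply: cvgM; [exact: cvg_cst|exact: c].
apply: cvgB; first exact: c.
by apply: cvgD; first apply: cvgD; exact: cz.
Qed.

Lemma kink_test_function a : a \in `]0, pi[ -> test_function (kink_test a).
Proof.
rewrite in_itv/= => /andP[a0 api]; have pi0 := pi_gt0 R.
have d1 : derive1 (kink_test a) = kink_test' a.
  by apply/funext => t; rewrite derive1E; have [_ ->] := is_derive_kink a t.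
split.
- by move=> t; have [] := is_derive_kink a t.
- by rewrite d1; exact: kink_test'_continuous.
- exists (Num.min a (pi / 4)), (Num.max a (3 * pi / 4)); split.
  + by rewrite lt_min a0 divr_gt0.
  + by rewrite gt_max api/=; move: (@pi R) pi0 => q q0; lra.
  move=> t; rewrite in_itv/= negb_and -!ltNge => /orP[|].
  + rewrite lt_min => /andP[ta t4].
    rewrite /kink_test /lag_comb /pos2 /pos !max_l ?expr0n ?mul0r ?mulr0 ?addr0 ?subrr//; move: (@pi R) a0 api pi0 ta t4 => q *; lra.
  + rewrite gt_max => /andP[ta t4].
    rewrite /kink_test /lag_comb /pos2 /pos !max_r ?/lag/=; move: (@pi R) a0 api pi0 ta t4 => q a0 aq q0 ta t4; [|lra..].
    by field; rewrite gt_eqF.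
Qed.

(** Pairing f with the kink tests expresses G(a) = int f(t) (t - a)_+ dt at
    an arbitrary a through three fixed values, so G is a quadratic polynomial;
    f is almost everywhere the second derivative of G. *)
Lemma du_bois_reymond f : L1 0 pi f ->
  (forall phi, test_function phi -> itg 0 pi (fun t => f t * derive1 phi t) = 0) ->
  exists k, {ae mu, forall t, t \in `]0, pi[ -> f t = k}.
Proof.
move=> lf f0; have pi0 := pi_gt0 R; have pi0' := ltW pi0.
pose G a := itg 0 pi (fun t => pos (t - a) * f t).
have cpos a : cont 0 pi (fun t => pos (t - a)).
  apply: contT => t; apply: (@continuous_comp _ _ _ (fun t => t - a) pos).
    by apply: continuousB; [exact: cvg_id|exact: cst_continuous].
  exact: pos_continuous.
have lpf a : L1 0 pi (fun t => pos (t - a) * f t) by apply: L1M.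
have GE a : a \in `]0, pi[ -> G a = lag_comb a G.
  move=> a0pi; have := f0 _ (kink_test_function a0pi).
  have d1 : derive1 (kink_test a) = kink_test' a.
    by apply/funext => t; rewrite derive1E; have [_ ->] := is_derive_kink a t.
  rewrite d1 (itg_eq (g := fun t => pos (t - a) * f t -
    (lag a 0 * (pos (t - pi / 4) * f t) + lag a 1 * (pos (t - pi / 2) * f t) +
     lag a 2 * (pos (t - 3 * pi / 4) * f t)))); last first.
    by move=> t _; rewrite /kink_test' /lag_comb; ring.
  have l0 := L1Z (lag a 0) (lpf (pi / 4)); have l1 := L1Z (lag a 1) (lpf (pi / 2)).
  have l2 := L1Z (lag a 2) (lpf (3 * pi / 4)).
  rewrite (itgB (lpf a) (L1D (L1D l0 l1) l2)) (itgD (L1D l0 l1) l2) (itgD l0 l1).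
  by rewrite !itgZ// => /eqP; rewrite subr_eq0 => /eqP.
have [A [B [C GC]]] := lag_comb_quadratic G.
pose K t := itg 0 t f.
have ACK := AC_itg pi0' lf; have cK := AC_cont pi0' ACK.
pose M t := itg 0 t K.
have lK : L1 0 pi K by exact: L1_cont.
have ME a : a \in `]0, pi[ ->
    M a = M pi - K pi * (pi - a) + (A + B * a + C * a ^+ 2).
  move=> a0pi; rewrite -GC -GE//; move: a0pi; rewrite in_itv/= => /andP[a0 api].
  have [a0' api'] := (ltW a0, ltW api).
  have Ga : G a = itg a pi (fun t => (t - a) * f t).
    rewrite /G (itg_chasles a0' api' (lpf a)) (itg_eq (g := fun=> 0)).
      rewrite itg_cst// mul0r add0r; apply: itg_eq => t; rewrite in_itv/= => /andP[at_ _].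
      by rewrite /pos max_r// subr_ge0.
    by move=> t; rewrite in_itv/= => /andP[_ ta]; rewrite /pos max_l ?mul0r// subr_le0.
  have Cid : C1 a pi (fun t => t - a) (fun=> 1).
    split; [|exact: cont_cst|].
      by apply: contB; [apply: contT => t; exact: cvg_id|exact: cont_cst].
    move=> t _; have := @is_deriveB R R R id (fun=> a) t 1 1 0 _ _.
    by rewrite subr0; apply.
  have [l e] := ACM api' (C1_AC Cid) (ACS a0' (lexx pi) ACK).
  have := e a pi (lexx a) api' (lexx pi).
  have lfa := L1S a0' (lexx pi) lf; have lKa := L1S a0' (lexx pi) lK.
  have lKa1 : L1 a pi (fun t => 1 * itg 0 t f) by exact: L1Z.
  have lta : L1 a pi (fun t => (t - a) * f t) by apply: L1M => //; case: Cid.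
  rewrite subrr mul0r subr0 itgD// itgZ//.
  rewrite mul1r => e1.
  have e2 : itg a pi (fun t => (t - a) * f t) = (pi - a) * K pi - itg a pi K.
    by rewrite {1}/K e1 addrC addKr.
  by rewrite Ga e2 /M (itg_chasles a0' api' lK); ring.
have dM t : t \in `]0, pi[ -> K t = K pi + B + 2 * C * t.
  move=> t0pi; have t0pi' := t0pi; move: t0pi'; rewrite in_itv/= => /andP[t0 tpi].
  have cKt : {for t, continuous K}.
    by have /continuous_within_itvP := cK => /(_ pi0)[+ _ _]; apply.
  have [_ <-] := continuous_FTC1_closed tpi lK t0 cKt.
  rewrite derive1E; pose N := M pi - K pi * pi + A.
  apply: derive_val; apply: near_eq_is_derive (is_derive_quadratic N (K pi + B) C t).
  apply: filterS (near_in_itvoo t0pi) => s s0pi.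
  by rewrite -[RHS]/(M s) ME// /N; ring.
have B0 : K pi + B = 0.
  have K00 : K 0 = 0 by rewrite /K itg_xx.
  have [_ K0 _] := (continuous_within_itvP K pi0).1 cK.
  have K1 : K t @[t --> 0^'+] --> K pi + B.
    have : (K pi + B + 2 * C * t) @[t --> (0:R)^'+] --> K pi + B + 2 * C * 0.
      apply: cvg_within_filter; apply: cvgD; first exact: cvg_cst.
      by apply: cvgM; [exact: cvg_cst|exact: cvg_id].
    rewrite mulr0 addr0; apply: cvg_trans; apply: near_eq_cvg.
    near=> t; rewrite (dM t)// in_itv/=; apply/andP; split.
      by near: t; exact: nbhs_right_gt.
    by near: t; exact: nbhs_right_lt.
  by rewrite -[RHS]K00; exact: (cvg_unique _ K1 K0).
exists (2 * C).
have lc : L1 0 pi (fun=> 2 * C) by apply: L1_cont; exact: cont_cst.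
have : {ae mu, forall t, t \in `]0, pi[ -> f t - 2 * C = 0}.
  apply: (L1_itg_cst_ae (k := 0)); first exact: L1B.
  move=> t t0pi; have := dM t t0pi; rewrite B0 add0r /K.
  move: t0pi; rewrite in_itv/= => /andP[/ltW t0 /ltW tpi].
  rewrite itgB; [|exact: L1S lf|exact: L1S lc].
  by move=> ->; rewrite itg_cst// subr0 subrr.
apply: aeS.
by move=> t H /H /eqP; rewrite subr_eq0 => /eqP.
Unshelve. all: by end_near. Qed.

(** The function xi minus a primitive of eta has weak derivative 0. *)
Lemma weak_derivative_AC xi eta :
  L2_0pi xi -> L2_0pi eta -> is_weak_derivative xi eta ->
  exists u, AC 0 pi u eta /\ {ae mu, forall t, t \in `]0, pi[ -> xi t = u t}.
Proof.
move=> /L2_0piP l2xi /L2_0piP l2eta wd; have pi0' : 0 <= pi :> R by exact: pi_ge0.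
have lxi := L2_L1 l2xi; have leta := L2_L1 l2eta.
have ACE := AC_itg pi0' leta; have cE := AC_cont pi0' ACE.
have lE := L1_cont cE.
have [||k hk] := @du_bois_reymond (fun t => xi t - itg 0 t eta).
- exact: L1B.
- move=> phi tphi; have [Cphi p0 ppi] := test_functionC1 tphi.
  have [cphi cphi' _] := Cphi.
  have lx : L1 0 pi (fun t => xi t * derive1 phi t).
    by apply: (L1_eq (f := fun t => derive1 phi t * xi t)) => [t _|]; [exact: mulrC|exact: L1M].
  have le : L1 0 pi (fun t => eta t * phi t).
    by apply: (L1_eq (f := fun t => phi t * eta t)) => [t _|]; [exact: mulrC|exact: L1M].
  have lE' : L1 0 pi (fun t => itg 0 t eta * derive1 phi t).
    by apply: L1_cont; exact: contM.
  have := wd phi tphi; rewrite !int0piE// => e1.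
  have [_ e] := ACM pi0' ACE (C1_AC Cphi).
  have := e 0 pi (lexx 0) pi0' (lexx pi).
  rewrite p0 ppi !mulr0 subrr itgD// => e2.
  rewrite (itg_eq (g := fun t => xi t * derive1 phi t - itg 0 t eta * derive1 phi t)).
    by rewrite itgB// e1 -opprD -e2 oppr0.
  by move=> t _; ring.
exists (fun t => itg 0 t eta + k); split.
  have := ACD ACE (AC_cst 0 pi k).
  by congr AC; apply/funext => t; rewrite addr0.
apply: aeS hk.
by move=> t H /H <-; rewrite addrC subrK.
Qed.

(** The product rule, applied to F and a test function. *)
Lemma C1_ae_H1 F f xi : C1 0 pi F f -> measurable_fun `]0, pi[ xi ->
  {ae mu, forall t, t \in `]0, pi[ -> xi t = F t} -> H1_0pi xi.
Proof.
move=> CF mxi xiF; have pi0' : 0 <= pi :> R by exact: pi_ge0.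
have [cF cf _] := CF.
have sub : `]0, pi[ `<=` `[0, @pi R] by exact: subset_itv_oo_cc.
split.
  split => //; apply/integrableP; split.
    by apply/measurable_EFinP; exact: measurable_funM.
  have lF2 : L1 0 pi (fun t => F t ^+ 2) by apply: L1_cont; exact: contM.
  have /integrableP[mF2] : mu.-integrable `]0, pi[ (EFin \o (fun t => F t ^+ 2)).
    exact: integrableS lF2.
  apply: le_lt_trans; rewrite le_eqVlt; apply/orP; left; apply/eqP.
  apply: ae_eq_integral => //.
  - apply: measurableT_comp => //; apply/measurable_EFinP; exact: measurable_funM.
  - exact: measurableT_comp.
  - apply: aeS xiF.
    by move=> t H /H /= ->.
exists f; split; first by apply/L2_0piP; exact: L2_cont.
move=> phi tphi; have [Cphi p0 ppi] := test_functionC1 tphi.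
have [cphi cphi' _] := Cphi.
have lFf : L1 0 pi (fun t => F t * derive1 phi t) by apply: L1_cont; exact: contM.
have lfF : L1 0 pi (fun t => f t * phi t) by apply: L1_cont; exact: contM.
rewrite (int0pi_ae (g := fun t => F t * derive1 phi t))//.
- rewrite int0piE//.
  have [_ e] := ACM pi0' (C1_AC CF) (C1_AC Cphi).
  have := e 0 pi (lexx 0) pi0' (lexx pi).
  rewrite p0 ppi !mulr0 subrr itgD// => e2.
  by apply/eqP; rewrite -addr_eq0 addrC -e2.
- apply: measurable_funM => //.
  have := subspace_continuous_measurable_fun (measurable_itv `[0, pi]) cphi'.
  exact: measurable_funS.
- apply: aeS xiF.
  by move=> t H /H ->.
Qed.

End WeakDerivative.

(** * A degenerate Sturm-Liouville form under one linear constraint *)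

Section SturmForm.
Context {R : realType}.
Implicit Types (u p z : R -> R).

(** The form int a u'^2 + b u^2 on [0, L], its null field [us], and a field [v]
    which represents the constraint int w u.  Each field comes with its
    derivative and with its flux [a u'], for which the Jacobi equation is a
    first-order identity; the vanishing of the fluxes at both ends is the
    natural boundary condition.  The null field changes sign at the single
    point [c], so the form alone is indefinite; the last two conditions, [v]
    nonzero at [c] and int w v < 0, are what the constraint needs to repair it. *)
Record jacobi_data (L c : R) (a b w us us1 fs v v1 fv : R -> R) : Prop := JacobiData {
  jac_c : 0 < c < L;
  jac_a : cont 0 L a;
  jac_b : cont 0 L b;
  jac_w : cont 0 L w;
  jac_a_gt0 : forall t, t \in `[0, L] -> 0 < a t;
  jac_us : C1 0 L us us1;
  jac_fs : C1 0 L fs (fun t => b t * us t);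
  jac_fsE : forall t, t \in `[0, L] -> fs t = a t * us1 t;
  jac_fs0 : fs 0 = 0;
  jac_fsL : fs L = 0;
  jac_usc : us c = 0;
  jac_us1c : us1 c != 0;
  jac_us_neq0 : forall t, t \in `[0, L] -> t != c -> us t != 0;
  jac_us_mean : itg 0 L (fun t => w t * us t) = 0;
  jac_us_half : itg 0 c (fun t => w t * us t) != 0;
  jac_v : C1 0 L v v1;
  jac_fv : C1 0 L fv (fun t => b t * v t - w t);
  jac_fvE : forall t, t \in `[0, L] -> fv t = a t * v1 t;
  jac_fv0 : fv 0 = 0;
  jac_fvL : fv L = 0;
  jac_vc : v c != 0;
  jac_v_lt0 : itg 0 L (fun t => w t * v t) < 0 }.

Context (L c : R) (a b w us us1 fs v v1 fv : R -> R).
Hypothesis J : jacobi_data L c a b w us us1 fs v v1 fv.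

Definition qform (s t : R) u p := itg s t (fun x => a x * p x ^+ 2 + b x * u x ^+ 2).

Let L_gt0 : 0 < L. Proof. by case/andP: (jac_c J) => *; lra. Qed.
Let L_ge0 : 0 <= L. Proof. exact: ltW. Qed.
Let c_in : c \in `]0, L[. Proof. by rewrite in_itv; exact: jac_c J. Qed.

Lemma L1_qform u p : AC 0 L u p -> L2 0 L p ->
  L1 0 L (fun x => a x * p x ^+ 2 + b x * u x ^+ 2).
Proof.
move=> ACu [_ lp]; apply: L1D; first by apply: L1M => //; exact: jac_a J.
apply: L1_cont; apply: contM; first exact: jac_b J.
by apply: contM; exact: (AC_cont L_ge0 ACu).
Qed.

(** This is a us^2 ((u / us)')^2. *)
Let ric_sq u p x := a x * (us x * p x - us1 x * u x) ^+ 2 / us x ^+ 2.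
Let ric x := fs x / us x.

(** Jacobi's identity: away from the zero of [us] the integrand is a square
    plus the derivative of (fs / us) u^2. *)
Lemma riccati s t u p : 0 <= s -> s <= t -> t <= L ->
  (forall x, x \in `[s, t] -> us x != 0) -> AC 0 L u p -> L2 0 L p ->
  L1 s t (ric_sq u p) /\
  qform s t u p = itg s t (ric_sq u p) + ric t * u t ^+ 2 - ric s * u s ^+ 2.
Proof.
move=> s0 st tL us0 ACu l2p.
have lq := L1S s0 tL (L1_qform ACu l2p).
have Cus := C1S s0 tL (jac_us J); have Cfs := C1S s0 tL (jac_fs J).
have Cnu := C1M Cfs (C1V Cus us0).
have ACu' := ACS s0 tL ACu.
have AC2 := ACM st (C1_AC Cnu) (ACM st ACu' ACu').
have [l2 e2] := AC2.
have E : forall x, x \in `[s, t] -> a x * p x ^+ 2 + b x * u x ^+ 2 =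
  ric_sq u p x + ((b x * us x * (us x)^-1 + fs x * (- us1 x / us x ^+ 2)) * (u x * u x) +
    fs x * (us x)^-1 * (p x * u x + u x * p x)).
  move=> x xst; rewrite (jac_fsE J); last exact: (sub_itvcc s0 tL).
  by rewrite /ric_sq; field; exact: us0.
have lz : L1 s t (ric_sq u p).
  apply: (L1_eq (f := fun x => (a x * p x ^+ 2 + b x * u x ^+ 2) -
    ((b x * us x * (us x)^-1 + fs x * (- us1 x / us x ^+ 2)) * (u x * u x) +
    fs x * (us x)^-1 * (p x * u x + u x * p x)))) => [x xst|].
    by rewrite E// addrK.
  exact: L1B.
split => //; rewrite /qform (itg_eq E) itgD//.
rewrite -e2// /ric; ring.
Qed.

Lemma ric_sq_ge0 s t u p : 0 <= s -> t <= L -> 0 <= itg s t (ric_sq u p).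
Proof.
move=> s0 tL; apply: itg_ge0 => x xst; rewrite /ric_sq mulr_ge0 ?invr_ge0 ?sqr_ge0//.
rewrite mulr_ge0 ?sqr_ge0// ltW// (jac_a_gt0 J)//.
exact: (sub_itvcc s0 tL).
Qed.

(** The increment of u / us is the integral of its derivative, which
    Cauchy-Schwarz bounds by the integral of the square. *)
Lemma ric_sq_itg0_prop s t u p : 0 <= s -> s <= t -> t <= L ->
  (forall x, x \in `[s, t] -> us x != 0) -> AC 0 L u p -> L2 0 L p ->
  itg s t (ric_sq u p) = 0 -> u t / us t = u s / us s.
Proof.
move=> s0 st tL us0 ACu l2p z0.
have [lz _] := riccati s0 st tL us0 ACu l2p.
have Cus := C1S s0 tL (jac_us J).
have ACu' := ACS s0 tL ACu; have l2p' := L2S s0 tL l2p.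
have [cus cus1 _] := Cus; have cu := AC_cont st ACu'.
have [_ e] := ACM st ACu' (C1_AC (C1V Cus us0)).
have cV : cont s t (fun x => (us x)^-1) by have [] := C1V Cus us0.
set d := fun x => (us x)^-1 ^+ 2 * (us x * p x - us1 x * u x).
have l2d : L2 s t d.
  apply: L2M; first exact: contM.
  apply: L2B; first exact: L2M.
  by apply: L2_cont; exact: contM.
have eI : u t / us t - u s / us s = itg s t d.
  rewrite e//; apply: itg_eq => x xst; rewrite /d; field; exact: us0.
have aV : cont s t (fun x => (a x)^-1).
  apply: contV (contS s0 tL (jac_a J)) _ => x xst.
  by rewrite gt_eqF// (jac_a_gt0 J)//; exact: (sub_itvcc s0 tL).
have [K K0 dK] := cont_bounded (contM aV (contM cV cV)).
have le1 := itg_sqr_le st l2d.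
have le2 : itg s t (fun x => d x ^+ 2) <= K * itg s t (ric_sq u p).
  rewrite -itgZ//; apply: itg_le; [by case: l2d|exact: L1Z|].
  move=> x xst; have := dK x xst; rewrite /d /ric_sq.
  have a0 : 0 < a x by rewrite (jac_a_gt0 J)//; exact: (sub_itvcc s0 tL).
  have u0 := us0 x xst.
  rewrite ger0_norm; last by rewrite mulr_ge0 ?invr_ge0 ?(ltW a0)// -expr2 sqr_ge0.
  move=> kx; have -> : ((us x)^-1 ^+ 2 * (us x * p x - us1 x * u x)) ^+ 2 =
    ((a x)^-1 * ((us x)^-1 * (us x)^-1)) *
    (a x * (us x * p x - us1 x * u x) ^+ 2 / us x ^+ 2).
    by field; rewrite u0 gt_eqF.
  by rewrite ler_wpM2r// mulr_ge0 ?invr_ge0 ?sqr_ge0// mulr_ge0 ?sqr_ge0// ltW.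
rewrite z0 mulr0 in le2.
apply/eqP; rewrite -subr_eq0 eI -sqrf_eq0 eq_le sqr_ge0 andbT.
by apply: (le_trans le1); rewrite mulr_ge0_le0// subr_ge0.
Qed.


(** [us] vanishes at [c] to first order exactly, and u^2 is smaller than the
    distance to [c] by a factor int p^2 over a shrinking interval. *)
Lemma ric_small u p (e : R) : AC 0 L u p -> L2 0 L p -> u c = 0 -> 0 < e ->
  \forall T \near c, T != c -> `|ric T * u T ^+ 2| <= e.
Proof.
move=> ACu l2p uc e0.
have [_ _ dus] := jac_us J.
have /is_derive1_caratheodory [G [GE cG Gc]] := dus _ c_in.
have G0 : 0 < `|G c| / 2 by rewrite divr_gt0// normr_gt0 Gc (jac_us1c J).
have [cfs _ _] := jac_fs J.
have [M M0 fsM] := cont_bounded cfs.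
have lp2 : L1 0 L (fun x => p x ^+ 2) by case: l2p.
pose E t := itg 0 t (fun x => p x ^+ 2).
have cE : {for c, continuous E}.
  have := AC_cont L_ge0 (AC_itg L_ge0 lp2).
  by move/continuous_within_itvP => /(_ L_gt0)[+ _ _]; apply.
have u2 T : T \in `]0, L[ -> u T ^+ 2 <= `|T - c| * `|E c - E T|.
  rewrite in_itv/= => /andP[T0 TL].
  have [c0 cL] := andP (jac_c J).
  have [Tc|cT] := leP T c.
    have := itg_sqr_le Tc (L2S (ltW T0) (ltW cL) l2p).
    have <- : u c - u T = itg T c p by apply: (ACu.2) => //; exact: ltW.
    rewrite uc sub0r sqrrN => /le_trans; apply.
    rewrite distrC ger0_norm ?subr_ge0// ler_wpM2l ?subr_ge0//.
    rewrite /E (@itg_chasles _ 0 T c) ?(ltW T0)//; last exact: (L1S (lexx 0) (ltW cL) lp2).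
    by rewrite [X in `|X|]addrC addKr ler_norm.
  have := itg_sqr_le (ltW cT) (L2S (ltW c0) (ltW TL) l2p).
  have <- : u T - u c = itg c T p by apply: (ACu.2); exact: ltW.
  rewrite uc subr0 => /le_trans; apply.
  have cT' := ltW cT.
  rewrite ger0_norm ?subr_ge0// ler_wpM2l ?subr_ge0// distrC.
  rewrite /E (@itg_chasles _ 0 c T) ?(ltW c0) ?(ltW cT)//; last exact: (L1S (lexx 0) (ltW TL) lp2).
  by rewrite [X in `|X|]addrC addKr ler_norm.
have e1 : 0 < e * (`|G c| / 2) / M by rewrite divr_gt0// mulr_gt0.
near=> T => Tc.
have TL : T \in `]0, L[ by near: T; exact: near_in_itvoo.
have GT : `|G c| / 2 < `|G T|.
  have : `|G c - G T| < `|G c| / 2.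
    by near: T; exact: (@cvgr_dist_lt _ _ _ _ _ G (G c) cG _ G0).
  have := lerB_dist (G c) (G T); lra.
have ET : `|E c - E T| < e * (`|G c| / 2) / M.
  by near: T; exact: (@cvgr_dist_lt _ _ _ _ _ E (E c) cE _ e1).
have usT : us T = G T * (T - c) by rewrite -GE (jac_usc J) subr0.
rewrite normrM normrX real_normK ?num_real// /ric normrM normfV usT normrM.
have Tc0 : 0 < `|T - c| by rewrite normr_gt0 subr_eq0.
have GT0 : 0 < `|G T| by apply: lt_trans GT.
have fT := fsM T (subset_itv_oo_cc TL).
have uT := u2 T TL.
apply: (@le_trans _ _ (M / (`|G c| / 2 * `|T - c|) * (`|T - c| * `|E c - E T|))).
  apply: ler_pM; rewrite ?sqr_ge0//.
  apply: ler_pM => //; rewrite ?invr_ge0 ?mulr_ge0// ?(ltW GT0)//.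
  have P1 : `|G T| * `|T - c| \is Num.pos by rewrite posrE mulr_gt0.
  have P2 : `|G c| / 2 * `|T - c| \is Num.pos by rewrite posrE mulr_gt0.
  by rewrite (lef_pV2 P1 P2) ler_pM2r// ltW.
have -> : M / (`|G c| / 2 * `|T - c|) * (`|T - c| * `|E c - E T|) =
  M / (`|G c| / 2) * `|E c - E T|.
  have Gc0 : 0 < `|G c| by lra.
  by field; rewrite !gt_eqF.
rewrite mulrAC ler_pdivrMr//; apply: ltW.
by move: ET; rewrite ltr_pdivlMr// mulrC.
Unshelve. all: by end_near. Qed.


(** Apply Jacobi's identity up to a point S and let S tend to [c]: the flux
    vanishes at the outer end and [ric_small] removes the inner boundary
    term. *)
Lemma qform_half u p : AC 0 L u p -> L2 0 L p -> u c = 0 ->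
  (forall T, 0 <= T -> T < c -> itg 0 T (ric_sq u p) <= qform 0 c u p) /\
  (forall T, c < T -> T <= L -> itg T L (ric_sq u p) <= qform c L u p).
Proof.
move=> ACu l2p uc.
have [c0 cL] := andP (jac_c J).
have lq := L1_qform ACu l2p.
pose E t := qform 0 t u p.
have cE : {for c, continuous E}.
  have := AC_cont L_ge0 (AC_itg L_ge0 lq).
  by move/continuous_within_itvP => /(_ L_gt0)[+ _ _]; apply.
have EB s t : 0 <= s -> s <= t -> t <= L -> qform s t u p = E t - E s.
  move=> s0 st tL; rewrite /E /qform (@itg_chasles _ 0 s t)//; last exact: L1S lq.
  by rewrite [RHS]addrC addKr.
split=> T.
- move=> T0 Tc; apply/ler_addgt0Pr => e e0.
  have e2 : 0 < e / 2 by rewrite divr_gt0.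
  have nS : \forall S \near c^'-, `|ric S * u S ^+ 2| <= e / 2.
    rewrite near_withinE; apply: filterS (ric_small ACu l2p uc e2) => S HS Sc.
    by apply: HS; rewrite lt_eqF.
  have ES : \forall S \near c^'-, `|E c - E S| < e / 2.
    by apply: cvg_within; exact: (@cvgr_dist_lt _ _ _ _ _ E (E c) cE _ e2).
  near c^'- => S.
  have Sc : S < c by near: S; exact: nbhs_left_lt.
  have TS : T <= S by near: S; exact: nbhs_left_ge.
  have S0 : 0 <= S by exact: le_trans TS.
  have SL : S <= L by exact/ltW/(lt_trans Sc).
  have us0 x : x \in `[0, S] -> us x != 0.
    rewrite in_itv/= => /andP[x0 xS]; apply: (jac_us_neq0 J).
      by rewrite in_itv/= x0 (le_trans xS).
    by rewrite lt_eqF// (le_lt_trans xS).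
  have [lz] := riccati (lexx 0) S0 SL us0 ACu l2p.
  have -> : ric 0 = 0 by rewrite /ric (jac_fs0 J) mul0r.
  rewrite mul0r subr0 (itg_chasles T0 TS lz) EB// => eq.
  have z0 := ric_sq_ge0 u p T0 SL; have z1 := ric_sq_ge0 u p (le_trans T0 TS) SL.
  have z2 := ric_sq_ge0 (s := T) u p T0 SL.
  have E0 := EB 0 c (lexx 0) (ltW c0) (ltW cL).
  have : `|ric S * u S ^+ 2| <= e / 2 by near: S.
  have : `|E c - E S| < e / 2 by near: S.
  rewrite ltr_norml ler_norml => /andP[? ?] /andP[? ?].
  by rewrite E0; lra.
- move=> cT TL; apply/ler_addgt0Pr => e e0.
  have e2 : 0 < e / 2 by rewrite divr_gt0.
  have nS : \forall S \near c^'+, `|ric S * u S ^+ 2| <= e / 2.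
    rewrite near_withinE; apply: filterS (ric_small ACu l2p uc e2) => S HS Sc.
    by apply: HS; rewrite gt_eqF.
  have ES : \forall S \near c^'+, `|E c - E S| < e / 2.
    by apply: cvg_within; exact: (@cvgr_dist_lt _ _ _ _ _ E (E c) cE _ e2).
  near c^'+ => S.
  have Sc : c < S by near: S; exact: nbhs_right_gt.
  have TS : S <= T by near: S; exact: nbhs_right_le.
  have SL : S <= L by exact: le_trans TL.
  have S0 : 0 <= S by exact/ltW/(lt_trans c0).
  have us0 x : x \in `[S, L] -> us x != 0.
    rewrite in_itv/= => /andP[Sx xL]; apply: (jac_us_neq0 J).
      by rewrite in_itv/= xL (le_trans S0).
    by rewrite gt_eqF// (lt_le_trans Sc).
  have [lz] := riccati S0 SL (lexx L) us0 ACu l2p.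
  have -> : ric L = 0 by rewrite /ric (jac_fsL J) mul0r.
  rewrite mul0r addr0 (itg_chasles TS TL lz) EB// => eq.
  have z2 := ric_sq_ge0 (t := T) u p S0 TL.
  have E0 := EB c L (ltW c0) (ltW cL) (lexx L).
  have : `|ric S * u S ^+ 2| <= e / 2 by near: S.
  have : `|E c - E S| < e / 2 by near: S.
  rewrite ltr_norml ler_norml => /andP[? ?] /andP[? ?].
  by rewrite E0; lra.
Unshelve. all: by end_near. Qed.

(** Both halves of the form are nonnegative, and a half that vanishes has no
    room left for the square in Jacobi's identity. *)
Lemma qform_vanishing u p : AC 0 L u p -> L2 0 L p -> u c = 0 ->
  0 <= qform 0 L u p /\ (qform 0 L u p = 0 -> exists C1 C2,
    (forall t, t \in `[0, c] -> u t = C1 * us t) /\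
    (forall t, t \in `[c, L] -> u t = C2 * us t)).
Proof.
move=> ACu l2p uc.
have [c0 cL] := andP (jac_c J).
have [hl hr] := qform_half ACu l2p uc.
have lq := L1_qform ACu l2p.
have hl0 := hl 0 (lexx 0) c0; have hr0 := hr L cL (lexx L).
rewrite !itg_xx in hl0 hr0.
have qE : qform 0 L u p = qform 0 c u p + qform c L u p.
  by apply: itg_chasles => //; exact: ltW.
split=> [|q0]; first by rewrite qE addr_ge0.
have ql : qform 0 c u p = 0 by move: q0; rewrite qE; lra.
have qr : qform c L u p = 0 by move: q0; rewrite qE; lra.
exists (u 0 / us 0), (u L / us L); split=> t; rewrite in_itv/= => /andP[].
- move=> t0; rewrite le_eqVlt => /predU1P[->|tc].
    by rewrite uc (jac_usc J) mulr0.
  have tL : t <= L by exact/ltW/(lt_trans tc).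
  have us0 x : x \in `[0, t] -> us x != 0.
    rewrite in_itv/= => /andP[x0 xt]; apply: (jac_us_neq0 J).
      by rewrite in_itv/= x0 (le_trans xt).
    by rewrite lt_eqF// (le_lt_trans xt).
  rewrite -(ric_sq_itg0_prop (lexx 0) t0 tL us0 ACu l2p); last first.
    by apply/eqP; rewrite eq_le ric_sq_ge0// andbT; have := hl t t0 tc; rewrite ql.
  by rewrite divfK// us0// in_itv/= t0 lexx.
- rewrite le_eqVlt => /predU1P[<- _|ct tL].
    by rewrite uc (jac_usc J) mulr0.
  have t0 : 0 <= t by exact/ltW/(lt_trans c0).
  have us0 x : x \in `[t, L] -> us x != 0.
    rewrite in_itv/= => /andP[tx xL]; apply: (jac_us_neq0 J).
      by rewrite in_itv/= xL (le_trans t0).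
    by rewrite gt_eqF// (lt_le_trans ct).
  rewrite (ric_sq_itg0_prop t0 tL (lexx L) us0 ACu l2p); last first.
    by apply/eqP; rewrite eq_le ric_sq_ge0// andbT; have := hr t ct tL; rewrite qr.
  by rewrite divfK// us0// in_itv/= tL lexx.
Qed.

Lemma qform_us : qform 0 L us us1 = 0.
Proof.
have [_ e] := ACM L_ge0 (C1_AC (jac_fs J)) (C1_AC (jac_us J)).
have := e 0 L (lexx 0) L_ge0 (lexx L).
rewrite (jac_fs0 J) (jac_fsL J) !mul0r subrr => e0; apply: etrans (esym e0); apply: itg_eq => t t0L.
by rewrite (jac_fsE J)//; ring.
Qed.

(** Subtract from u the multiple of [v] that makes it vanish at [c].  As [v]
    represents the constraint and u satisfies it, the form splits into its value
    at the difference, which is nonnegative, and - al^2 int w v, which is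
    positive unless al = 0. *)
Theorem jacobi_kernel u p : AC 0 L u p -> L2 0 L p ->
  itg 0 L (fun t => w t * u t) = 0 ->
  (qform 0 L u p = 0 <-> exists C, forall t, t \in `[0, L] -> u t = C * us t).
Proof.
move=> ACu l2p wu0.
have [c0 cL] := andP (jac_c J).
have [[ca cb] cw] := (jac_a J, jac_b J, jac_w J).
have cu := AC_cont L_ge0 ACu.
have [cv cv1 _] := jac_v J; have [cus cus1 _] := jac_us J.
have [cfv _ _] := jac_fv J.
split=> [q0|[C uC]].
- set al := u c / v c.
  pose u1 t := u t - al * v t; pose p1 t := p t - al * v1 t.
  have ACu1 : AC 0 L u1 p1 by apply: ACB => //; apply: ACZ; exact: C1_AC (jac_v J).
  have l2v : L2 0 L (fun t => al * v1 t).
    by apply: L2_cont; apply: contM => //; exact: cont_cst.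
  have l2p1 : L2 0 L p1 by exact: L2B.
  have u1c : u1 c = 0 by rewrite /u1 /al divfK ?subrr// (jac_vc J).
  have cu1 := AC_cont L_ge0 ACu1.
  set N := itg 0 L (fun t => w t * v t).
  have N0 : N < 0 := jac_v_lt0 J.
  have lwv : L1 0 L (fun t => w t * v t) by apply: L1_cont; exact: contM.
  have lwu : L1 0 L (fun t => w t * u t) by apply: L1_cont; exact: contM.
  have lwu1 : L1 0 L (fun t => w t * u1 t) by apply: L1_cont; exact: contM.
  (* Green's formula: v represents the constraint *)
  have green u' p' : AC 0 L u' p' ->
      itg 0 L (fun t => a t * v1 t * p' t + b t * v t * u' t) =
      itg 0 L (fun t => w t * u' t).
    move=> ACu'; have [l e] := ACM L_ge0 (C1_AC (jac_fv J)) ACu'.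
    have lw : L1 0 L (fun t => w t * u' t).
      by apply: L1_cont; apply: contM => //; exact: AC_cont ACu'.
    have := e 0 L (lexx 0) L_ge0 (lexx L).
    rewrite (jac_fv0 J) (jac_fvL J) !mul0r subrr => e0.
    rewrite -[RHS]add0r -[X in X + _](esym e0) -itgD//; apply: itg_eq => t t0L.
    by rewrite (jac_fvE J)//; ring.
  have g1 : itg 0 L (fun t => a t * v1 t * p1 t + b t * v t * u1 t) = - (al * N).
    rewrite green// (itg_eq (g := fun t => w t * u t - al * (w t * v t))).
      by rewrite itgB ?itgZ//; [rewrite wu0 sub0r|exact: L1Z].
    by move=> t _; rewrite /u1; ring.
  have g2 := green v v1 (C1_AC (jac_v J)); rewrite -/N in g2.
  have lg1 : L1 0 L (fun t => a t * v1 t * p1 t + b t * v t * u1 t).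
    apply: L1D; last by apply: L1_cont; do 2 apply: contM => //.
    by apply: L1M; [exact: contM|exact: L2_L1].
  have lg2 : L1 0 L (fun t => a t * v1 t * v1 t + b t * v t * v t).
    by apply: L1_cont; apply: contD; do 2 apply: contM => //.
  have lq1 := L1_qform ACu1 l2p1.
  have qE : qform 0 L u p = qform 0 L u1 p1 - al ^+ 2 * N.
    rewrite {1}/qform (itg_eq (g := fun t => (a t * p1 t ^+ 2 + b t * u1 t ^+ 2) +
      ((2 * al) * (a t * v1 t * p1 t + b t * v t * u1 t) +
      al ^+ 2 * (a t * v1 t * v1 t + b t * v t * v t)))); last first.
      by move=> t _; rewrite /u1 /p1; ring.
    have lZ1 := L1Z (2 * al) lg1; have lZ2 := L1Z (al ^+ 2) lg2.
    rewrite (itgD lq1 (L1D lZ1 lZ2)) (itgD lZ1 lZ2) (itgZ _ lg1) (itgZ _ lg2).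
    by rewrite g1 g2 /qform; ring.
  have [q1 H1] := qform_vanishing ACu1 l2p1 u1c.
  have al0 : al = 0.
    apply/eqP; rewrite -sqrf_eq0 eq_le sqr_ge0 andbT leNgt; apply/negP => al2.
    have : al ^+ 2 * N < 0 by rewrite pmulr_rlt0.
    by move: q0; rewrite qE; lra.
  have q10 : qform 0 L u1 p1 = 0 by move: q0; rewrite qE al0 expr0n mul0r subr0.
  have [C1 [C2 [h1 h2]]] := H1 q10.
  have u1E t : u1 t = u t by rewrite /u1 al0 mul0r subr0.
  have lwus : L1 0 L (fun t => w t * us t) by apply: L1_cont; exact: contM.
  have c0' := ltW c0; have cL' := ltW cL.
  have C12 : C1 = C2.
    have e1 : itg 0 c (fun t => w t * u t) = C1 * itg 0 c (fun t => w t * us t).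
      rewrite -itgZ; last exact: L1S lwus.
      by apply: itg_eq => t t0c; rewrite -u1E h1//; ring.
    have e2 : itg c L (fun t => w t * u t) = C2 * itg c L (fun t => w t * us t).
      rewrite -itgZ; last exact: L1S lwus.
      by apply: itg_eq => t t0c; rewrite -u1E h2//; ring.
    have e3 := itg_chasles c0' cL' lwus; rewrite (jac_us_mean J) in e3.
    have e4 := itg_chasles c0' cL' lwu; rewrite wu0 e1 e2 in e4.
    apply/eqP; rewrite -subr_eq0; apply/eqP; apply: (mulIf (jac_us_half J)).
    rewrite mul0r mulrBl.
    have -> : C2 * itg 0 c (fun t => w t * us t) = - (C2 * itg c L (fun t => w t * us t)).
      by rewrite -mulrN; congr (_ * _); lra.
    by rewrite opprK -e4.
  exists C1 => t; rewrite in_itv/= => /andP[t0 tL]; rewrite -u1E.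
  have [tc|ct] := leP t c; first by rewrite h1// in_itv/= t0.
  by rewrite C12 h2// in_itv/= ltW.
- have lp1 : L1 0 L (fun t => p t - C * us1 t).
    by apply: L1B; [exact: L2_L1|apply: L1_cont; apply: contM => //; exact: cont_cst].
  have ae0 : {ae (@lebesgue_measure R), forall t, t \in `]0, L[ -> p t - C * us1 t = 0}.
    apply: (L1_itg_cst_ae (k := 0)) => // t; rewrite in_itv/= => /andP[/ltW t0 /ltW tL].
    have [_ <-] := ACB ACu (ACZ C (C1_AC (jac_us J))) => //.
    by rewrite !uC ?subrr// in_itv/= ?lexx ?t0 ?tL ?L_ge0.
  apply: (@etrans _ _ (C ^+ 2 * qform 0 L us us1)); last by rewrite qform_us mulr0.
  rewrite /qform -itgZ; last first.
    apply: L1_cont; apply: contD; apply: contM => //; exact: contM.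
  apply: itg_ae_eq.
  + exact: L1_qform.
  + by apply: L1Z; apply: L1_cont; apply: contD; apply: contM => //; exact: contM.
  + apply: aeS ae0.
    move=> t H t0L; have /eqP := H t0L; rewrite subr_eq0 => /eqP ->.
    by rewrite uC ?(subset_itv_oo_cc t0L)//; ring.
Qed.

End SturmForm.

(** * Geometry of a sessile drop *)

Section Drop.
Context {R : realType}.

(** [drop_EL] is the equation sigma * curvature = P - g * height, where the
    curvature of the polar curve r is
    (r^2 + 2 r'^2 - r r'') / (r^2 + r'^2)^(3/2). *)
Record drop_profile (g sigma P : R) (r r1 r2 : R -> R) : Prop := DropProfile {
  drop_g : 0 < g;
  drop_sigma : 0 < sigma;
  drop_r : C1 0 pi r r1;
  drop_r1 : C1 0 pi r1 r2;
  drop_gt0 : forall t, t \in `[0, pi] -> 0 < r t;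
  drop_mid : r1 (pi / 2) = 0;
  drop_EL : forall t, t \in `]0, pi[ ->
    sigma * (r t ^+ 2 + 2 * r1 t ^+ 2 - r2 t * r t) =
    (P - g * (r t * sin t)) * Num.sqrt (r t ^+ 2 + r1 t ^+ 2) ^+ 3 }.

Context (g sigma P : R) (r r1 r2 : R -> R).
Hypothesis D : drop_profile g sigma P r r1 r2.

Definition xco t := r t * cos t.
Definition yco t := r t * sin t.
Definition xco' t := r1 t * cos t - r t * sin t.
Definition yco' t := r1 t * sin t + r t * cos t.
Definition speed2 t := r t ^+ 2 + r1 t ^+ 2.
Definition speed t := Num.sqrt (speed2 t).
(** The pressure jump across the interface, that is sigma times the
    curvature. *)
Definition press t := P - g * yco t.

Let pi0 : 0 < pi :> R. Proof. exact: pi_gt0. Qed.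
Let pi0' : 0 <= pi :> R. Proof. exact: pi_ge0. Qed.
Let sg0 := drop_sigma D.
Let g0 := drop_g D.
Let Cr := drop_r D.
Let Cr1 := drop_r1 D.

Lemma r_neq0 t : t \in `[0, pi] -> r t != 0.
Proof. by move=> t0; rewrite gt_eqF// (drop_gt0 D). Qed.

Lemma speed2_gt0 t : t \in `[0, pi] -> 0 < speed2 t.
Proof. by move=> t0; rewrite /speed2 ltr_pwDl ?sqr_ge0// exprn_gt0// (drop_gt0 D). Qed.

Lemma speed_gt0 t : t \in `[0, pi] -> 0 < speed t.
Proof. by move=> t0; rewrite /speed sqrtr_gt0 speed2_gt0. Qed.

Lemma speed_sqr t : t \in `[0, pi] -> speed t ^+ 2 = r t ^+ 2 + r1 t ^+ 2.
Proof. by move=> t0; rewrite /speed sqr_sqrtr// ltW// speed2_gt0. Qed.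

Lemma cos2E t : cos t ^+ 2 = 1 - sin t ^+ 2 :> R.
Proof. by rewrite -(cos2Dsin2 t) addrK. Qed.

Lemma C1_xco : C1 0 pi xco xco'.
Proof.
apply: C1_eq (C1M Cr (C1_cos 0 pi)) => t _; rewrite /xco'; ring.
Qed.

Lemma C1_yco : C1 0 pi yco yco'.
Proof. by apply: C1_eq (C1M Cr (C1_sin 0 pi)) => t _. Qed.

Lemma C1_xco' : C1 0 pi xco' (fun t => r2 t * cos t - 2 * r1 t * sin t - r t * cos t).
Proof.
apply: C1_eq (C1B (C1M Cr1 (C1_cos 0 pi)) (C1M Cr (C1_sin 0 pi))) => t _; ring.
Qed.

Lemma C1_yco' : C1 0 pi yco' (fun t => r2 t * sin t + 2 * r1 t * cos t - r t * sin t).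
Proof.
apply: C1_eq (C1D (C1M Cr1 (C1_sin 0 pi)) (C1M Cr (C1_cos 0 pi))) => t _; ring.
Qed.

Lemma C1_press : C1 0 pi press (fun t => - (g * yco' t)).
Proof.
apply: C1_eq (C1B (C1_cst 0 pi P) (C1Z g C1_yco)) => t _; ring.
Qed.

Lemma C1_speed : C1 0 pi speed (fun t => r1 t * (r t + r2 t) / speed t).
Proof.
have Cq : C1 0 pi speed2 (fun t => 2 * (r1 t * (r t + r2 t))).
  have := C1D (C1M Cr Cr) (C1M Cr1 Cr1); rewrite /speed2 => C.
  apply: C1_eq C => t _; ring.
apply: C1_eq (C1_sqrt Cq speed2_gt0) => t t0; rewrite /speed; field.
by rewrite gt_eqF// sqrtr_gt0 speed2_gt0.
Qed.

(** The unit tangent.  It rotates at a speed given by the curvature, so that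
    the equilibrium equation is a pendulum equation for the tangent angle; in
    terms of (tanx, tany) it is [C1_tanx] and [C1_tany]. *)
Definition tanx t := xco' t / speed t.
Definition tany t := yco' t / speed t.

Lemma tan_unit t : t \in `[0, pi] -> tanx t ^+ 2 + tany t ^+ 2 = 1.
Proof.
move=> t0; have N0 := speed_gt0 t0; rewrite /tanx /tany !expr_div_n speed_sqr// -mulrDl.
have -> : xco' t ^+ 2 + yco' t ^+ 2 = r t ^+ 2 + r1 t ^+ 2.
  by rewrite /xco' /yco'; have := cos2E t; move: (cos t) (sin t) => c s c2; ring: c2.
by rewrite divff// gt_eqF// -/(speed2 t) speed2_gt0.
Qed.

Let cN : cont 0 pi speed. Proof. by case: C1_speed. Qed.
Let ck : cont 0 pi press. Proof. by case: C1_press. Qed.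
Let cx1 : cont 0 pi xco'. Proof. by case: C1_xco'. Qed.
Let cy1 : cont 0 pi yco'. Proof. by case: C1_yco'. Qed.
Let N_neq0 t : t \in `[0, pi] -> speed t != 0.
Proof. by move=> t0; rewrite gt_eqF// speed_gt0. Qed.

Lemma equilibriumE t : t \in `]0, pi[ ->
  r t ^+ 2 + 2 * r1 t ^+ 2 - r2 t * r t = press t * speed t ^+ 3 / sigma.
Proof.
by move=> t0; rewrite /press /yco /speed /speed2 -(drop_EL D t0) mulrAC divff ?mul1r// gt_eqF.
Qed.

Lemma C1_tanx : C1 0 pi tanx (fun t => - (yco' t * press t / sigma)).
Proof.
apply: C1_eqo (C1M C1_xco' (C1V C1_speed N_neq0)) _ _.
  by apply: contN; apply: contM; [exact: contM|exact: cont_cst].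
move=> t t0; have t0' := subset_itv_oo_cc t0; have N0 := N_neq0 t0'.
have E := equilibriumE t0; have N2 := speed_sqr t0'.
apply: (mulIf (expf_neq0 3 N0)).
have -> : - (yco' t * press t / sigma) * speed t ^+ 3 = - yco' t * (press t * speed t ^+ 3 / sigma) by ring.
rewrite -E.
transitivity ((r2 t * cos t - 2 * r1 t * sin t - r t * cos t) * speed t ^+ 2
  - xco' t * (r1 t * (r t + r2 t))).
  by field.
by rewrite N2 /xco' /yco'; ring.
Qed.

Lemma C1_tany : C1 0 pi tany (fun t => xco' t * press t / sigma).
Proof.
apply: C1_eqo (C1M C1_yco' (C1V C1_speed N_neq0)) _ _.
  by apply: contM; [exact: contM|exact: cont_cst].
move=> t t0; have t0' := subset_itv_oo_cc t0; have N0 := N_neq0 t0'.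
have E := equilibriumE t0; have N2 := speed_sqr t0'.
apply: (mulIf (expf_neq0 3 N0)).
have -> : (xco' t * press t / sigma) * speed t ^+ 3 = xco' t * (press t * speed t ^+ 3 / sigma) by ring.
rewrite -E.
transitivity ((r2 t * sin t + 2 * r1 t * cos t - r t * sin t) * speed t ^+ 2
  - yco' t * (r1 t * (r t + r2 t))).
  by field.
by rewrite N2 /xco' /yco'; ring.
Qed.

Lemma zero_in0pi : 0 \in `[0, @pi R]. Proof. by rewrite in_itv/= lexx pi0'. Qed.
Lemma half_in0pi : pi / 2 \in `]0, @pi R[.
Proof. by rewrite in_itv/= divr_gt0//= ltr_pdivrMr// ltr_pMr// ltr1n. Qed.
Let half_in0pi' : pi / 2 \in `[0, @pi R]. Proof. exact: subset_itv_oo_cc half_in0pi. Qed.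
Let half0 : 0 <= pi / 2 :> R. Proof. by rewrite divr_ge0. Qed.
Let halfpi : pi / 2 <= pi :> R. Proof. by case/andP: half_in0pi => _ /ltW. Qed.

Lemma yco_0 : yco 0 = 0. Proof. by rewrite /yco sin0 mulr0. Qed.
Lemma yco_pi : yco pi = 0. Proof. by rewrite /yco sinpi mulr0. Qed.
Lemma yco_ge0 t : t \in `[0, pi] -> 0 <= yco t.
Proof. by move=> t0; rewrite mulr_ge0 ?sin_ge0_pi// ltW// (drop_gt0 D). Qed.

Let H := yco (pi / 2).
Lemma H_gt0 : 0 < H.
Proof. by rewrite /H /yco sin_pihalf mulr1 (drop_gt0 D). Qed.
Lemma tany_half : tany (pi / 2) = 0.
Proof. by rewrite /tany /yco' (drop_mid D) cos_pihalf mul0r mulr0 addr0 mul0r. Qed.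
Lemma tanx_half : tanx (pi / 2) = -1.
Proof.
have r0 := drop_gt0 D half_in0pi'.
rewrite /tanx /xco' /speed /speed2 (drop_mid D) cos_pihalf sin_pihalf mulr0 mulr1 sub0r.
by rewrite expr0n addr0 sqrtr_sqr gtr0_norm// mulNr divff// gt_eqF.
Qed.

(** Energy conservation for the pendulum, with the constant evaluated at the
    apex, where the tangent is (-1, 0). *)
Lemma first_integral t : t \in `[0, pi] ->
  sigma * (tanx t + 1) = (H - yco t) * (P - g * (yco t + H) / 2).
Proof.
move=> t0; pose F s := sigma * tanx s + P * yco s - g / 2 * (yco s * yco s).
have CF : C1 0 pi F (fun=> 0).
  apply: C1_eq (C1B (C1D (C1Z sigma C1_tanx) (C1Z P C1_yco)) (C1Z (g / 2) (C1M C1_yco C1_yco))).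
  by move=> s _; rewrite /press; field; rewrite gt_eqF.
have Fc s : s \in `[0, pi] -> F s = F 0.
  rewrite in_itv/= => /andP[s0 spi]; apply/eqP; rewrite -subr_eq0.
  by rewrite (C1_FTC s0 (C1S (lexx 0) spi CF)) itg_cst// mul0r.
have := Fc _ t0; rewrite -(Fc _ half_in0pi') /F tanx_half -/H => e.
by move: e; rewrite mulrN1 => e; lra.
Qed.

Lemma tanx_geN1 t : t \in `[0, pi] -> 0 <= tanx t + 1.
Proof.
move=> t0; have := tan_unit t0; have := sqr_ge0 (tany t); move: (tanx t) (tany t) => C S; nra.
Qed.

(** Every height between 0 and H is attained, and there the right-hand side of
    the first integral is nonnegative because tanx >= -1; were P < g H, it would
    be negative at some of these heights. *)
Lemma P_gegH : g * H <= P.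
Proof.
rewrite leNgt; apply/negP => PH; have H0 := H_gt0.
(* P / g is the height of vanishing curvature, possibly below the floor *)
pose ys := Num.max 0 (P / g).
have ys0 : 0 <= ys by rewrite le_max lexx.
have ysH : ys < H by rewrite gt_max H0 ltr_pdivrMr// mulrC.
have ysP : P <= g * ys by rewrite mulrC -ler_pdivrMr// le_max lexx orbT.
have [s s0 ys_s] : exists2 s, s \in `[0, pi / 2] & yco s = ys.
  apply: IVT => //; first by apply: contS halfpi _ => //; case: C1_yco.
  by rewrite yco_0 -/H min_l ?max_r ?(ltW H0)// ys0 ltW.
have s0' : s \in `[0, pi] by apply: (sub_itvcc (lexx 0) halfpi).
have := tanx_geN1 s0'; rewrite -(pmulr_rge0 _ sg0) first_integral// ys_s.
rewrite pmulr_rge0 ?subr_gt0//; nra.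
Qed.

(** If P = g H the apex would be an equilibrium of the pendulum: by the first
    integral y'^2 <= K (H - y)^2, and by Gronwall's inequality the curve could
    not come from height 0. *)
Lemma P_gtgH : g * H < P.
Proof.
rewrite lt_neqAle P_gegH andbT; apply/eqP => PE; have H0 := H_gt0.
have [M M0 NM] := cont_bounded cN.
(* 2 (H - y) y' <= (H - y)^2 + y'^2 is absorbed by this rate *)
pose La := 1 + M ^+ 2 * (g / sigma).
pose F s := (H - yco s) * (H - yco s) * expR (La * s).
pose f s := expR (La * s) * (La * ((H - yco s) * (H - yco s)) - 2 * ((H - yco s) * yco' s)).
have CH := C1B (C1_cst 0 pi H) C1_yco.
have Ce : C1 0 pi (fun s => expR (La * s)) (fun s => expR (La * s) * La).
  have := @C1_comp R 0 pi _ _ expR expR (C1Z La (C1_id 0 pi)) _ _.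
  move/(_ _ _)/(C1_eq _); apply=> s _; first by rewrite mulr1.
  exact: (@continuous_expR R).
have CF : C1 0 pi F f.
  apply: C1_eq (C1M (C1M CH CH) Ce) => s _; rewrite /f; ring.
have f0 s : s \in `[0, pi] -> 0 <= f s.
  move=> s0; apply: mulr_ge0; first exact: expR_ge0.
  have N0 := speed_gt0 s0; have NMs := NM s s0.
  have e1 : sigma * (tanx s + 1) = g / 2 * (H - yco s) ^+ 2.
    by rewrite first_integral// -PE; field.
  have S2 : tany s ^+ 2 <= g / sigma * (H - yco s) ^+ 2.
    have -> : g / sigma * (H - yco s) ^+ 2 = 2 * (tanx s + 1).
      have e2 : g * (H - yco s) ^+ 2 = 2 * (sigma * (tanx s + 1)) by rewrite e1; field.
      by rewrite mulrAC e2; field; rewrite gt_eqF.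
    by have := tan_unit s0; move: (tanx s) (tany s) => C S; nra.
  have y2 : yco' s ^+ 2 <= M ^+ 2 * (g / sigma) * (H - yco s) ^+ 2.
    have -> : yco' s = tany s * speed s by rewrite /tany divfK// N_neq0.
    rewrite exprMn mulrC -mulrA ler_pM ?sqr_ge0//.
    by rewrite ler_pXn2r ?nnegrE ?(ltW N0) ?(ltW M0)// (le_trans _ NMs)// ler_norm.
  rewrite subr_ge0 /La.
  move: y2; set A := M ^+ 2 * (g / sigma); set h := H - yco s; set y1 := yco' s => y2.
  have := sqr_ge0 (h - y1); rewrite sqrrB; nra.
have F1 := C1_FTC half0 (C1S (lexx 0) halfpi CF).
have : 0 <= itg 0 (pi / 2) f.
  by apply: itg_ge0 => s s0; apply: f0; apply: (sub_itvcc (lexx 0) halfpi).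
rewrite -F1 /F -/H subrr !mul0r yco_0 subr0 mulr0 expR0 mulr1 sub0r.
by rewrite oppr_ge0 leNgt mulr_gt0.
Qed.

(** Slightly above H the first integral would give tanx < -1, and by
    continuity the curve cannot jump over these heights. *)
Lemma yco_leH t : t \in `[0, pi] -> yco t <= H.
Proof.
move=> t0; rewrite leNgt; apply/negP => Ht; have H0 := H_gt0.
have HP : H < P / g by rewrite ltr_pdivlMr// mulrC P_gtgH.
(* any height between H and 2 P / g - H contradicts the first integral *)
pose ys := Num.min (yco t) (P / g).
have ysH : H < ys by rewrite lt_min Ht.
have yst : ys <= yco t by rewrite ge_min lexx.
have ysP : g * ys <= P by rewrite mulrC -ler_pdivlMr// ge_min lexx orbT.
have [t0' tpi] := andP (t0 : 0 <= t <= pi).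
have [s s0 ys_s] : exists2 s, s \in `[0, t] & yco s = ys.
  apply: IVT => //; first by apply: contS (lexx 0) tpi _; case: C1_yco.
  rewrite yco_0 min_l ?max_r ?(ltW (lt_trans H0 Ht))// yst andbT.
  exact: ltW (lt_trans H0 ysH).
have s0' : s \in `[0, pi] by apply: (sub_itvcc (lexx 0) tpi).
have := tanx_geN1 s0'; rewrite -(pmulr_rge0 _ sg0) first_integral// ys_s.
rewrite nmulr_rge0 ?subr_lt0//; have := P_gtgH; nra.
Qed.

Lemma press_gt0 t : t \in `[0, pi] -> 0 < press t.
Proof.
move=> t0; rewrite subr_gt0 (le_lt_trans _ P_gtgH)// ler_pM2l//; exact: yco_leH.
Qed.

(** By the first integral tanx decreases with the height, and at height 0 the
    curve leaves the floor transversally, as r(0) > 0. *)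
Lemma tanx_lt1 t : t \in `[0, pi] -> tanx t < 1.
Proof.
move=> t0.
have c01 : tanx 0 < 1.
  have S0 : 0 < tany 0.
    by rewrite /tany divr_gt0 ?speed_gt0 ?zero_in0pi// /yco' sin0 cos0 mulr0 add0r mulr1 (drop_gt0 D) ?zero_in0pi.
  by have := tan_unit zero_in0pi; move: (tanx 0) (tany 0) S0 => C S S0; nra.
have := first_integral zero_in0pi; have := first_integral t0; rewrite yco_0.
have := press_gt0 t0; rewrite /press; have := yco_ge0 t0; move: (yco t) (tanx t) (tanx 0) c01 => y c c0 c01 y0 k0 e1 e2.
have : sigma * (c0 - c) = y * (P - g * y / 2).
  by rewrite mulrBr; move: e1 e2; lra.
have Py : 0 <= P - g * y / 2.
  by have gy : 0 <= g * y := mulr_ge0 (ltW g0) y0; lra.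
move=> e; have := mulr_ge0 y0 Py; rewrite -e pmulr_rge0// subr_ge0 => h.
exact: le_lt_trans h c01.
Qed.

(** The ratio tany / (1 - tanx) is the cotangent of half the tangent angle.
    It is strictly decreasing because the curvature is positive, and it
    vanishes at the apex. *)
Lemma tany_sign t : t \in `[0, pi] ->
  (t < pi / 2 -> 0 < tany t) /\ (pi / 2 < t -> tany t < 0).
Proof.
have u0 s : s \in `[0, pi] -> 0 < 1 - tanx s by move=> s0; rewrite subr_gt0 tanx_lt1.
have u_neq0 s : s \in `[0, pi] -> 1 - tanx s != 0 by move=> s0; rewrite gt_eqF// u0.
have CB := C1B (C1_cst 0 pi 1) C1_tanx.
have CT := C1N (C1M C1_tany (C1V CB u_neq0)).
have T0 : - (tany (pi / 2) * (1 - tanx (pi / 2))^-1) = 0 by rewrite tany_half mul0r oppr0.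
have incr := C1_incr CT _.
move=> t0; have /andP[t0' tpi] : 0 <= t <= pi by [].
have f0 : forall s, s \in `]0, pi[ -> 0 < - (xco' s * press s / sigma * (1 - tanx s)^-1 +
   tany s * (- (0 - - (yco' s * press s / sigma)) / (1 - tanx s) ^+ 2)).
  move=> s s0; have s0' := subset_itv_oo_cc s0; have N0 := speed_gt0 s0'.
  have -> : xco' s = tanx s * speed s by rewrite /tanx divfK// N_neq0.
  have -> : yco' s = tany s * speed s by rewrite /tany divfK// N_neq0.
  have -> : - (tanx s * speed s * press s / sigma * (1 - tanx s)^-1 +
     tany s * (- (0 - - (tany s * speed s * press s / sigma)) / (1 - tanx s) ^+ 2)) =
     speed s * press s / sigma / (1 - tanx s).
    have S2 : tany s ^+ 2 = 1 - tanx s ^+ 2 by rewrite -(tan_unit s0') addrAC subrr add0r.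
    have := u_neq0 s s0'.
    move: (tanx s) (tany s) (speed s) (press s) S2 => c' s' n' k' S2 u1.
    by field: S2; rewrite u1 gt_eqF.
  by rewrite !divr_gt0 ?mulr_gt0 ?press_gt0 ?u0.
split=> tc.
- have := incr f0 t (pi / 2) t0' tc halfpi; rewrite T0 oppr_lt0 => h.
  by move: h; rewrite pmulr_lgt0// invr_gt0 u0.
- have := incr f0 (pi / 2) t half0 tc tpi; rewrite T0 oppr_gt0 => h.
  by move: h; rewrite pmulr_llt0// invr_gt0 u0.
Qed.


(** Coefficients of the second variation and weight of the volume constraint,
    in the unknown u = xi / r. *)
Definition coef_a t := sigma * r t ^+ 4 / speed t ^+ 3.
Definition coef_b t := r t ^+ 2 * (2 * (g * yco t) - P).
Definition coef_w t := r t ^+ 2.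

(** The Jacobi field of the horizontal translations: moving the curve by c
    changes r at first order by c y' / r. *)
Definition shift_field t := yco' t / r t ^+ 2.
Definition shift_flux t := - (press t * yco t).

(** The field of the pressure: parametrized by its tangent angle psi, the drop
    has y = (P - K) / g and dx = sigma cos(psi) / K dpsi, with
    K^2 = P^2 - 2 g sigma (cos(psi_0) - cos(psi)) and psi_0 its value at the floor.
    Differentiating in P at fixed psi gives dy/dP = - y / K and
    dx/dP = - P int x' / K^2; [press_field] is the resulting normal
    displacement, in the unknown u. *)
Definition press_int t := itg 0 t (fun s => xco' s / press s ^+ 2).
Definition press_field t := xco' t * yco t / (press t * r t ^+ 2) - P * press_int t * shift_field t.
Definition press_flux t := yco t * (P * press_int t * press t - xco t).

Lemma coef_a_gt0 t : t \in `[0, pi] -> 0 < coef_a t.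
Proof.
by move=> t0; rewrite divr_gt0 ?mulr_gt0 ?exprn_gt0 ?speed_gt0 ?(drop_gt0 D).
Qed.

Let k_neq0 t : t \in `[0, pi] -> press t != 0.
Proof. by move=> t0; rewrite gt_eqF// press_gt0. Qed.
Let s_neq0 : sigma != 0. Proof. by rewrite gt_eqF. Qed.
Let cr : cont 0 pi r. Proof. by case: Cr. Qed.
Let cy : cont 0 pi yco. Proof. by case: C1_yco. Qed.
Let cx : cont 0 pi xco. Proof. by case: C1_xco. Qed.

Lemma cont_coef_a : cont 0 pi coef_a.
Proof.
apply: contM; first by apply: contM; [exact: cont_cst|exact: contX].
apply: contV; first exact: contX.
by move=> t t0; rewrite expf_neq0// N_neq0.
Qed.

Lemma cont_coef_b : cont 0 pi coef_b.
Proof.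
apply: contM; first exact: contX.
apply: contB; last exact: cont_cst.
by apply: contM; [exact: cont_cst|apply: contM => //; exact: cont_cst].
Qed.

Lemma cont_coef_w : cont 0 pi coef_w. Proof. exact: contX. Qed.

Let a_neq0 t : t \in `[0, pi] -> coef_a t != 0.
Proof. by move=> t0; rewrite gt_eqF// coef_a_gt0. Qed.

Lemma C1_r2V : C1 0 pi (fun t => (r t ^+ 2)^-1) (fun t => - (2 * r1 t) / r t ^+ 3).
Proof.
have C2 : C1 0 pi (fun t => r t ^+ 2) (fun t => 2 * (r t * r1 t)).
  apply: C1_eq (C1M Cr Cr) => t _; ring.
have r2n t : t \in `[0, pi] -> r t ^+ 2 != 0 by move=> t0; rewrite expf_neq0// r_neq0.
apply: C1_eq (C1V C2 r2n) => t t0; field; exact: r_neq0.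
Qed.

Lemma C1_shift_flux : C1 0 pi shift_flux (fun t => coef_b t * shift_field t).
Proof.
apply: C1_eq (C1N (C1M C1_press C1_yco)) => t t0; rewrite /coef_b /shift_field /press.
by field; exact: r_neq0.
Qed.

Lemma C1_shift_field : C1 0 pi shift_field (fun t => shift_flux t / coef_a t).
Proof.
have cfs : cont 0 pi shift_flux by case: C1_shift_flux.
apply: C1_eqo (C1M C1_yco' C1_r2V) _ _.
  by apply: contM => //; apply: contV => //; exact: cont_coef_a.
move=> t t0; have t0' := subset_itv_oo_cc t0.
have E := equilibriumE t0; have N0 := N_neq0 t0'; have rn := r_neq0 t0'.
have -> : shift_flux t / coef_a t = - (press t * speed t ^+ 3 / sigma) * yco t / r t ^+ 4.
  by rewrite /shift_flux /coef_a; field; rewrite N0 rn s_neq0.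
by rewrite -E /yco' /yco; field.
Qed.

Let cI : cont 0 pi (fun s => xco' s / press s ^+ 2).
Proof.
apply: contM => //; apply: contV; first exact: contX.
by move=> t t0; rewrite expf_neq0// k_neq0.
Qed.

Lemma C1_press_int : C1 0 pi press_int (fun s => xco' s / press s ^+ 2).
Proof. exact: C1_itg. Qed.

(** The inhomogeneous term comes from x' y - x y' = - r^2. *)
Lemma C1_press_flux : C1 0 pi press_flux (fun t => coef_b t * press_field t - coef_w t).
Proof.
have C := C1M C1_yco (C1B (C1M (C1Z P C1_press_int) C1_press) C1_xco).
apply: C1_eq C => t t0; rewrite /coef_b /press_field /coef_w /shift_field.
have rn := r_neq0 t0; have kn := k_neq0 t0.
have xy : xco' t * yco t - xco t * yco' t = - r t ^+ 2.
  rewrite /xco' /xco /yco' /yco; have := cos2E t.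
  by move: (cos t) (sin t) => c s c2; ring: c2.
rewrite -[X in _ = _ - X]opprK -xy; move: kn; rewrite /press => kn.
by field; rewrite rn kn.
Qed.

Lemma C1_press_field : C1 0 pi press_field (fun t => press_flux t / coef_a t).
Proof.
have cfv : cont 0 pi press_flux by case: C1_press_flux.
have C := C1B (C1M (C1M (C1M C1_xco' C1_yco) (C1V C1_press k_neq0)) C1_r2V)
  (C1M (C1Z P C1_press_int) C1_shift_field).
have -> : press_field = fun t => xco' t * yco t * (press t)^-1 * (r t ^+ 2)^-1 - P * press_int t * shift_field t.
  by apply/funext => t; rewrite /press_field invfM !mulrA.
apply: C1_eqo C _ _.
  by apply: contM => //; apply: contV => //; exact: cont_coef_a.
move=> t t0; have t0' := subset_itv_oo_cc t0.
have E := equilibriumE t0; have N0 := N_neq0 t0'; have rn := r_neq0 t0'; have kn := k_neq0 t0'.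
have jE : shift_flux t / coef_a t = - (press t * speed t ^+ 3 / sigma) * yco t / r t ^+ 4.
  by rewrite /shift_flux /coef_a; field; rewrite N0 rn s_neq0.
have -> : press_flux t / coef_a t = (press t * speed t ^+ 3 / sigma) *
    (yco t * (P * press_int t - xco t / press t)) / r t ^+ 4.
  by rewrite /press_flux /coef_a; field; rewrite N0 rn s_neq0 kn.
rewrite jE -E /shift_field.
have Pk : P = press t + g * yco t by rewrite /press; ring.
rewrite Pk; move: kn; move: (press t) (press_int t) => k I kn.
rewrite /yco /xco' /xco /yco'; move: (cos t) (sin t) => c s.
by field; rewrite rn kn.
Qed.

Lemma shift_field_neq0 t : t \in `[0, pi] -> t != pi / 2 -> shift_field t != 0.
Proof.
move=> t0 tc; have [hl hr] := tany_sign t0.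
have : tany t != 0.
  by case: (ltgtP t (pi / 2)) tc hl hr => // tc _ hl hr;
    [rewrite gt_eqF// hl|rewrite lt_eqF// hr].
by rewrite /tany /shift_field !mulf_eq0 !negb_or !invr_eq0 expf_neq0 ?r_neq0// => /andP[-> _].
Qed.

Lemma shift_field_half : shift_field (pi / 2) = 0.
Proof.
have := tany_half; rewrite /tany /shift_field => /eqP; rewrite mulf_eq0 invr_eq0.
by rewrite (negbTE (N_neq0 half_in0pi')) orbF => /eqP ->; rewrite mul0r.
Qed.

Lemma itg_coef_w_shift_field s t : 0 <= s -> s <= t -> t <= pi ->
  itg s t (fun x => coef_w x * shift_field x) = yco t - yco s.
Proof.
move=> s0 st tpi; rewrite (C1_FTC st (C1S s0 tpi C1_yco)); apply: itg_eq => x xst.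
rewrite /coef_w /shift_field mulrCA divff ?mulr1// expf_neq0// r_neq0//.
exact: (sub_itvcc s0 tpi).
Qed.

(** The derivative of the volume with respect to the pressure.  Since
    tany' = x' K / sigma with K = P - g y, the integrand differs from
    - tany y' dB/dy, where B = sigma y (K + P) / K^3, by the derivative of a
    function that vanishes with the height; and dB/dy > 0. *)
Lemma itg_coef_w_press_field : itg 0 pi (fun t => coef_w t * press_field t) < 0.
Proof.
have cus : cont 0 pi shift_field by case: C1_shift_field.
have cv : cont 0 pi press_field by case: C1_press_field.
pose Bk t := sigma * (yco t * (press t + P)) * (press t)^-1 ^+ 3.
pose pk t := sigma * yco' t ^+ 2 / speed t * (2 / press t ^+ 2 +
  3 * g * yco t * (press t + P) / press t ^+ 4).
have kV := C1V C1_press k_neq0.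
have CB := C1M (C1Z sigma (C1M C1_yco (C1D C1_press (C1_cst 0 pi P))))
  (C1M kV (C1M kV kV)).
have CG := C1B (C1M C1_tany CB) (C1Z P (C1M C1_press_int C1_yco)).
have lw : L1 0 pi (fun t => coef_w t * press_field t).
  by apply: L1_cont; apply: contM => //; exact: cont_coef_w.
have cpk : cont 0 pi pk.
  apply: contM.
    apply: contM; last by apply: contV => // t; exact: N_neq0.
    by apply: contM; [exact: cont_cst|exact: contX].
  have kX n t : t \in `[0, pi] -> press t ^+ n != 0 by move=> t0; rewrite expf_neq0// k_neq0.
  apply: contD.
    by apply: contM; [exact: cont_cst|apply: contV; [exact: contX|exact: kX]].
  apply: contM; last by apply: contV; [exact: contX|exact: kX].
  by apply: contM; [apply: contM; [exact: cont_cst|]|apply: contD; [|exact: cont_cst]].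
have P0 : 0 < P by apply: le_lt_trans P_gtgH; rewrite mulr_ge0// ltW// H_gt0.
have tail0 t : t \in `[0, pi] -> 0 <= 3 * g * yco t * (press t + P) / press t ^+ 4.
  move=> t0; have y0 := yco_ge0 t0; have k0 := press_gt0 t0.
  apply: divr_ge0; last by apply: exprn_ge0; exact: ltW.
  apply: mulr_ge0; last by apply: addr_ge0; exact: ltW.
  by apply: mulr_ge0 => //; apply: mulr_ge0 => //; exact: ltW.
have pk0 t : t \in `[0, pi] -> 0 <= pk t.
  move=> t0; have y0 := yco_ge0 t0; have k0 := press_gt0 t0; have N0 := speed_gt0 t0.
  apply: mulr_ge0.
    by apply: divr_ge0; [apply: mulr_ge0; [exact: ltW|exact: sqr_ge0]|exact: ltW].
  apply: addr_ge0; last exact: tail0.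
  by apply: divr_ge0 => //; apply: exprn_ge0; exact: ltW.
have q_in : pi / 4 \in `]0, @pi R[.
  by rewrite in_itv/= divr_gt0//= ltr_pdivrMr// ltr_pMr// ltr1n.
have q_in' := subset_itv_oo_cc q_in.
have pkq : pk (pi / 4) != 0.
  rewrite gt_eqF// /pk.
  have y0 := yco_ge0 q_in'; have k0 := press_gt0 q_in'; have N0 := speed_gt0 q_in'.
  apply: mulr_gt0.
    rewrite divr_gt0// mulr_gt0// lt_neqAle sqr_ge0 andbT eq_sym sqrf_eq0.
    have [+ _] := tany_sign q_in'.
    have /[swap] /[apply] : pi / 4 < pi / 2 :> R.
      by rewrite ltr_pM2l// ltf_pV2 ?posrE// ltr_nat.
    by rewrite /tany => h; apply: contraTneq h => ->; rewrite mul0r ltxx.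
  apply: ltr_wpDr; first exact: tail0.
  by rewrite divr_gt0// exprn_gt0.
have pkI := itg_gt0 cpk pk0 q_in pkq.
have GF := C1_FTC pi0' CG.
have {}GF : 0 = itg 0 pi (fun t => coef_w t * press_field t + pk t).
  have e0 : forall A B C E : R, A * (sigma * (0 * B) * C) - P * (E * 0) = 0.
    by move=> *; ring.
  rewrite yco_0 yco_pi !e0 subrr in GF.
  rewrite [LHS]GF; apply: itg_eq => t t0.
  have rn := r_neq0 t0; have kn := k_neq0 t0; have Nn := N_neq0 t0.
  rewrite /coef_w /press_field /pk /shift_field /tany.
  have Pk : P = press t + g * yco t by rewrite /press; ring.
  rewrite Pk; move: kn; move: (press t) (press_int t) => k I kn.
  by field; rewrite rn kn Nn s_neq0.
rewrite itgD// in GF; last exact: L1_cont.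
by move: pkI GF; lra.
Qed.

Theorem drop_jacobi : jacobi_data pi (pi / 2) coef_a coef_b coef_w
  shift_field (fun t => shift_flux t / coef_a t) shift_flux press_field (fun t => press_flux t / coef_a t) press_flux.
Proof.
have H0 := H_gt0.
have k0 := k_neq0 half_in0pi'.
split.
- by have := half_in0pi; rewrite in_itv.
- exact: cont_coef_a.
- exact: cont_coef_b.
- exact: cont_coef_w.
- exact: coef_a_gt0.
- exact: C1_shift_field.
- exact: C1_shift_flux.
- by move=> t t0; rewrite mulrC divfK// a_neq0.
- by rewrite /shift_flux yco_0 mulr0 oppr0.
- by rewrite /shift_flux yco_pi mulr0 oppr0.
- exact: shift_field_half.
- rewrite mulf_neq0 ?invr_eq0 ?a_neq0// /shift_flux oppr_eq0 mulf_neq0//.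
  by rewrite gt_eqF// -/H.
- exact: shift_field_neq0.
- by rewrite itg_coef_w_shift_field// yco_0 yco_pi subrr.
- by rewrite itg_coef_w_shift_field// yco_0 subr0 gt_eqF.
- exact: C1_press_field.
- exact: C1_press_flux.
- by move=> t t0; rewrite mulrC divfK// a_neq0.
- by rewrite /press_flux yco_0 mul0r.
- by rewrite /press_flux yco_pi mul0r.
- rewrite /press_field shift_field_half mulr0 subr0.
  have -> : xco' (pi / 2) = tanx (pi / 2) * speed (pi / 2) by rewrite /tanx divfK// N_neq0.
  rewrite tanx_half mulN1r; apply: mulf_neq0.
    by apply: mulf_neq0; [rewrite oppr_eq0 N_neq0|rewrite gt_eqF].
  by rewrite invr_eq0 mulf_neq0// expf_neq0// r_neq0.
- exact: itg_coef_w_press_field.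
Qed.

End Drop.

(** * Equilibrium equation of a constrained minimizer *)

Section EulerLagrange.
Context {R : realType}.
Implicit Types (f r : R -> R).

Let pi0 : 0 < pi :> R. Proof. exact: pi_gt0. Qed.
Let pi0' : 0 <= pi :> R. Proof. exact: pi_ge0. Qed.

Lemma int0pi_eq f h : (forall t, t \in `]0, pi[ -> f t = h t) -> \int0pi f = \int0pi h.
Proof. by move=> fh; apply: eq_Rintegral => t; rewrite inE => /fh. Qed.

Lemma C1_Ck F f : C1 0 pi F f -> Ck_0pi 1 F.
Proof.
move=> [cF cf dF]; split => // j; case: j => // _; split.
  by move=> t t0; have [] := dF t t0.
exists f; split => // t t0 /=.
by rewrite derive1E; have [_ ->] := dF t t0.
Qed.

Lemma C1_derive1 F f t : C1 0 pi F f -> t \in `]0, pi[ -> derive1 F t = f t.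
Proof. by move=> [_ _ dF] t0; rewrite derive1E; have [_ ->] := dF t t0. Qed.

(** The continuous extensions of the derivatives form a chain of C^1 functions
    on the closed interval. *)
Lemma smooth_C1 r : smooth_0pi r -> exists r1 r2 r3,
  [/\ C1 0 pi r r1, C1 0 pi r1 r2, C1 0 pi r2 r3 &
      forall t, t \in `]0, pi[ -> derive1 r t = r1 t /\ derive1n 2 r t = r2 t].
Proof.
move=> sr; have [cr Hr] := sr 3%N.
have [d0 [r1 [cr1 e1]]] := Hr 0%N isT.
have [d1 [r2 [cr2 e2]]] := Hr 1%N isT.
have [d2 [r3 [cr3 e3]]] := Hr 2%N isT.
have step n (f h h' : R -> R) : (forall t, t \in `]0, pi[ -> derivable (derive1n n r) t 1) ->
    (forall t, t \in `]0, pi[ -> derive1n n r t = h t) ->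
    (forall t, t \in `]0, pi[ -> derive1n n.+1 r t = h' t) ->
    cont 0 pi h -> cont 0 pi h' -> C1 0 pi h h'.
  move=> d eh eh' ch ch'; split => // t t0.
  apply: (@near_eq_is_derive _ _ _ (derive1n n r)).
    by apply: filterS (near_in_itvoo t0) => s /eh.
  rewrite -eh'//= derive1E; exact/derivableP/d.
exists r1, r2, r3; split.
- exact: (step 0%N r).
- exact: (step 1%N r).
- exact: (step 2%N r).
- by move=> t t0; rewrite -e2// -e1.
Qed.

(** Concavity.  An upper bound of the perturbed length is all that minimality
    calls for, and this one is quadratic in the perturbation. *)
Lemma sqrt_le_tangent (x y : R) : 0 <= x -> 0 < y ->
  Num.sqrt x <= Num.sqrt y + (x - y) / (2 * Num.sqrt y).
Proof.
move=> x0 y0; have v0 : 0 < Num.sqrt y by rewrite sqrtr_gt0.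
rewrite -{2}(sqr_sqrtr x0) -{2}(sqr_sqrtr (ltW y0)).
rewrite -lerBlDl ler_pdivlMr ?mulr_gt0//.
by have := sqr_ge0 (Num.sqrt x - Num.sqrt y); move: (Num.sqrt x) (Num.sqrt y) => u v; nra.
Qed.

(** Take e of small modulus and of sign opposite to A. *)
Lemma linear_dominated (A K e0 : R) : 0 < e0 ->
  (forall e, `|e| <= e0 -> 0 <= e * A + K * e ^+ 2) -> A = 0.
Proof.
move=> e00 H; apply/eqP; apply: contraT => A0.
pose K' := `|K| + 1; have K0 : 0 < K' by rewrite ltr_wpDl.
pose d := Num.min e0 (`|A| / (2 * K')).
have A0' : 0 < `|A| by rewrite normr_gt0.
have d0 : 0 < d by rewrite lt_min e00 divr_gt0// mulr_gt0.
have de : d <= e0 by rewrite ge_min lexx.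
have dA : K' * d <= `|A| / 2.
  have : d <= `|A| / (2 * K') by rewrite ge_min lexx orbT.
  rewrite ler_pdivlMr ?mulr_gt0//; lra.
have KK : K <= K' by rewrite (le_trans (ler_norm _))// lerDl.
have dn : `|- (Num.sg A * d)| <= e0.
  by rewrite normrN normrM normr_sg A0 mul1r gtr0_norm.
have := H _ dn; rewrite sqrrN exprMn sqr_sg A0 mul1r mulNr mulrAC -normrEsg.
move: dA KK A0'; move: (`|A|) => a dA KK a0.
have : K * d ^+ 2 <= K' * d ^+ 2 by rewrite ler_wpM2r// sqr_ge0.
have : K' * d ^+ 2 <= a / 2 * d by rewrite expr2 mulrA ler_wpM2r// ltW.
have : 0 < a * d by rewrite mulr_gt0.
lra.
Qed.

Section Minimizer.
Context (g sigma V gamma : R) (r r1 : R -> R).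
Hypothesis g0 : 0 < g.
Hypothesis sigma0 : 0 < sigma.
Hypothesis V0 : 0 < V.
Hypothesis Cr : C1 0 pi r r1.
Hypothesis rmin : constrained_minimizer g sigma V gamma r.

Let r_pos : positive_0pi r. Proof. by case: rmin => -[]. Qed.
Let N t := Num.sqrt (r t ^+ 2 + r1 t ^+ 2).

Let q_gt0 t : t \in `[0, pi] -> 0 < r t ^+ 2 + r1 t ^+ 2.
Proof. by move=> t0; rewrite ltr_pwDl ?sqr_ge0// exprn_gt0// r_pos. Qed.
Let N_gt0 t : t \in `[0, pi] -> 0 < N t.
Proof. by move=> t0; rewrite sqrtr_gt0 q_gt0. Qed.
Let cr : cont 0 pi r. Proof. by case: Cr. Qed.
Let cr1 : cont 0 pi r1. Proof. by case: Cr. Qed.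
Let csin : cont 0 pi (@sin R). Proof. exact: (contT (@continuous_sin R)). Qed.

Lemma cont_sqrt_sumsq f h : cont 0 pi f -> cont 0 pi h ->
  cont 0 pi (fun t => Num.sqrt (f t ^+ 2 + h t ^+ 2)).
Proof.
move=> cf ch; apply: (@cont_comp _ 0 pi (fun t => f t ^+ 2 + h t ^+ 2) Num.sqrt).
  by apply: contD; exact: contM.
by move=> t _; exact: sqrt_continuous.
Qed.
Let cN : cont 0 pi N. Proof. exact: cont_sqrt_sumsq. Qed.
Let cNV : cont 0 pi (fun t => (N t)^-1).
Proof. by apply: contV => // t t0; rewrite gt_eqF// N_gt0. Qed.

Let Vr : itg 0 pi (fun t => r t ^+ 2) = V.
Proof.
by case: rmin => -[_ _ <-] _; rewrite int0piE//; apply: L1_cont; exact: contM.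
Qed.

Lemma energyE f f1 : C1 0 pi f f1 ->
  energy g sigma gamma f = g / 3 * itg 0 pi (fun t => f t ^+ 3 * sin t) +
    sigma * itg 0 pi (fun t => Num.sqrt (f t ^+ 2 + f1 t ^+ 2)) - gamma * (f 0 + f pi).
Proof.
move=> Cf; have [cf cf1 _] := Cf; rewrite /energy; congr (_ * _ + _ * _ - _).
  rewrite int0piE//; apply: L1_cont; apply: contM => //.
  by do 2 apply: contM => //.
rewrite -int0piE; last by apply: L1_cont; exact: cont_sqrt_sumsq.
by apply: int0pi_eq => t t0; rewrite (C1_derive1 Cf).
Qed.

(** The factor restores the volume of r + e z, which is V (1 + k e^2) because
    z is orthogonal to r; it differs from 1 at second order only. *)
Lemma rescaled_energy_le z z1 : C1 0 pi z z1 -> z 0 = 0 -> z pi = 0 ->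
  itg 0 pi (fun t => r t * z t) = 0 ->
  exists2 e0, 0 < e0 & forall e, `|e| <= e0 ->
    let k := itg 0 pi (fun t => z t ^+ 2) / V in
    let s := (Num.sqrt (1 + k * e ^+ 2))^-1 in
    energy g sigma gamma r <= energy g sigma gamma (fun t => s * (r t + e * z t)).
Proof.
move=> Cz z00 zpi rz0; have [cz cz1 _] := Cz.
have [m m01 rm] := EVT_min pi0' cr.
have [M M0 zM] := cont_bounded cz.
exists (r m / (2 * M)); first by rewrite divr_gt0 ?mulr_gt0// r_pos.
move=> e ee; cbv zeta; set k := _ / V; set s := (Num.sqrt _)^-1.
have k0 : 0 <= k by rewrite divr_ge0 ?(ltW V0)// itg_ge0// => *; exact: sqr_ge0.
have q0 : 0 < 1 + k * e ^+ 2 by rewrite ltr_pwDl// mulr_ge0 ?sqr_ge0.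
have s0 : 0 < s by rewrite invr_gt0 sqrtr_gt0.
have Cf := C1Z s (C1D Cr (C1Z e Cz)).
have [cf _ _] := Cf.
case: rmin => _; apply; split; first exact: C1_Ck Cf.
  move=> t t0; apply: mulr_gt0 => //.
  have := rm t t0; have rm0 := r_pos m01.
  have : `|e * z t| <= r m / 2.
    have -> : r m / 2 = r m / (2 * M) * M by field; rewrite gt_eqF.
    by rewrite normrM ler_pM// zM.
  by rewrite ler_norml => /andP[+ _]; lra.
rewrite int0piE; last by apply: L1_cont; exact: contM.
have lr : L1 0 pi (fun t => r t ^+ 2) by apply: L1_cont; exact: contM.
have lz : L1 0 pi (fun t => z t ^+ 2) by apply: L1_cont; exact: contM.
have lrz : L1 0 pi (fun t => r t * z t) by apply: L1_cont; exact: contM.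
rewrite (itg_eq (g := fun t => s ^+ 2 * (r t ^+ 2 + 2 * e * (r t * z t) + e ^+ 2 * z t ^+ 2))).
  have l1 := L1Z (2 * e) lrz; have l2 := L1Z (e ^+ 2) lz.
  rewrite (itgZ _ (L1D (L1D lr l1) l2)) (itgD (L1D lr l1) l2) (itgD lr l1).
  rewrite !itgZ// rz0 mulr0 addr0 Vr /s exprVn sqr_sqrtr ?(ltW q0)//.
  move: q0; rewrite /k; move: (itg _ _ _) => Z q0.
  have Vn : V != 0 by rewrite gt_eqF.
  have q1 : V + e ^+ 2 * Z = V * (1 + Z / V * e ^+ 2) by field.
  by rewrite q1 mulrCA mulVf ?mulr1// gt_eqF.
by move=> t _; ring.
Qed.

(** The energy increment is at most e times this expression plus K e^2: the
    cubic term is polynomial in e, the length is bounded by its tangent, and the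
    rescaling contributes at second order. *)
Lemma first_variation0 z z1 : C1 0 pi z z1 -> z 0 = 0 -> z pi = 0 ->
  itg 0 pi (fun t => r t * z t) = 0 ->
  g * itg 0 pi (fun t => r t ^+ 2 * sin t * z t) +
  sigma * itg 0 pi (fun t => (r t * z t + r1 t * z1 t) / N t) = 0.
Proof.
move=> Cz z00 zpi rz0; have [cz cz1 _] := Cz.
have [e1 e10 He] := rescaled_energy_le Cz z00 zpi rz0.
set k := itg 0 pi (fun t => z t ^+ 2) / V in He.
have k0 : 0 <= k by rewrite divr_ge0 ?(ltW V0)// itg_ge0// => *; exact: sqr_ge0.
set a1 := itg 0 pi (fun t => r t ^+ 2 * sin t * z t).
set h1 := itg 0 pi (fun t => (r t * z t + r1 t * z1 t) / N t).
pose a0 := itg 0 pi (fun t => r t ^+ 3 * sin t).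
pose a2 := itg 0 pi (fun t => r t * z t ^+ 2 * sin t).
pose a3 := itg 0 pi (fun t => z t ^+ 3 * sin t).
pose h0 := itg 0 pi N.
pose h2 := itg 0 pi (fun t => (z t ^+ 2 + z1 t ^+ 2) / (2 * N t)).
pose b := r 0 + r pi.
have la0 : L1 0 pi (fun t => r t ^+ 3 * sin t) by apply: L1_cont; apply: contM => //; exact: contX.
have la1 : L1 0 pi (fun t => r t ^+ 2 * sin t * z t).
  by apply: L1_cont; apply: contM => //; apply: contM => //; exact: contX.
have la2 : L1 0 pi (fun t => r t * z t ^+ 2 * sin t).
  by apply: L1_cont; apply: contM => //; apply: contM => //; exact: contX.
have la3 : L1 0 pi (fun t => z t ^+ 3 * sin t) by apply: L1_cont; apply: contM => //; exact: contX.
have lh0 : L1 0 pi N by exact: L1_cont.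
have lh1 : L1 0 pi (fun t => (r t * z t + r1 t * z1 t) / N t).
  by apply: L1_cont; apply: contM => //; apply: contD; exact: contM.
have lh2 : L1 0 pi (fun t => (z t ^+ 2 + z1 t ^+ 2) / (2 * N t)).
  apply: (L1_eq (f := fun t => 2^-1 * ((z t ^+ 2 + z1 t ^+ 2) * (N t)^-1))).
    by move=> t _; rewrite invfM mulrCA.
  by apply: L1Z; apply: L1_cont; apply: contM => //; apply: contD; exact: contX.
pose Ba := `|a0| + 3 * `|a1| + 3 * `|a2| + `|a3|.
pose Bh := `|h0| + `|h1| + `|h2|.
pose K := g / 3 * (3 * `|a2| + `|a3| + 3 * k * Ba) +
  sigma * (`|h2| + k * Bh) + `|gamma * b| * k.
apply: (@linear_dominated _ K (Num.min e1 1)); first by rewrite lt_min e10 ltr01.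
move=> e; rewrite le_min => /andP[ee1 ee].
have := He e ee1; rewrite /=; set s := _^-1.
have q0 : 0 <= k * e ^+ 2 by rewrite mulr_ge0 ?sqr_ge0.
have w1 : 1 <= Num.sqrt (1 + k * e ^+ 2) by rewrite -{1}(@sqrtr1 R) ler_wsqrtr// lerDl.
have w2 : Num.sqrt (1 + k * e ^+ 2) ^+ 2 = 1 + k * e ^+ 2.
  by rewrite sqr_sqrtr// addr_ge0.
have s0 : 0 < s by rewrite invr_gt0 (lt_le_trans _ w1).
have s1 : s <= 1 by rewrite invf_le1// (lt_le_trans _ w1).
have sk : 1 - s <= k * e ^+ 2.
  have sw : s * Num.sqrt (1 + k * e ^+ 2) = 1.
    by rewrite mulVf// gt_eqF// (lt_le_trans _ w1).
  have s2q : s ^+ 2 * (1 + k * e ^+ 2) = 1 by rewrite -w2 -exprMn sw expr1n.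
  have s2 : s ^+ 2 <= s by rewrite expr2 ler_piMl// ltW.
  have s2q' : s ^+ 2 * (k * e ^+ 2) <= k * e ^+ 2.
    by rewrite ler_piMl// (le_trans s2).
  by rewrite mulrDr mulr1 in s2q; lra.
have s3 : 0 <= 1 - s ^+ 3 <= 3 * (k * e ^+ 2).
  have -> : 1 - s ^+ 3 = (1 - s) * (1 + s + s ^+ 2) by ring.
  have s2 : 0 <= s ^+ 2 <= 1 by rewrite sqr_ge0 expr_le1// ltW.
  have b3 : 0 <= 1 + s + s ^+ 2 <= 3 by case/andP: s2 => *; lra.
  rewrite mulr_ge0 ?subr_ge0//=; last by case/andP: b3.
  rewrite mulrC ler_pM ?subr_ge0//; by case/andP: b3.
have Cf := C1Z s (C1D Cr (C1Z e Cz)).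
have [cf cf1 _] := Cf.
rewrite (energyE Cr) (energyE Cf) z00 zpi !mulr0 !addr0 -/a0 -/h0 -mulrDr -/b.
have -> : itg 0 pi (fun t => (s * (r t + e * z t)) ^+ 3 * sin t) =
    s ^+ 3 * (a0 + 3 * e * a1 + 3 * e ^+ 2 * a2 + e ^+ 3 * a3).
  rewrite (itg_eq (g := fun t => s ^+ 3 * (r t ^+ 3 * sin t +
    3 * e * (r t ^+ 2 * sin t * z t) + 3 * e ^+ 2 * (r t * z t ^+ 2 * sin t) +
    e ^+ 3 * (z t ^+ 3 * sin t)))); last by move=> t _; ring.
  have l1 := L1Z (3 * e) la1; have l2 := L1Z (3 * e ^+ 2) la2; have l3 := L1Z (e ^+ 3) la3.
  rewrite (itgZ _ (L1D (L1D (L1D la0 l1) l2) l3)) (itgD (L1D (L1D la0 l1) l2) l3).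
  by rewrite (itgD (L1D la0 l1) l2) (itgD la0 l1) !itgZ.
have hle : itg 0 pi (fun t => Num.sqrt ((s * (r t + e * z t)) ^+ 2 +
    (s * (r1 t + e * z1 t)) ^+ 2)) <= s * (h0 + e * h1 + e ^+ 2 * h2).
  have l1 := L1Z e lh1; have l2 := L1Z (e ^+ 2) lh2.
  rewrite -[e * h1](itgZ _ lh1) -[e ^+ 2 * h2](itgZ _ lh2) -(itgD lh0 l1).
  rewrite -(itgD (L1D lh0 l1) l2) -(itgZ _ (L1D (L1D lh0 l1) l2)).
  apply: itg_le; [by apply: L1_cont; exact: cont_sqrt_sumsq|by apply: L1Z; apply: L1D => //; exact: L1D|].
  move=> t t0; rewrite !exprMn -mulrDr sqrtrM ?sqr_ge0// sqrtr_sqr gtr0_norm// ler_pM2l//.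
  apply: (le_trans (sqrt_le_tangent _ (q_gt0 t0))); first by rewrite addr_ge0 ?sqr_ge0.
  rewrite -/(N t) le_eqVlt; apply/orP; left; apply/eqP.
  by field; rewrite gt_eqF// N_gt0.
have e2 : e ^+ 2 <= 1 by rewrite -real_normK ?num_real// expr_le1.
have nb (c x y : R) : `|c| <= 1 -> c * x <= `|x|.
  move=> c1; apply: le_trans (ler_norm _) _; rewrite normrM ler_piMl//.
have e2n : `|e ^+ 2| <= 1 by rewrite normrX expr_le1.
have e3n : `|e ^+ 3| <= 1 by rewrite normrX expr_le1.
set A := a0 + 3 * e * a1 + 3 * e ^+ 2 * a2 + e ^+ 3 * a3.
set B := h0 + e * h1 + e ^+ 2 * h2 in hle *.
have AB : `|A| <= Ba.
  rewrite /A /Ba (le_trans (ler_normD _ _))// lerD//; last by rewrite normrM ler_piMl.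
  rewrite (le_trans (ler_normD _ _))// lerD//; last first.
    by rewrite -mulrA normrM [ `|3|]ger0_norm// ler_pM2l// normrM ler_piMl.
  rewrite (le_trans (ler_normD _ _))// lerD//.
  by rewrite -mulrA normrM [ `|3|]ger0_norm// ler_pM2l// normrM ler_piMl.
have BB : `|B| <= Bh.
  rewrite /B /Bh (le_trans (ler_normD _ _))// lerD//; last by rewrite normrM ler_piMl.
  by rewrite (le_trans (ler_normD _ _))// lerD// normrM ler_piMl.
have D3 : - ((1 - s ^+ 3) * A) <= 3 * (k * e ^+ 2) * Ba.
  apply: le_trans (ler_norm _) _; rewrite normrN normrM.
  by case/andP: s3 => s30 s31; apply: ler_pM => //; rewrite ger0_norm.
have D1 : - ((1 - s) * B) <= k * e ^+ 2 * Bh.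
  apply: le_trans (ler_norm _) _; rewrite normrN normrM.
  by apply: ler_pM => //; rewrite ger0_norm// subr_ge0.
have Db : (1 - s) * (gamma * b) <= k * e ^+ 2 * `|gamma * b|.
  apply: le_trans (ler_norm _) _; rewrite normrM.
  by apply: ler_pM => //; rewrite ger0_norm// subr_ge0.
have T2 : e ^+ 2 * a2 <= e ^+ 2 * `|a2| by rewrite ler_wpM2l ?sqr_ge0// ler_norm.
have T3 : e ^+ 3 * a3 <= e ^+ 2 * `|a3|.
  rewrite exprSr -mulrA ler_wpM2l ?sqr_ge0//; exact: nb.
have Th : e ^+ 2 * h2 <= e ^+ 2 * `|h2| by rewrite ler_wpM2l ?sqr_ge0// ler_norm.
move=> HE.
have HA : s ^+ 3 * A - a0 <= 3 * e * a1 +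
    e ^+ 2 * (3 * `|a2| + `|a3| + 3 * k * Ba).
  have -> : s ^+ 3 * A - a0 = - ((1 - s ^+ 3) * A) + (A - a0) by ring.
  rewrite {2}/A; lra.
have HB : s * B - h0 <= e * h1 + e ^+ 2 * (`|h2| + k * Bh).
  have -> : s * B - h0 = - ((1 - s) * B) + (B - h0) by ring.
  rewrite {2}/B; lra.
have g3 : 0 < g / 3 by rewrite divr_gt0.
have GA := ler_wpM2l (ltW g3) HA.
have SB := ler_wpM2l (ltW sigma0) HB.
have Sh := ler_wpM2l (ltW sigma0) hle.
rewrite /K.
have -> : e * (g * a1 + sigma * h1) + (g / 3 * (3 * `|a2| + `|a3| + 3 * k * Ba) +
  sigma * (`|h2| + k * Bh) + `|gamma * b| * k) * e ^+ 2 =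
  g / 3 * (3 * e * a1 + e ^+ 2 * (3 * `|a2| + `|a3| + 3 * k * Ba)) +
  sigma * (e * h1 + e ^+ 2 * (`|h2| + k * Bh)) + k * e ^+ 2 * `|gamma * b| by field.
move: HE GA SB Sh Db; rewrite (mulrCA gamma s b) -/A.
move: (itg 0 pi _) (gamma * b) => I c HE GA SB Sh Db.
lra.
Qed.

(** The multiplier P is read off from the direction [sin]; subtracting a
    multiple of it makes any other direction admissible. *)
Lemma first_variation : exists P, forall z z1, C1 0 pi z z1 -> z 0 = 0 -> z pi = 0 ->
  g * itg 0 pi (fun t => r t ^+ 2 * sin t * z t) +
  sigma * itg 0 pi (fun t => (r t * z t + r1 t * z1 t) / N t) =
  P * itg 0 pi (fun t => r t * z t).
Proof.
pose G z := itg 0 pi (fun t => r t ^+ 2 * sin t * z t).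
pose S z z1 := itg 0 pi (fun t => (r t * z t + r1 t * z1 t) / N t).
pose I z := itg 0 pi (fun t => r t * z t).
have Isin : 0 < I sin.
  apply: (@itg_gt0 _ _ _ _ (pi / 2)); [exact: contM| |exact: half_in0pi|].
    by move=> t t0; rewrite mulr_ge0 ?sin_ge0_pi// ltW// r_pos.
  by rewrite sin_pihalf mulr1 gt_eqF// r_pos//; apply: subset_itv_oo_cc; exact: half_in0pi.
exists ((g * G sin + sigma * S sin cos) / I sin) => z z1 Cz z0 zpi.
rewrite -/(G z) -/(S z z1) -/(I z).
pose l := I z / I sin.
have [cz cz1 _] := Cz; have Csin := C1_sin (R := R) 0 pi.
have [_ ccos _] := Csin.
have Cz' := C1B Cz (C1Z l Csin).
have lI : forall f, cont 0 pi f -> L1 0 pi (fun t => r t * f t).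
  by move=> f cf; apply: L1_cont; exact: contM.
have lG : forall f, cont 0 pi f -> L1 0 pi (fun t => r t ^+ 2 * sin t * f t).
  by move=> f cf; apply: L1_cont; apply: contM => //; apply: contM => //; exact: contM.
have lS : forall f h, cont 0 pi f -> cont 0 pi h ->
    L1 0 pi (fun t => (r t * f t + r1 t * h t) / N t).
  by move=> f h cf ch; apply: L1_cont; apply: contM => //; apply: contD; exact: contM.
have := first_variation0 Cz' _ _ _.
rewrite sin0 sinpi z0 zpi !mulr0 subrr => /(_ erefl erefl) H.
have {}H : g * (G z - l * G sin) + sigma * (S z z1 - l * S sin cos) = 0.
  rewrite -[RHS]H; last first.
    rewrite (itg_eq (g := fun t => r t * z t - l * (r t * sin t))).
      rewrite (itgB (lI z cz) (L1Z l (lI _ csin))) (itgZ l (lI _ csin)).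
      by rewrite -/(I z) -/(I sin) /l divfK ?subrr// gt_eqF.
    by move=> t _; ring.
  congr (_ * _ + _ * _).
  - rewrite -[l * _](itgZ l (lG _ csin)) -(itgB (lG _ cz) (L1Z l (lG _ csin))).
    by apply: itg_eq => t _; ring.
  - rewrite -[l * _](itgZ l (lS _ _ csin ccos)).
    rewrite -(itgB (lS _ _ cz cz1) (L1Z l (lS _ _ csin ccos))).
    by apply: itg_eq => t _; ring.
have In : I sin != 0 by rewrite gt_eqF.
have -> : (g * G sin + sigma * S sin cos) / I sin * I z = l * (g * G sin + sigma * S sin cos).
  by rewrite /l; field.
lra.
Qed.

Hypothesis r_sym : forall t, t \in `[0, pi] -> r (pi - t) = r t.
Context (r2 r3 : R -> R).
Hypothesis Cr1 : C1 0 pi r1 r2.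
Hypothesis Cr2 : C1 0 pi r2 r3.

Lemma symmetric_derive_half : r1 (pi / 2) = 0.
Proof.
have hh : pi - pi / 2 = pi / 2 :> R by move: (@pi R) => p; field.
have [_ _ dr] := Cr; have d := dr _ (@half_in0pi R).
have d2 : is_derive (pi / 2) 1 (fun t : R => pi - t) (- 1).
  have := @is_deriveB R R R (fun=> pi) id (pi / 2) 1 0 1 _ _.
  by rewrite sub0r; apply.
have d' : is_derive (pi - pi / 2) 1 r (r1 (pi / 2)) by rewrite hh.
have d3 : is_derive (pi / 2) 1 (r \o (fun t : R => pi - t)) (r1 (pi / 2) * -1).
  exact: is_derive1_comp.
have d4 : is_derive (pi / 2) 1 r (r1 (pi / 2) * -1).
  apply: near_eq_is_derive d3; apply: filterS (near_in_itvoo (@half_in0pi R)) => t t0 /=.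
  by rewrite r_sym//; exact: subset_itv_oo_cc.
have e : r1 (pi / 2) = r1 (pi / 2) * -1.
  by case: d d4 => _ <- [_ <-].
by move: e; rewrite mulrN1 => e; lra.
Qed.

(** After integration by parts the equation reads int E z = 0 for every z
    that vanishes at the ends; take z = E sin, where E is the residual. *)
Lemma minimizer_drop_profile : exists P, drop_profile g sigma P r r1 r2.
Proof.
have [P HP] := first_variation; exists P.
split => //; first exact: symmetric_derive_half.
have N_neq0 t : t \in `[0, pi] -> N t != 0 by move=> t0; rewrite gt_eqF// N_gt0.
have Cq : C1 0 pi (fun t => r t ^+ 2 + r1 t ^+ 2) (fun t => 2 * (r1 t * (r t + r2 t))).
  apply: C1_eq (C1D (C1M Cr Cr) (C1M Cr1 Cr1)) => t _; ring.
have CN : C1 0 pi N (fun t => r1 t * (r t + r2 t) * (N t)^-1).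
  apply: C1_eq (C1_sqrt Cq q_gt0) => t t0; rewrite -/(N t); field; exact: N_neq0.
have CNV := C1V CN N_neq0.
have Cm := C1M Cr1 CNV.
pose m t := r2 t * (N t)^-1 - r1 t * r1 t * (r t + r2 t) * ((N t)^-1 * ((N t)^-1 * (N t)^-1)).
pose E t := g * (r t * r t * sin t) + sigma * (r t * (N t)^-1) - sigma * m t - P * r t.
have Csin := C1_sin (R := R) 0 pi.
have [E1 CE] : exists E1, C1 0 pi E E1.
  have CM := C1B (C1M Cr2 CNV) (C1M (C1M (C1M Cr1 Cr1) (C1D Cr Cr2)) (C1M CNV (C1M CNV CNV))).
  eexists; exact: (C1B (C1B (C1D (C1Z g (C1M (C1M Cr Cr) Csin))
    (C1Z sigma (C1M Cr CNV))) (C1Z sigma CM)) (C1Z P Cr)).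
have [cE _ _] := CE.
have Cz := C1M CE Csin.
have [cz cz1 _] := Cz.
have := HP _ _ Cz _ _; rewrite sin0 sinpi !mulr0 => /(_ erefl erefl) H.
have cm : cont 0 pi m.
  case: Cm => _ cm _; apply: cont_eq cm => t t0; rewrite /m; field; exact: N_neq0.
have [_ IBP] := ACM pi0' (C1_AC Cm) (C1_AC Cz).
have := IBP 0 pi (lexx 0) pi0' (lexx pi).
rewrite sin0 sinpi !mulr0 subrr => {}IBP.
have lsE f : cont 0 pi f -> L1 0 pi (fun t => f t * (E t * sin t)).
  by move=> cf; apply: L1_cont; exact: contM.
have EE : itg 0 pi (fun t => E t * (E t * sin t)) = 0.
  have cr2 : cont 0 pi (fun t => r t * r t * sin t) by apply: contM => //; exact: contM.
  have crN : cont 0 pi (fun t => r t * (N t)^-1) by exact: contM.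
  have cr1N : cont 0 pi (fun t => r1 t * (N t)^-1) by exact: contM.
  pose Z1 t := E1 t * sin t + E t * cos t.
  have lZ1 : L1 0 pi (fun t => r1 t * (N t)^-1 * Z1 t) by apply: L1_cont; exact: contM.
  have H1 : itg 0 pi (fun t => r t ^+ 2 * sin t * (E t * sin t)) =
      itg 0 pi (fun t => (r t * r t * sin t) * (E t * sin t)).
    by apply: itg_eq => t _; ring.
  have H2 : itg 0 pi (fun t => (r t * (E t * sin t) + r1 t * Z1 t) / N t) =
      itg 0 pi (fun t => (r t * (N t)^-1) * (E t * sin t)) +
      itg 0 pi (fun t => r1 t * (N t)^-1 * Z1 t).
    rewrite -(itgD (lsE _ crN) lZ1); apply: itg_eq => t _; ring.
  have H3 : 0 = itg 0 pi (fun t => m t * (E t * sin t)) +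
      itg 0 pi (fun t => r1 t * (N t)^-1 * Z1 t).
    rewrite [LHS]IBP -(itgD (lsE _ cm) lZ1); apply: itg_eq => t t0; rewrite /m /Z1.
    by field; exact: N_neq0.
  have l1 := L1Z g (lsE _ cr2); have l2 := L1Z sigma (lsE _ crN).
  have l3 := L1Z sigma (lsE _ cm); have l4 := L1Z P (lsE _ cr).
  rewrite (itg_eq (g := fun t => g * ((r t * r t * sin t) * (E t * sin t)) +
    sigma * ((r t * (N t)^-1) * (E t * sin t)) - sigma * (m t * (E t * sin t)) -
    P * (r t * (E t * sin t)))); last by move=> t _; rewrite {1}/E; ring.
  rewrite (itgB (L1B (L1D l1 l2) l3) l4) (itgB (L1D l1 l2) l3) (itgD l1 l2).
  rewrite (itgZ _ (lsE _ cr2)) (itgZ _ (lsE _ crN)) (itgZ _ (lsE _ cm)) (itgZ _ (lsE _ cr)).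
  move: H; rewrite H1 H2 => H; rewrite -H mulrDr.
  have -> : itg 0 pi (fun t => r1 t * (N t)^-1 * Z1 t) = - itg 0 pi (fun t => m t * (E t * sin t)).
    by apply/eqP; rewrite -addr_eq0 addrC -H3.
  by ring.
move=> t t0; have t0' := subset_itv_oo_cc t0.
have E0 : E t = 0.
  have cEE : cont 0 pi (fun t => E t * (E t * sin t)) by exact: contM.
  apply/eqP; apply: contraT => Et.
  have := itg_gt0 cEE _ t0 _; rewrite EE ltxx; apply.
    by move=> s s0; rewrite mulrA -expr2 mulr_ge0 ?sqr_ge0// sin_ge0_pi.
  by rewrite mulrA !mulf_neq0// gt_eqF// sin_gt0_pi.
have rn : r t != 0 by rewrite gt_eqF// r_pos.
have Nn := N_neq0 t t0'.
have N2 : N t ^+ 2 = r t ^+ 2 + r1 t ^+ 2 by rewrite sqr_sqrtr// ltW// q_gt0.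
rewrite -/(N t); apply: (mulfI rn).
have : N t ^+ 3 * E t = 0 by rewrite E0 mulr0.
have -> : N t ^+ 3 * E t = g * r t ^+ 2 * sin t * N t ^+ 3 + sigma * (r t * N t ^+ 2) -
    sigma * (r2 t * N t ^+ 2 - r1 t ^+ 2 * (r t + r2 t)) - P * r t * N t ^+ 3.
  by rewrite /E /m; field.
rewrite N2 => h; apply/eqP; rewrite -subr_eq0 -[X in _ == X]h; apply/eqP; ring.
Qed.

End Minimizer.
End EulerLagrange.

(** * Horizontal translations in polar coordinates *)

Section Shift.
Context {R : realType}.
Context (r r1 : R -> R).
Hypothesis Cr : C1 0 pi r r1.
Hypothesis r_pos : positive_0pi r.

Let pi0 : 0 < pi :> R. Proof. exact: pi_gt0. Qed.
Let pi0' : 0 <= pi :> R. Proof. exact: pi_ge0. Qed.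

(** The point of parameter [s], shifted by [c], has polar coordinates
    (l, t). *)
Definition on_ray (c t s l : R) : Prop :=
  [/\ s \in `[0, pi], 0 < l, r s * cos s + c = l * cos t & r s * sin s = l * sin t].

Lemma sin_eq0_0pi (s : R) : s \in `[0, pi] -> sin s = 0 -> s = 0 \/ s = pi.
Proof.
rewrite in_itv/= => /andP[]; rewrite le_eqVlt => /predU1P[<-|s0]; first by left.
rewrite le_eqVlt => /predU1P[->|spi]; first by right.
by have := @sin_gt0_pi _ s; rewrite s0 spi => /(_ isT) /[swap] ->; rewrite ltxx.
Qed.

Let cr : cont 0 pi r. Proof. by case: Cr. Qed.
Let cr1 : cont 0 pi r1. Proof. by case: Cr. Qed.
Let Cy := C1M Cr (C1_sin (R := R) 0 pi).
Let Cx := C1M Cr (C1_cos (R := R) 0 pi).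

(** The first condition keeps the two ends of the curve on their sides of the
    origin.  The second is the positivity of x y' - y x' for the shifted curve,
    that is of its angular velocity about the origin. *)
Definition small_shift (c : R) := (forall s, s \in `[0, pi] -> `|c| < r s) /\
  forall s, s \in `[0, pi] -> 0 < r s ^+ 2 + c * (r1 s * sin s + r s * cos s).

Lemma small_shift_near : \forall c \near (0 : R), small_shift c.
Proof.
have [m m01 rm] := EVT_min pi0' cr; have rm0 : 0 < r m by exact: r_pos.
have [_ cdy _] := Cy.
have [M M0 yM] := cont_bounded cdy.
pose d := Num.min (r m) (r m ^+ 2 / M).
have d0 : 0 < d by rewrite lt_min rm0 divr_gt0// exprn_gt0.
have : 0 \in `](- d), d[ by rewrite in_itv/= oppr_lt0 d0.
move/near_in_itvoo; apply: filterS => c; rewrite in_itv/= -ltr_norml => cd.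
have c1 : `|c| < r m by apply: lt_le_trans cd _; rewrite ge_min lexx.
have c2 : `|c| * M < r m ^+ 2.
  by rewrite -ltr_pdivlMr//; apply: lt_le_trans cd _; rewrite ge_min lexx orbT.
split=> s s0; first exact: lt_le_trans (rm s s0).
have h1 : r m ^+ 2 <= r s ^+ 2 by rewrite ler_pXn2r ?nnegrE ?(ltW rm0) ?(ltW (r_pos s0))// rm.
have h2 : `|c * (r1 s * sin s + r s * cos s)| <= `|c| * M.
  by rewrite normrM ler_wpM2l// yM.
by move: h2; rewrite ler_norml => /andP[h2 _]; lra.
Qed.

Section SmallShift.
Context (c : R).
Hypothesis cs : small_shift c.

Let c_bounds s : s \in `[0, pi] -> 0 < r s + c /\ 0 < r s - c.
Proof. by move=> s0; have := cs.1 s s0; rewrite ltr_norml => /andP[? ?]; split; lra. Qed.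

Let zero_in : 0 \in `[0, @pi R]. Proof. by rewrite in_itv/= lexx. Qed.
Let pi_in : pi \in `[0, @pi R]. Proof. by rewrite in_itv/= lexx pi0'. Qed.

Lemma on_ray0 : on_ray c 0 0 (r 0 + c).
Proof.
by split=> //; [case: (c_bounds zero_in)|rewrite cos0 !mulr1|rewrite sin0 !mulr0].
Qed.

Lemma on_raypi : on_ray c pi pi (r pi - c).
Proof.
split=> //; [by case: (c_bounds pi_in)| |by rewrite sinpi !mulr0].
by rewrite cospi; ring.
Qed.

(** The cross product with the direction of angle t changes sign along the
    shifted curve. *)
Lemma on_ray_exists t : t \in `[0, pi] -> exists s l, on_ray c t s l.
Proof.
move=> t01; have [st|st] := eqVneq (sin t) 0.
  have [->|->] := sin_eq0_0pi t01 st; first by exists 0, (r 0 + c); exact: on_ray0.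
  by exists pi, (r pi - c); exact: on_raypi.
have st0 : 0 < sin t by rewrite lt_neqAle eq_sym st sin_ge0_pi.
pose K s := r s * sin s * cos t - r s * cos s * sin t - c * sin t.
have cK : cont 0 pi K.
  have [cy _ _] := Cy; have [cx _ _] := Cx.
  apply: contB; last exact: cont_cst.
  by apply: contB; apply: contM => //; exact: cont_cst.
have K0 : K 0 < 0.
  have -> : K 0 = - ((r 0 + c) * sin t) by rewrite /K sin0 cos0; ring.
  by rewrite oppr_lt0 mulr_gt0//; case: (c_bounds zero_in).
have Kpi : 0 < K pi.
  have -> : K pi = (r pi - c) * sin t by rewrite /K sinpi cospi; ring.
  by rewrite mulr_gt0//; case: (c_bounds pi_in).
have [s s0 Ks] : exists2 s, s \in `[0, pi] & K s = 0.
  apply: IVT => //; rewrite min_l ?max_r ?(ltW (lt_trans K0 Kpi))//.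
  by rewrite (ltW K0) (ltW Kpi).
have ss : sin s != 0.
  apply/eqP => /(sin_eq0_0pi s0)[] se; move: Ks; rewrite se => e.
    by move: K0; rewrite e ltxx.
  by move: Kpi; rewrite e ltxx.
have ss0 : 0 < sin s by rewrite lt_neqAle eq_sym ss sin_ge0_pi.
exists s, (r s * sin s / sin t); split => //.
- by rewrite divr_gt0// mulr_gt0// r_pos.
- apply: (mulIf st); rewrite [RHS]mulrAC divfK//.
  by move: Ks; rewrite /K; lra.
- by rewrite divfK.
Qed.

Lemma on_ray_sin0 t s l : on_ray c t s l -> sin t = 0 -> sin s = 0.
Proof.
move=> [s0 _ _ e] st; move: e; rewrite st mulr0 => /eqP.
by rewrite mulf_eq0 gt_eqF ?r_pos//= => /eqP.
Qed.

(** The cotangent of the polar angle of the shifted point. *)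
Let slope s := (r s * cos s + c) * (r s * sin s)^-1.

Lemma slope_decr s s' : 0 < s -> s < s' -> s' < pi -> slope s' < slope s.
Proof.
move=> s0 ss' s'pi.
have sub x : x \in `[s, s'] -> x \in `[0, pi] /\ 0 < sin x.
  rewrite !in_itv/= => /andP[sx xs']; have x0 := lt_le_trans s0 sx.
  have xpi := le_lt_trans xs' s'pi.
  by rewrite (ltW x0) (ltW xpi) sin_gt0_pi// x0.
have yn x : x \in `[s, s'] -> r x * sin x != 0.
  by move=> /sub[x0 sx]; rewrite mulf_neq0 ?gt_eqF// r_pos.
have Cx' := C1S (ltW s0) (ltW s'pi) Cx; have Cy' := C1S (ltW s0) (ltW s'pi) Cy.
have CK := C1N (C1M (C1D Cx' (C1_cst s s' c)) (C1V Cy' yn)).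
rewrite -ltrN2; apply: (C1_incr CK) => // x xss'.
have xss := subset_itv_oo_cc xss'; have [x0 sx] := sub x xss.
have rn : r x != 0 by rewrite gt_eqF// r_pos.
have sn : sin x != 0 by rewrite gt_eqF.
rewrite (_ : - _ = (r x ^+ 2 + c * (r1 x * sin x + r x * cos x)) / (r x * sin x) ^+ 2).
  by rewrite divr_gt0 ?(cs.2 x x0)// exprn_gt0// mulr_gt0// r_pos.
have := cos2Dsin2 x; move: rn sn; move: (cos x) (sin x) => co si rn sn e.
have -> : r x ^+ 2 + c * (r1 x * si + r x * co) =
  r x ^+ 2 * (co ^+ 2 + si ^+ 2) + c * (r1 x * si + r x * co) by rewrite e mulr1.
by field; rewrite rn sn.
Qed.

(** Off the axis this is the monotonicity of [slope]; on the axis the two end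
    points lie on opposite sides of the origin. *)
Lemma on_ray_inj t s l s' l' : on_ray c t s l -> on_ray c t s' l' -> s = s' /\ l = l'.
Proof.
suff H : forall s l s' l', on_ray c t s l -> on_ray c t s' l' -> ~ s < s'.
  move=> h h'; have e : s = s'.
    by case: (ltgtP s s') => // ss; [case: (H _ _ _ _ h h')|case: (H _ _ _ _ h' h)].
  split => //; move: h h' => [_ l0 c1 s1] [_ l0' c2 s2]; subst s'.
  have : (l - l') * cos t = 0 by rewrite mulrBl -c1 -c2 subrr.
  have : (l - l') * sin t = 0 by rewrite mulrBl -s1 -s2 subrr.
  move=> /eqP; rewrite mulf_eq0 => /orP[/eqP + _|/eqP st]; first by lra.
  move/eqP; rewrite mulf_eq0 => /orP[/eqP|/eqP ct]; first by lra.
  by have := cos2Dsin2 t; rewrite st ct !expr0n addr0 => /esym/eqP; rewrite oner_eq0.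
move=> {}s {}l {}s' {}l' h h' ss'; have [st|st] := eqVneq (sin t) 0.
  have s_0 := on_ray_sin0 h st; have s'_0 := on_ray_sin0 h' st.
  move: h h' ss' => [s0 l0 c1 _] [s0' l0' c2 _].
  have [es|es] := sin_eq0_0pi s0 s_0; have [es'|es'] := sin_eq0_0pi s0' s'_0;
    subst s s'; rewrite ?ltxx// => ss'.
    have [+ _] := c_bounds zero_in; have [_ +] := c_bounds pi_in.
    move: c1 c2; rewrite cos0 cospi mulr1 mulrN1 => c1 c2.
    have ct2 : cos t ^+ 2 = 1 by have := cos2Dsin2 t; rewrite st expr0n addr0.
    move=> a b; have : (r 0 + c) * (- r pi + c) = l * l'.
      by rewrite c1 c2 mulrACA -expr2 ct2 mulr1.
    have := mulr_gt0 l0 l0'; have := mulr_gt0 a b; lra.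
  by move: ss'; rewrite ltNge pi0'.
have s_n : sin s != 0 /\ 0 < s < pi.
  case: h => [s0 l0 _ e]; have sn : sin s != 0.
    apply/eqP => ss; move: e; rewrite ss mulr0 => /esym/eqP.
    by rewrite mulf_eq0 (negbTE st) gt_eqF.
  split=> //; move: s0; rewrite in_itv/= !le_eqVlt => /andP[/predU1P[e0|->] /predU1P[e1|->]]//.
  - by move: sn; rewrite -e0 sin0 eqxx.
  - by move: sn; rewrite -e0 sin0 eqxx.
  - by move: sn; rewrite e1 sinpi eqxx.
have s'_n : sin s' != 0 /\ 0 < s' < pi.
  case: h' => [s0 l0 _ e]; have sn : sin s' != 0.
    apply/eqP => ss; move: e; rewrite ss mulr0 => /esym/eqP.
    by rewrite mulf_eq0 (negbTE st) gt_eqF.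
  split=> //; move: s0; rewrite in_itv/= !le_eqVlt => /andP[/predU1P[e0|->] /predU1P[e1|->]]//.
  - by move: sn; rewrite -e0 sin0 eqxx.
  - by move: sn; rewrite -e0 sin0 eqxx.
  - by move: sn; rewrite e1 sinpi eqxx.
have := slope_decr (proj1 (andP s_n.2)) ss' (proj2 (andP s'_n.2)).
have E s0 l0 : on_ray c t s0 l0 -> slope s0 = cos t / sin t.
  move=> [_ l00 ec es]; rewrite /slope ec es; field.
  by rewrite st gt_eqF.
by rewrite (E _ _ h) (E _ _ h') ltxx.
Qed.

Lemma on_ray_angle s : s \in `[0, pi] -> exists2 t, t \in `[0, pi] &
  exists l, on_ray c t s l.
Proof.
move=> s0; set X := r s * cos s + c; set Y := r s * sin s.
have Y0 : 0 <= Y by rewrite mulr_ge0 ?sin_ge0_pi// ltW// r_pos.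
have q0 : 0 < X ^+ 2 + Y ^+ 2.
  rewrite lt_neqAle addr_ge0 ?sqr_ge0// andbT eq_sym paddr_eq0 ?sqr_ge0//.
  rewrite !sqrf_eq0; apply/negP => /andP[/eqP X0 /eqP Y00].
  have [a b] := c_bounds s0.
  have : sin s = 0.
    by move: Y00 => /eqP; rewrite mulf_eq0 gt_eqF ?r_pos//= => /eqP.
  move/(sin_eq0_0pi s0) => [] e; move: X0 a b; rewrite /X e ?cos0 ?cospi; lra.
set l := Num.sqrt (X ^+ 2 + Y ^+ 2); have l0 : 0 < l by rewrite sqrtr_gt0.
have l2 : l ^+ 2 = X ^+ 2 + Y ^+ 2 by rewrite sqr_sqrtr// ltW.
have Xl : (X / l) ^+ 2 <= 1.
  by rewrite expr_div_n l2 ler_pdivrMr// mul1r lerDl sqr_ge0.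
have Xl1 : -1 <= X / l <= 1.
  rewrite -ler_norml -(expr_le1 (n := 2))//.
  by rewrite real_normK// num_real.
have Yl : Num.sqrt (1 - (X / l) ^+ 2) = Y / l.
  have -> : 1 - (X / l) ^+ 2 = (Y / l) ^+ 2.
    rewrite !expr_div_n l2; field; rewrite gt_eqF//.
  by rewrite sqrtr_sqr ger0_norm// divr_ge0// ltW.
exists (acos (X / l)); first by rewrite in_itv/= acos_ge0 ?acos_lepi.
exists l; split=> //.
- by rewrite acosK// [RHS]mulrC divfK// gt_eqF.
- by rewrite sin_acos// Yl [RHS]mulrC divfK// gt_eqF.
Qed.

Lemma shifted_profile_ray f t s l : is_shifted_profile r c f -> t \in `[0, pi] ->
  on_ray c t s l -> f t = l.
Proof.
move=> [fpos fE] t0 h.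
have : polar_curve f (f t * cos t, f t * sin t) by exists t.
rewrite fE => -[s' s'0 [e1 e2]].
have h' : on_ray c t s' (f t) by split => //; exact: fpos.
by have [_ ->] := on_ray_inj h' h.
Qed.

Lemma shifted_profileP : is_shifted_profile r c (shifted_profile r c).
Proof.
have [f Hf] : exists f : R -> R, forall t, t \in `[0, pi] -> exists s, on_ray c t s (f t).
  have /choice[f Hf] : forall t, exists l, t \in `[0, pi] -> exists s, on_ray c t s l.
    move=> t; have [t0|t0] := boolP (t \in `[0, pi]); last by exists 0.
    by have [s [l h]] := on_ray_exists t0; exists l => _; exists s.
  by exists f.
apply: (@xgetPex _ r [set f | is_shifted_profile r c f]); exists f; split.
  by move=> t t0; have [s []] := Hf t t0.
apply/seteqP; split=> [_ [t t0 <-]|_ [s s0 <-]].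
  by have [s [s0 l0 <- <-]] := Hf t t0; exists s.
have [t t0 [l h]] := on_ray_angle s0; have [s' h'] := Hf t t0.
have [_ e] := on_ray_inj h' h; exists t => //.
by rewrite e; case: h => _ _ <- <-.
Qed.

End SmallShift.

(** At the ends the shifted radius is r(0) + c or r(pi) - c.  Inside, the
    parameter of the point on the ray of angle t is the local inverse of
    [K : s |-> c]. *)
Lemma shifted_profile_derive t : t \in `[0, pi] ->
  is_derive (0 : R) (1 : R) (fun c => shifted_profile r c t) (cos t + r1 t / r t * sin t).
Proof.
move=> t01; have ns := small_shift_near.
have val c s l : small_shift c -> on_ray c t s l -> shifted_profile r c t = l.
  by move=> cs; apply: shifted_profile_ray => //; exact: shifted_profileP.
have [st|st] := eqVneq (sin t) 0.
  rewrite st mulr0 addr0; have [te|te] := sin_eq0_0pi t01 st.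
    rewrite te cos0.
    apply: (@near_eq_is_derive _ _ _ (fun c => r 0 + c)).
      apply: filterS ns => c cs; apply/esym; rewrite -te.
      by apply: (val c 0) => //; rewrite te; exact: on_ray0.
    by have := @is_deriveD R R R (fun=> r 0) id 0 1 0 1 _ _; rewrite add0r; apply.
  rewrite te cospi.
  apply: (@near_eq_is_derive _ _ _ (fun c => r pi - c)).
    apply: filterS ns => c cs; apply/esym; rewrite -te.
    by apply: (val c pi) => //; rewrite te; exact: on_raypi.
  by have := @is_deriveB R R R (fun=> r pi) id 0 1 0 1 _ _; rewrite sub0r; apply.
have st0 : 0 < sin t by rewrite lt_neqAle eq_sym st sin_ge0_pi.
have t0 : t \in `]0, pi[.
  have t_0 : t != 0 by apply: contraNneq st => ->; rewrite sin0.
  have t_pi : t != pi by apply: contraNneq st => ->; rewrite sinpi.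
  by move: t01; rewrite !in_itv/= !lt_neqAle t_pi eq_sym t_0.
have tn : r t != 0 by rewrite gt_eqF// r_pos.
(* the shift and the radius of the point of parameter s on the ray of angle t *)
pose K s := (r s * sin s * cos t - r s * cos s * sin t) / sin t.
pose L s := r s * sin s / sin t.
have rayK s : s \in `]0, pi[ -> on_ray (K s) t s (L s).
  move=> s0; have s0' := subset_itv_oo_cc s0.
  have ss0 : 0 < sin s by apply: sin_gt0_pi; move: s0; rewrite in_itv.
  split => //; first by rewrite divr_gt0// mulr_gt0// r_pos.
  - by rewrite /K /L; field.
  - by rewrite /L divfK.
have Kt : K t = 0 by rewrite /K; field.
have [cy cy1 dy] := Cy; have [cx _ dx] := Cx.
have CK := C1Z (sin t)^-1 (C1B (C1Z (cos t) Cy) (C1Z (sin t) Cx)).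
have CL := C1Z (sin t)^-1 Cy.
have KE : K = fun s => (sin t)^-1 * (cos t * (r s * sin s) - sin t * (r s * cos s)).
  by apply/funext => s; rewrite /K mulrC; congr (_ * _); ring.
have LE : L = fun s => (sin t)^-1 * (r s * sin s) by apply/funext => s; rewrite /L mulrC.
have dK s : s \in `]0, pi[ -> derivable K s 1.
  by move=> s0; rewrite KE; case: CK => _ _ /(_ s s0) [].
have dKt : is_derive t 1 K (r t / sin t).
  rewrite KE; case: CK => _ _ /(_ t t0); congr is_derive.
  have := cos2Dsin2 t; move: st; move: (cos t) (sin t) => co si st e.
  have -> : r t / si = r t * (co ^+ 2 + si ^+ 2) / si by rewrite e mulr1.
  by field.
have dLt : is_derive t 1 L ((r1 t * sin t + r t * cos t) / sin t).
  by rewrite LE; case: CL => _ _ /(_ t t0); rewrite mulrC.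
have nK : \forall s \near t, small_shift (K s).
  have cK : {for t, continuous K}.
    by apply: differentiable_continuous; apply/derivable1_diffP; exact: dK.
  by apply: cK; rewrite Kt.
pose gs c := xget 0 [set s | exists l, on_ray c t s l].
have gsP c : small_shift c -> exists l, on_ray c t (gs c) l.
  move=> cs; apply: (@xgetPex _ 0 [set s | exists l, on_ray c t s l]).
  by have [s [l h]] := on_ray_exists cs t01; exists s, l.
have gK : {near t, cancel K gs}.
  near=> s.
  have s0 : s \in `]0, pi[ by near: s; exact: near_in_itvoo.
  have cs : small_shift (K s) by near: s.
  have [l h] := gsP _ cs.
  by have [-> _] := on_ray_inj cs h (rayK s s0).
have cKn : {near t, continuous K}.
  apply: filterS (near_in_itvoo t0) => s s0.
  by apply: differentiable_continuous; apply/derivable1_diffP; exact: dK.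
have ln : r t / sin t != 0 by rewrite mulf_neq0 ?invr_eq0.
have := is_derive_inverse gK cKn dKt ln; rewrite Kt => dg.
have g0 : gs 0 = t by rewrite -[in gs 0]Kt; exact: (nbhs_singleton gK).
have dL0 : is_derive (gs 0) 1 L ((r1 t * sin t + r t * cos t) / sin t) by rewrite g0.
have dc : is_derive (0 : R) (1 : R) (L \o gs) ((r1 t * sin t + r t * cos t) / sin t * (r t / sin t)^-1).
  exact: is_derive1_comp.
have -> : cos t + r1 t / r t * sin t =
    (r1 t * sin t + r t * cos t) / sin t * (r t / sin t)^-1 by field; rewrite st tn.
apply: near_eq_is_derive dc; apply: filterS ns => c cs /=.
have [l h] := gsP c cs; rewrite (val c (gs c) l cs h) /L.
by case: h => _ _ _ ->; rewrite mulfK.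
Unshelve. all: by end_near. Qed.

End Shift.

(** * Kernel of the second variation *)

Section SecondVariation.
Context {R : realType}.
Notation mu := (@lebesgue_measure R).
Context (g sigma P : R) (r r1 r2 : R -> R).
Hypothesis D : drop_profile g sigma P r r1 r2.
Hypothesis r1E : forall t, t \in `]0, pi[ -> derive1 r t = r1 t.
Hypothesis r2E : forall t, t \in `]0, pi[ -> derive1n 2 r t = r2 t.

Let pi0 : 0 < pi :> R. Proof. exact: pi_gt0. Qed.
Let pi0' : 0 <= pi :> R. Proof. exact: pi_ge0. Qed.
Let Cr := drop_r D.
Let Cr1 := drop_r1 D.
Let N := speed r r1.
Let zeta t := r t * shift_field r r1 t.

Lemma cont_ae0 (f : R -> R) : cont 0 pi f ->
  {ae mu, forall t, t \in `]0, pi[ -> f t = 0} -> forall t, t \in `[0, pi] -> f t = 0.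
Proof.
move=> cf f0; apply: cont_eq0_closed => // t t0; apply/eqP; apply: contraT => ft.
have cf2 : cont 0 pi (fun t => f t * f t) by exact: contM.
have := itg_gt0 cf2 _ t0 _.
rewrite (itg_ae_eq (g := fun=> 0)); last 3 first.
- exact: L1_cont.
- by apply: L1_cont; exact: cont_cst.
- by apply: aeS f0 => s /[apply] ->; rewrite mul0r.
rewrite itg_cst// mul0r ltxx; apply; last by rewrite mulf_neq0.
by move=> s _; rewrite -expr2 sqr_ge0.
Qed.

Lemma shiftE t : t \in `[0, pi] -> cos t + r1 t / r t * sin t = zeta t.
Proof.
by move=> t0; rewrite /zeta /shift_field /yco'; field; rewrite gt_eqF// (drop_gt0 D).
Qed.

Section H1.
Context (xi dxi u0 : R -> R).
Hypothesis mxi : measurable_fun `]0, pi[ xi.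
Hypothesis l2d : L2 0 pi dxi.
Hypothesis ACu0 : AC 0 pi u0 dxi.
Hypothesis xiE : {ae mu, forall t, t \in `]0, pi[ -> xi t = u0 t}.

Let u t := u0 t * (r t)^-1.
Let p t := dxi t * (r t)^-1 + u0 t * (- r1 t / r t ^+ 2).

Let rn t : t \in `[0, pi] -> r t != 0.
Proof. by move=> t0; rewrite gt_eqF// (drop_gt0 D). Qed.
Let Nn t : t \in `[0, pi] -> N t != 0.
Proof. by move=> t0; rewrite gt_eqF// (speed_gt0 D). Qed.
Let cr : cont 0 pi r. Proof. by case: Cr. Qed.
Let cr1 : cont 0 pi r1. Proof. by case: Cr. Qed.
Let cr2 : cont 0 pi r2. Proof. by case: Cr1. Qed.
Let CrV := C1V Cr rn.
Let cu0 := AC_cont pi0' ACu0.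
Let csin : cont 0 pi (@sin R). Proof. exact: (contT (@continuous_sin R)). Qed.

Lemma quotient_AC : AC 0 pi u p.
Proof. exact: (ACM pi0' ACu0 (C1_AC CrV)). Qed.

Lemma quotient_L2 : L2 0 pi p.
Proof.
have [crV crV1 _] := CrV.
apply: L2D; last by apply: L2_cont; exact: contM.
have := L2M crV l2d; congr L2; apply/funext => t; exact: mulrC.
Qed.

Let measurable_open (f : R -> R) : cont 0 pi f -> measurable_fun `]0, pi[ f.
Proof.
move=> cf; have := subspace_continuous_measurable_fun (measurable_itv `[0, pi]) cf.
by apply: measurable_funS => //; exact: subset_itv_oo_cc.
Qed.

Let mdxi : measurable_fun `]0, pi[ dxi.
Proof. by case: l2d => + _; apply: measurable_funS => //; exact: subset_itv_oo_cc. Qed.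

Lemma mean_quotient :
  \int0pi (fun t => xi t * r t) = itg 0 pi (fun t => coef_w r t * u t).
Proof.
rewrite (int0pi_ae (g := fun t => u0 t * r t)).
- by apply: itg_eq => t t0; rewrite /coef_w /u; field; exact: rn.
- by apply: measurable_funM => //; exact: measurable_open.
- by apply: L1_cont; exact: contM.
- by apply: aeS xiE => t /[apply] ->.
Qed.

Let cNV : cont 0 pi (fun t => (N t)^-1).
Proof.
by have [cN _ _] := C1_speed D; apply: contV.
Qed.
Let cNV3 : cont 0 pi (fun t => (N t)^-1 * ((N t)^-1 * (N t)^-1)).
Proof. by apply: contM => //; exact: contM. Qed.

(** The equilibrium equation replaces the curvature by P - g y, and the terms
    in the derivative combine into the square of r xi' - r' xi, that is of
    r^2 u'. *)
Lemma second_variation_qform : weak_derivative xi = dxi ->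
  second_variation g sigma r xi = qform (coef_a sigma r r1) (coef_b g P r) 0 pi u p.
Proof.
move=> dE; rewrite /second_variation dE.
pose n3 t := (N t)^-1 * ((N t)^-1 * (N t)^-1).
pose A t := (N t)^-1 - (r t * r t + 2 * (r1 t * r1 t) - r2 t * r t + r t * r t) * n3 t.
pose B t := (N t)^-1 - r1 t * r1 t * n3 t.
pose C t := - (2 * (r t * r1 t) * n3 t).
have c2 (f : R -> R) : cont 0 pi f -> cont 0 pi (fun t => 2 * f t).
  by move=> cf; apply: contM => //; exact: cont_cst.
have cA : cont 0 pi A.
  apply: contB => //; apply: contM => //; apply: contD; last exact: contM.
  apply: contB; last exact: contM.
  by apply: contD; [exact: contM|apply: c2; exact: contM].
have cB : cont 0 pi B by apply: contB => //; apply: contM => //; exact: contM.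
have cC : cont 0 pi C by apply: contN; apply: contM => //; apply: c2; exact: contM.
have lA : L1 0 pi (fun t => A t * (u0 t * u0 t)).
  by apply: L1_cont; apply: contM => //; exact: contM.
have lB : L1 0 pi (fun t => B t * dxi t ^+ 2) by apply: L1M => //; case: l2d.
have lC : L1 0 pi (fun t => C t * (u0 t * dxi t)).
  by apply: L1M => //; apply: L1M => //; exact: L2_L1.
have lG : L1 0 pi (fun t => r t * sin t * (u0 t * u0 t)).
  by apply: L1_cont; apply: contM; exact: contM.
have lF := L1D (L1D lA lB) lC.
rewrite (int0pi_ae (g := fun t => r t * sin t * (u0 t * u0 t))) //; last 2 first.
- apply: measurable_funM; last exact: measurable_open.
  by apply: measurable_funM; [exact: measurable_open|exact: measurable_funM].
- by apply: aeS xiE => t /[apply] ->; ring.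
rewrite [X in _ + sigma * X](_ : _ = itg 0 pi (fun t => A t * (u0 t * u0 t) +
    B t * dxi t ^+ 2 + C t * (u0 t * dxi t))); last first.
  rewrite -(int0pi_ae (f := fun t => A t * (xi t * xi t) + B t * dxi t ^+ 2 +
    C t * (xi t * dxi t)))//; last 2 first.
  - apply: measurable_funD; [apply: measurable_funD|]; apply: measurable_funM;
      try (by exact: measurable_open); exact: measurable_funM.
  - by apply: aeS xiE => t /[apply] ->.
  apply: int0pi_eq => t t0; rewrite r1E// r2E// -/(speed2 r r1 t) -/(speed r r1 t) -/(N t).
  rewrite /A /B /C /n3; field; exact: Nn (subset_itv_oo_cc t0).
rewrite -(itgZ g lG) -(itgZ sigma lF) -(itgD (L1Z g lG) (L1Z sigma lF)).
rewrite -int0piE; last by apply: L1D; exact: L1Z.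
rewrite /qform -int0piE; last exact: (L1_qform (drop_jacobi D) quotient_AC quotient_L2).
apply: int0pi_eq => t t0; have t0' := subset_itv_oo_cc t0.
have E := equilibriumE D t0; have r0 := rn t0'; have N0 := Nn t0'; have N2 := speed_sqr D t0'.
have s0 : sigma != 0 by rewrite gt_eqF// (drop_sigma D).
have NV : (N t)^-1 = (r t ^+ 2 + r1 t ^+ 2) * n3 t by rewrite -N2 /n3 -/(N t); field.
have Nk : n3 t * (press g P r t * N t ^+ 3 / sigma) = press g P r t / sigma.
  by rewrite /n3; field; rewrite s0 N0.
have -> : A t = r1 t ^+ 2 * n3 t - press g P r t / sigma.
  by rewrite -Nk /A -E NV; ring.
have -> : B t = r t ^+ 2 * n3 t by rewrite /B NV; ring.
have -> : coef_a sigma r r1 t = sigma * r t ^+ 4 * n3 t.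
  by rewrite /coef_a /n3 -/(N t); field.
rewrite /C /coef_b /u /p /press; move: (n3 t) => n.
rewrite /yco; field; by rewrite r0 s0.
Qed.

(** Continuous functions equal almost everywhere are equal. *)
Lemma kernel_ae : (exists C, forall t, t \in `[0, pi] -> u t = C * shift_field r r1 t) <->
  exists C : R, {ae mu, forall t, t \in `]0, pi[ -> xi t = C * zeta t}.
Proof.
split=> -[C HC]; exists C.
  apply: aeS xiE => t xt t0; have t0' := subset_itv_oo_cc t0.
  by rewrite xt// /zeta mulrCA -HC// /u mulrC divfK// rn.
have cz : cont 0 pi zeta by apply: contM => //; case: (C1_shift_field D).
have ae0 : {ae mu, forall t, t \in `]0, pi[ -> u0 t - C * zeta t = 0}.
  by apply: aeS2 xiE HC => s h1 h2 s0; rewrite -h1// -h2// subrr.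
move=> t t0; have e := cont_ae0 (contB cu0 (contM (@cont_cst _ 0 pi C) cz)) ae0 t0.
have {e}-> : u t = C * zeta t * (r t)^-1 by rewrite /u; congr (_ * _); move: e; lra.
by rewrite /zeta; field; exact: rn.
Qed.

End H1.

Lemma second_variation_kernel xi : H1_0pi xi -> \int0pi (fun t => xi t * r t) = 0 ->
  second_variation g sigma r xi = 0 <->
  exists C : R, {ae mu, forall t, t \in `]0, pi[ -> xi t = C * zeta t}.
Proof.
move=> [l2xi Hw] mean.
have [l2d wd] : L2_0pi (weak_derivative xi) /\ is_weak_derivative xi (weak_derivative xi).
  by apply: (@xgetPex _ (fun=> 0) [set eta | L2_0pi eta /\ is_weak_derivative xi eta]).
have [u0 [ACu0 xiE]] := weak_derivative_AC l2xi l2d wd.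
have mxi : measurable_fun `]0, pi[ xi by case: l2xi.
have {}l2d : L2 0 pi (weak_derivative xi) by exact/L2_0piP.
rewrite (second_variation_qform mxi l2d ACu0 xiE erefl).
rewrite -(kernel_ae ACu0 xiE).
apply: (jacobi_kernel (drop_jacobi D) (quotient_AC ACu0) (quotient_L2 l2d ACu0)).
by rewrite -(mean_quotient mxi ACu0 xiE).
Qed.

Lemma zeta_span xi : ae_span zeta xi ->
  H1_0pi xi /\ \int0pi (fun t => xi t * r t) = 0.
Proof.
move=> [mxi [C xiC]].
have CZ := C1Z C (C1M Cr (C1_shift_field D)).
split; first exact: (C1_ae_H1 CZ mxi xiC).
have [cz _ _] := CZ; have [cr _ _] := Cr.
rewrite (int0pi_ae (g := fun t => C * (coef_w r t * shift_field r r1 t))).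
- have [cus _ _] := C1_shift_field D.
  have lw : L1 0 pi (fun t => coef_w r t * shift_field r r1 t).
    by apply: L1_cont; apply: contM => //; exact: contM.
  by rewrite itgZ// (jac_us_mean (drop_jacobi D)) mulr0.
- apply: measurable_funM => //.
  have := subspace_continuous_measurable_fun (measurable_itv `[0, pi]) cr.
  by apply: measurable_funS => //; exact: subset_itv_oo_cc.
- apply: L1Z; apply: L1_cont; apply: contM; first exact: contM.
  by case: (C1_shift_field D).
- by apply: aeS xiC => t /[apply] ->; rewrite /zeta /coef_w; ring.
Qed.

End SecondVariation.

Unset Implicit Arguments.

Theorem theorem1p2 (R : realType) (g sigma V gamma : R) (rho0 : R -> R)
    (g_gt0 : 0 < g) (sigma_gt0 : 0 < sigma) (V_gt0 : 0 < V)
    (gamma_lt : `|gamma| < sigma)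
    (rho0_eq : equilibrium_profile g sigma V gamma rho0) :
  ((\forall c \near (0 : R), is_shifted_profile rho0 c (shifted_profile rho0 c)) /\
   (forall t : R, t \in `[0, pi] ->
      derivable (fun c : R => shifted_profile rho0 c t) 0 1 /\
      horizontal_shift rho0 t = cos t + derive1 rho0 t / rho0 t * sin t)) /\
  ((forall xi : R -> R, H1_0pi xi ->
      \int0pi (fun t => xi t * rho0 t) = 0 ->
      (second_variation g sigma rho0 xi = 0 <->
       exists C : R, {ae @lebesgue_measure R, forall t : R,
         t \in `]0, pi[ -> xi t = C * horizontal_shift rho0 t})) /\
   second_variation_ker g sigma rho0 = ae_span (horizontal_shift rho0)).
Proof.
have [smooth rho0_pos rho0_sym rho0_min] := rho0_eq.
have [r1 [r2 [r3 [Cr Cr1 Cr2 rE]]]] := smooth_C1 smooth.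
have [P D] := minimizer_drop_profile g_gt0 sigma_gt0 V_gt0 Cr rho0_min rho0_sym Cr1 Cr2.
have r1E t : t \in `]0, pi[ -> derive1 rho0 t = r1 t by move=> /rE[].
have r2E t : t \in `]0, pi[ -> derive1n 2 rho0 t = r2 t by move=> /rE[].
have shift t : t \in `[0, pi] -> horizontal_shift rho0 t = cos t + r1 t / rho0 t * sin t.
  move=> t0; rewrite /horizontal_shift derive1E.
  by have [_ ->] := shifted_profile_derive Cr rho0_pos t0.
pose zeta t := rho0 t * shift_field rho0 r1 t.
have aeE xi : (exists C : R, {ae @lebesgue_measure R, forall t : R,
      t \in `]0, pi[ -> xi t = C * horizontal_shift rho0 t}) <->
    (exists C : R, {ae @lebesgue_measure R, forall t : R,
      t \in `]0, pi[ -> xi t = C * zeta t}).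
  have e t : t \in `]0, pi[ -> horizontal_shift rho0 t = zeta t.
    by move=> t0; rewrite shift ?(shiftE D)//; exact: subset_itv_oo_cc.
  by split=> -[C HC]; exists C; (apply: aeS HC);
    move=> t H t0; rewrite H// e.
have kerE xi : H1_0pi xi -> \int0pi (fun t => xi t * rho0 t) = 0 ->
    (second_variation g sigma rho0 xi = 0 <->
     exists C : R, {ae @lebesgue_measure R, forall t : R,
       t \in `]0, pi[ -> xi t = C * horizontal_shift rho0 t}).
  by move=> h m; rewrite aeE; exact: (second_variation_kernel D).
split; split.
- apply: filterS (small_shift_near Cr rho0_pos) => c cs.
  exact: (shifted_profileP Cr rho0_pos cs).
- move=> t t0; have [d _] := shifted_profile_derive Cr rho0_pos t0; split=> //.
  rewrite shift//; have [st|st] := eqVneq (sin t) 0; first by rewrite st !mulr0.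
  rewrite r1E//.
  have t_0 : t != 0 by apply: contraNneq st => ->; rewrite sin0.
  have t_pi : t != pi by apply: contraNneq st => ->; rewrite sinpi.
  by move: t0; rewrite !in_itv/= !lt_neqAle t_pi eq_sym t_0.
- exact: kerE.
- apply/seteqP; split=> xi.
    move=> [h m s]; split; first by case: h => -[].
    exact/kerE.
  move=> [mxi hC].
  have [h m] : H1_0pi xi /\ \int0pi (fun t => xi t * rho0 t) = 0.
    by apply: (zeta_span D); split => //; apply/aeE.
  by split => //; apply/kerE.
Qed.
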